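(* Let $0<c\le\infty$ and let $(M,\phi)$ be a $c$ log-convergent nuclear $\sigma$-module ordinary at slope zero, with unit root part $(U_0,\phi_0)$. Then for each integer $k>0$, the unit root zeta function $L(\phi_0^k,T)$ is meromorphic in the open disc $|T|_\pi<p^{\min(k,c)}$.
   Context: Let $p$ be a prime, $q$ a power of $p$, $K/\mathbf Q_p$ finite with residue field $\mathbf F_q$, uniformizer $\pi$, ring of integers $R$, $\mathrm{ord}_\pi\pi=1$, $|\pi|_\pi=1/p$. Fix $n\ge1$; $A_0=\{\sum_{u\in\mathbf Z^n}a_uX^u:a_u\in R,a_u\to0\text{ as }|u|\to\infty\}$ with Gauss norm, $\sigma(X^u)=X^{qu}$ ($R$-linear). A nuclear $\sigma$-module $(M,\phi)$: $M$ = all formal sums $\sum_{i\in I}a_ie_i$ ($a_i\in A_0$, $I\subseteq\mathbf Z_{>0}$ at most countable) with norm $\max\|a_i\|$; $\phi(\sum a_ie_i)=\sum\sigma(a_i)\phi(e_i)$, $\|\phi(e_i)\|\to0$. Matrix $B(X)=\sum_uB_uX^u$ via $\phi(e_j)=\sum_ib_{ij}e_i$; $c$ log-convergent: for some basis $\liminf_{|u|\to\infty}\mathrm{ord}_\pi B_u/\log_q|u|\ge c$. For a closed point $\bar x$ of $\mathbf G_m^n/\mathbf F_q$ of degree $d$ with Teichmüller lift $x$, $B_{\bar x}=B(x)B(x^q)\cdots B(x^{q^{d-1}})$. Ordinary at slope zero: for some basis, with $h_0$ the smallest integer such that $\phi(e_j)\equiv0\pmod\pi$ for $j>h_0$, every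 Fredholm determinant $\det(I-B_{\bar x}T)$ has exactly $h_0$ unit reciprocal zeros (with multiplicity). $L(\phi_0^k,T)=\prod_{\bar x}\prod_\alpha(1-\alpha^kT^{\deg\bar x})^{-1}$, $\alpha$ over the unit reciprocal zeros of $\det(I-B_{\bar x}T)$; this is the $L$-function of the $k$-th power of the unit root part $(U_0,\phi_0)$, the $\phi$-stable free rank-$h_0$ submodule of the Hodge–Newton decomposition. *)

(* Defs.v *)
From HB Require Import structures.
From mathcomp Require Import all_boot all_order all_algebra all_field finmap.
From mathcomp Require Import all_classical all_reals all_analysis.

Set Implicit Arguments.
Unset Strict Implicit.
Unset Printing Implicit Defensive.

Import Order.TTheory GRing.Theory Num.Theory.
Import numFieldNormedType.Exports.

Local Open Scope classical_set_scope.
Local Open Scope ring_scope.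

(** * Non-archimedean absolute values and unordered sums *)

Section AbsoluteValues.
Context {R : realType}.

Record ultrametric_abs (F : fieldType) (abs : F -> R) : Prop := UltrametricAbs {
  abs_ge0 : forall x, 0 <= abs x;
  abs_eq0 : forall x, abs x = 0 <-> x = 0;
  absM : forall x y, abs (x * y) = abs x * abs y;
  abs_ultra : forall x y, abs (x + y) <= Num.max (abs x) (abs y)
}.

Definition abs_complete (F : fieldType) (abs : F -> R) : Prop :=
  forall s : nat -> F,
    (forall e : R, 0 < e ->
       \forall N \near \oo,
         forall i j, (N <= i)%N -> (N <= j)%N -> abs (s i - s j) < e) ->
    exists l, abs (s i - l) @[i --> \oo] --> (0 : R).

(* [F] is Q_p: the completion of Q for the absolute value with
   |m|_p = p ^ - v_p(m) for every integer m > 0 (so F has characteristic 0). *)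
Record is_padic_numbers (p : nat) (F : fieldType) (abs : F -> R) : Prop := {
  Qp_abs : ultrametric_abs abs;
  Qp_padic : forall m : nat, (0 < m)%N -> abs m%:R = p%:R ^- logn p m;
  Qp_dense : forall (x : F) (e : R), 0 < e -> exists r : rat, abs (x - ratr r) < e;
  Qp_complete : abs_complete abs
}.

(* [red], restricted to the valuation ring {|x| <= 1}, is the reduction map
   onto the residue field [k]; its values elsewhere are irrelevant. *)
Record is_residue_map (F k : fieldType) (abs : F -> R) (red : F -> k) : Prop := {
  red1 : red 1 = 1;
  redD : forall x y, abs x <= 1 -> abs y <= 1 -> red (x + y) = red x + red y;
  redM : forall x y, abs x <= 1 -> abs y <= 1 -> red (x * y) = red x * red y;
  red_eq0 : forall x, abs x <= 1 -> (red x = 0 <-> abs x < 1);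
  red_surj : forall y, exists2 x, abs x <= 1 & red x = y
}.

(* [s] is the sum of the family [f] along the directed set of finite subsets
   of [T]; over a complete ultrametric field this exists iff f tends to 0. *)
Definition is_sum (V : zmodType) (norm : V -> R) (T : choiceType) (f : T -> V)
    (s : V) : Prop :=
  forall e : R, 0 < e -> exists A : {fset T}, forall B : {fset T},
    (A `<=` B)%fset -> norm (s - \sum_(i <- B) f i) < e.

(* equal to 0 if the family is not summable *)
Definition tsum (V : zmodType) (norm : V -> R) (T : choiceType) (f : T -> V) : V :=
  xget 0 [set s | is_sum norm f s].

End AbsoluteValues.

(** * Formal power series, as sequences of coefficients *)

Section PowerSeries.
Variable A : comNzRingType.

Definition ps_one : nat -> A := fun m => (m == 0%N)%:R.

Definition ps_mul (f g : nat -> A) : nat -> A :=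
  fun m => \sum_(i < m.+1) f i * g (m - i)%N.

(* (1 - a T^d)^-1 = \sum_j a^j T^(d j), for 0 < d *)
Definition ps_euler (a : A) (d : nat) : nat -> A :=
  fun m => if (d %| m)%N then a ^+ (m %/ d) else 0.

Let trunc (f : nat -> A) N : {poly A} := \poly_(i < N.+1) f i.

Let ps_mulE f g N m : (m <= N)%N -> ps_mul f g m = (trunc f N * trunc g N)`_m.
Proof.
move=> mN; rewrite coefM; apply: eq_bigr => i _.
have iN : (i < N.+1)%N by rewrite (leq_trans (ltn_ord i)).
by rewrite !coef_poly iN ltnS (leq_trans (leq_subr _ _) mN).
Qed.

Lemma ps_mulC : commutative ps_mul.
Proof. by move=> f g; apply/funext => m; rewrite !(ps_mulE _ _ (leqnn m)) mulrC. Qed.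

Lemma ps_mulA : associative ps_mul.
Proof.
move=> f g h; apply/funext => m; rewrite !(ps_mulE _ _ (leqnn m)).
have E u v w : (trunc u m * trunc (ps_mul v w) m)`_m =
               (trunc u m * (trunc v m * trunc w m))`_m.
  rewrite !coefM; apply: eq_bigr => i _; congr (_ * _).
  by rewrite coef_poly ltnS leq_subr (ps_mulE _ _ (leq_subr i m)).
by rewrite E [in RHS]mulrC E mulrA mulrC mulrA.
Qed.

Lemma ps_mul1 : left_id ps_one ps_mul.
Proof.
move=> f; apply/funext => m; rewrite /ps_mul big_ord_recl big1 => [|i _].
  by rewrite /ps_one /= mul1r addr0 subn0.
by rewrite /ps_one /= mul0r.
Qed.

HB.instance Definition _ := Monoid.isComLaw.Build (nat -> A) ps_one ps_mul
  ps_mulA ps_mulC ps_mul1.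

End PowerSeries.

(** * The base field K and its ambient field *)

(* [Om] is an arbitrary complete algebraically closed valued extension of K
   (for instance C_p), in which Teichmueller points and reciprocal zeros of
   Fredholm determinants live.  Its residue field [kOm] is algebraically
   closed and contains an algebraic closure of F_q. *)
Structure padic_setting (R : realType) (p q : nat) := PadicSetting {
  Qp : fieldType;
  absQp : Qp -> R;
  QpP : is_padic_numbers p absQp;
  K : fieldExtType Qp;
  absK : K -> R;
  absK_ultra : ultrametric_abs absK;
  absK_Qp : exists2 e : nat, (0 < e)%N & forall x : Qp, absK x%:A = absQp x ^+ e;
  uniformizer : K;
  uniformizer_abs : absK uniformizer = p%:R^-1;
  uniformizer_max : forall x, absK x < 1 -> absK x <= absK uniformizer;
  Fq : finFieldType;
  card_Fq : #|Fq| = q;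
  redK : K -> Fq;
  redKP : is_residue_map absK redK;
  Om : closedFieldType;
  absOm : Om -> R;
  absOm_ultra : ultrametric_abs absOm;
  Om_complete : abs_complete absOm;
  iotaK : {rmorphism K -> Om};
  absOm_iota : forall x, absOm (iotaK x) = absK x;
  kOm : fieldType;
  redOm : Om -> kOm;
  redOmP : is_residue_map absOm redOm
}.

Section SigmaModules.
Context {R : realType} {p q : nat} (D : padic_setting R p q) (n : nat).

Local Notation K := (K D).
Local Notation Om := (Om D).
Local Notation kOm := (kOm D).
Local Notation absK := (@absK _ _ _ D).
Local Notation absOm := (@absOm _ _ _ D).
Local Notation iotaK := (iotaK D).
Local Notation pi := (uniformizer D).

Definition ordK (x : K) : \bar R :=
  if x == 0 then +oo%E else (- (ln (absK x) / ln p%:R))%:E.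

(** ** The ring A_0 *)

(* the family of coefficients of a formal series \sum_u a_u X^u *)
Definition laurent := 'rV[int]_n -> K.

HB.instance Definition _ := GRing.Zmodule.copy laurent ('rV[int]_n -> K).

Definition size1 (u : 'rV[int]_n) : nat := (\sum_(i < n) absz (u ord0 i))%N.

Definition size1_oo : set_system 'rV[int]_n :=
  filter_from setT (fun N : nat => [set u | (N <= size1 u)%N]).

Definition A0 : set laurent :=
  [set a | (forall u, absK (a u) <= 1) /\ absK (a u) @[u --> size1_oo] --> (0 : R)].

Definition gauss_norm (a : laurent) : R := sup [set absK (a u) | u in setT].

Definition laurent1 : laurent := fun u => (u == 0)%:R.

Definition laurent_mul (a b : laurent) : laurent :=
  fun u => tsum absK (fun v : 'rV[int]_n => a v * b (u - v)).

(* \sum_u a_u X^u |-> \sum_u a_u X^(q u) *)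
Definition sigma (a : laurent) : laurent := fun u =>
  if [forall i, (q%:Z %| u ord0 i)%Z] then a (map_mx (fun z => (z %/ q%:Z)%Z) u)
  else 0.

Definition laurent_eval (a : laurent) (x : 'rV[Om]_n) : Om :=
  tsum absOm (fun u : 'rV[int]_n => iotaK (a u) * \prod_i x 0 i ^ u 0 i).

(** ** Modules with a formal basis *)

(* the formal sum \sum_(i in I) a_i e_i is represented by the family (a_i) *)
Definition fvec (I : set nat) := I -> laurent.

Definition fmodule (I : set nat) : set (fvec I) := [set m | forall i, A0 (m i)].

Definition fnorm (I : set nat) (m : fvec I) : R :=
  sup [set gauss_norm (m i) | i in setT].

Definition evec (I : set nat) (i : I) : fvec I :=
  fun l => if l == i then laurent1 else 0.

(* x = \sum_(j in J) a_j f_j, each coordinate converging in the Gauss norm *)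
Definition is_formal_sum (I J : set nat) (a : J -> laurent) (f : J -> fvec I)
    (x : fvec I) : Prop :=
  forall l : I, is_sum gauss_norm (fun j : J => laurent_mul (a j) (f j l)) (x l).

(* (f_j)_(j in J) describes the normed module over I in the same way as (e_i)
   does: its elements are exactly the formal sums \sum a_j f_j, with unique
   coordinates a_j in A_0, and with norm max ||a_j||. *)
Record is_basis (I J : set nat) (f : J -> fvec I) : Prop := {
  basis_pos : J `<=` [set j | (0 < j)%N];
  basis_mem : forall j, fmodule (f j);
  basis_sum : forall a : fvec J, fmodule a ->
    exists2 x, fmodule x & is_formal_sum a f x;
  basis_coord : forall x : fvec I, fmodule x ->
    exists! a : fvec J, fmodule a /\ is_formal_sum a f x;
  basis_norm : forall (a : fvec J) (x : fvec I), fmodule a -> fmodule x ->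
    is_formal_sum a f x -> fnorm x = fnorm a
}.

Record nuclear_sigma_module := NuclearSigmaModule {
  mindex : set nat;
  mindex_pos : mindex `<=` [set i | (0 < i)%N];
  phi : fvec mindex -> fvec mindex;
  phi_stable : forall a, fmodule a -> fmodule (phi a);
  phi_semilinear : forall a, fmodule a ->
    is_formal_sum (fun i => sigma (a i)) (fun i => phi (evec i)) (phi a);
  phi_nuclear : forall e : R, 0 < e ->
    \forall N \near \oo, forall i : mindex, (N <= val i)%N ->
      fnorm (phi (evec i)) < e
}.

Definition is_matrix_of (M : nuclear_sigma_module) (J : set nat)
    (f : J -> fvec (mindex M)) (B : J -> J -> laurent) : Prop :=
  forall j : J, fmodule (fun i => B i j) /\
    is_formal_sum (fun i => B i j) f (phi (f j)).

Definition std_matrix (M : nuclear_sigma_module) :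
    mindex M -> mindex M -> laurent :=
  fun i j => phi (evec j) i.

Definition ord_coef (J : set nat) (B : J -> J -> laurent) (u : 'rV[int]_n) :
    \bar R :=
  ereal_inf [set ordK (B ij.1 ij.2 u) | ij in [set: J * J]].

(* [limf_einf] along [size1_oo]; the library's version requires a filtered
   structure on Z^n *)
Definition liminf_oo (g : 'rV[int]_n -> \bar R) : \bar R :=
  ereal_sup [set ereal_inf (g @` V) | V in size1_oo].

(* log_q |u| > 0 as soon as |u| >= 2, which is all that matters for the liminf *)
Definition log_convergent (M : nuclear_sigma_module) (c : \bar R) : Prop :=
  exists (J : set nat) (f : J -> fvec (mindex M)) (B : J -> J -> laurent),
    [/\ is_basis f, is_matrix_of f B &
        (c <= liminf_oo (fun u => ord_coef B u *
                           ((ln (size1 u)%:R / ln q%:R)^-1)%:E))%E].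

(** ** Closed points of G_m^n over F_q *)

Definition frob (x : 'rV[kOm]_n) : 'rV[kOm]_n := map_mx (fun t => t ^+ q) x.

(* points of G_m^n with coordinates in the algebraic closure of F_q in kOm *)
Definition geom_point : set 'rV[kOm]_n :=
  [set x : 'rV[kOm]_n | (forall i, x 0 i != 0) /\
           exists2 d, (0 < d)%N & iter d frob x = x].

(* A closed point is the orbit of a geometric point under Frobenius, and its
   degree is the number of geometric points in the orbit. *)
Definition closed_point : set (set 'rV[kOm]_n) :=
  [set [set iter m frob x | m in setT] | x in geom_point].

Definition degree (P : set 'rV[kOm]_n) : nat := #|` fset_set P|.

Definition teich1 (t : kOm) : Om :=
  xget 0 [set x | [/\ absOm x <= 1, redOm x = t &
                      exists2 d, (0 < d)%N & x ^+ (q ^ d) = x]].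

(* Teichmueller lift of a geometric point of P; the choice of that point does
   not affect the Fredholm determinant below. *)
Definition teich (P : set 'rV[kOm]_n) : 'rV[Om]_n := map_mx teich1 (xget 0 P).

(** ** Fredholm determinants at closed points *)

Section Fredholm.
Variable J : set nat.

Definition imx_id : J -> J -> Om := fun i j => (i == j)%:R.

Definition imx_mul (C C' : J -> J -> Om) : J -> J -> Om :=
  fun i j => tsum absOm (fun l : J => C i l * C' l j).

Definition imx_eval (B : J -> J -> laurent) (x : 'rV[Om]_n) : J -> J -> Om :=
  fun i j => laurent_eval (B i j) x.

(* B(x) B(x^q) ... B(x^(q^(d-1))) *)
Fixpoint frob_product (B : J -> J -> laurent) (x : 'rV[Om]_n) (d : nat) :
    J -> J -> Om :=
  if d is d'.+1 then
    imx_mul (frob_product B x d')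
            (imx_eval B (map_mx (fun t => t ^+ (q ^ d')) x))
  else imx_id.

Definition principal_minor (C : J -> J -> Om) (S : {fset J}) : Om :=
  \det (\matrix_(a < #|{: S}|, b < #|{: S}|)
          C (val (enum_val a)) (val (enum_val b))).

(* coefficients of det(I - C T): that of T^m is (-1)^m times the sum of the
   principal m x m minors of C *)
Definition fredholm_det (C : J -> J -> Om) : nat -> Om :=
  fun m => (-1) ^+ m *
    tsum absOm (fun S : {fset J} =>
                  if #|` S| == m then principal_minor C S else 0).

Definition fredholm_at (B : J -> J -> laurent) (P : set 'rV[kOm]_n) : nat -> Om :=
  fredholm_det (frob_product B (teich P) (degree P)).

End Fredholm.

(* value at z of the j-th divided derivative of \sum_m G_m T^m; the terms with
   m < j vanish because of the binomial coefficient *)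
Definition hasse_deriv (G : nat -> Om) (j : nat) (z : Om) : Om :=
  tsum absOm (fun m : nat => (G m * z ^+ (m - j)) *+ 'C(m, j)).

Definition is_zero_order (G : nat -> Om) (z : Om) (mu : nat) : Prop :=
  (forall j, (j < mu)%N -> hasse_deriv G j z = 0) /\ hasse_deriv G mu z <> 0.

(* s lists the reciprocal zeros of absolute value 1, with multiplicities *)
Definition is_unit_recip_zeros (G : nat -> Om) (s : seq Om) : Prop :=
  (forall alpha, alpha \in s -> absOm alpha = 1) /\
  (forall alpha, absOm alpha = 1 ->
     is_zero_order G alpha^-1 (count_mem alpha s)).

Definition unit_recip_zeros (G : nat -> Om) : seq Om :=
  xget [::] [set s | is_unit_recip_zeros G s].

(** ** Ordinarity and the unit root zeta function *)

Definition zero_mod_pi (I : set nat) (m : fvec I) : Prop :=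
  exists2 m' : fvec I, fmodule m' & forall i u, m i u = pi * m' i u.

Definition is_h0 (M : nuclear_sigma_module) (J : set nat)
    (f : J -> fvec (mindex M)) (h0 : nat) : Prop :=
  let vanish_beyond h :=
    forall j : J, (h < val j)%N -> zero_mod_pi (phi (f j)) in
  vanish_beyond h0 /\ (forall h, vanish_beyond h -> (h0 <= h)%N).

Definition ordinary_slope0 (M : nuclear_sigma_module) : Prop :=
  exists (J : set nat) (f : J -> fvec (mindex M)) (B : J -> J -> laurent)
         (h0 : nat),
    [/\ is_basis f, is_matrix_of f B, is_h0 f h0 &
        forall P, closed_point P ->
          exists2 s, is_unit_recip_zeros (fredholm_at B P) s & size s = h0].

Definition euler_factor (M : nuclear_sigma_module) (k : nat)
    (P : set 'rV[kOm]_n) : nat -> Om :=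
  \big[@ps_mul Om/@ps_one Om]_(alpha <-
      unit_recip_zeros (fredholm_at (@std_matrix M) P))
    ps_euler (alpha ^+ k) (degree P).

(* The coefficient of T^m in the product over all closed points only involves
   the finitely many closed points of degree at most m. *)
Definition unit_root_L (M : nuclear_sigma_module) (k : nat) : nat -> Om :=
  fun m =>
    (\big[@ps_mul Om/@ps_one Om]_(P \in
        [set P | closed_point P /\ (degree P <= m)%N]) euler_factor M k P) m.

(** ** Meromorphy *)

Definition ps_converges (rho : R) (f : nat -> K) : Prop :=
  forall r : R, 0 <= r -> r < rho -> absK (f m) * r ^+ m @[m --> \oo] --> (0 : R).

(* L is a quotient f / g of power series over K converging on |T| < rho *)
Definition meromorphic_in_disc (rho : R) (L : nat -> Om) : Prop :=
  exists f g : nat -> K,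
    [/\ ps_converges rho f, ps_converges rho g, (exists m, g m != 0) &
        ps_mul (iotaK \o g) L = iotaK \o f].

End SigmaModules.

(* Main.v *)
(** For a Teichmueller point x with x^(q^m) = x put
    G_x(T) = det(I - B(x) B(x^q) ... B(x^(q^(m-1))) T).  Dwork's trace formula,
    applied to tensor products of exterior powers of finite truncations of B,
    writes the sum over all such x of a monomial in the coefficients of G_x as
    (q^m - 1)^n times the trace of the m-th power of a finite matrix over K, and
    log-convergence bounds the characteristic series of that matrix on
    |T| < p^c, uniformly in the truncation.  By Newton's identities, the sums
    over x of the k-th power sums of the reciprocal zeros of G_x are therefore the
    logarithmic derivative of a function meromorphic on |T| < p^c.

    By ordinarity, estimating minors gives G_x = U_x H_x where U_x collects the
    unit zeros and the j-th coefficient of H_x is at most p^(-mj).  The factors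
    H_x contribute the logarithmic derivative of a series whose m-th coefficient
    is at most p^(-km), so it converges on |T| < p^k, and what remains is the
    logarithmic derivative of the unit root zeta function.  It has coefficients
    in K: the coefficients of G_x have residues in a finite field, so the unit
    zeros reduce to roots of unity, and the unit root contribution is the limit of
    the full sums for the exponents k + E p^t, with E a common order. *)

Require Import Defs.
From mathcomp Require Import all_boot all_order all_algebra all_fingroup all_field finmap.
From mathcomp Require Import all_classical all_reals all_analysis.
From mathcomp Require Import zify ring lra.

Set Implicit Arguments.
Unset Strict Implicit.
Unset Printing Implicit Defensive.

Import Order.TTheory GRing.Theory Num.Theory.
Import numFieldNormedType.Exports.

Local Open Scope ring_scope.

(** * Characteristic series and minors of finite matrices *)

(** The unit root part need not inherit the log-convergence of $M$, so the trace formula is not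
    applied to it, and $U_0$ is never constructed: it enters only through the unit zeros of the
    $G_x$. The argument runs on logarithmic derivatives, that is, on sequences indexed by $m$. There
    Euler products become sums, the factor $(q^m-1)^n$ becomes repeated passage from $F(T)$ to
    $F(qT)/F(T)$, and the truncation can be removed term by term. Exponentiation divides by
    integers, so bounds on these sequences would not bound the series; a growth bound for the series
    itself is carried along, with a constant independent of the truncation. For the Dwork matrix
    this constant comes from conjugation by weights of size $|u|^g$. The entry at $(u,v)$ is a
    coefficient of $X^{qv-u}$, and for large $|v|$ the multiplication by $q$ gains any factor $r <
    q^g$. Only boundedly many columns escape: exponents in a fixed ball, tensor indices made of the
    first basis vectors. The radius $p^k$ comes instead from the reciprocal zeros of the $H_x$, of
    absolute value at most $p^{-m}$, whose $k$-th powers enter. *)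

Section Sylvester.
Variable F : comNzRingType.

(** Sylvester's identity. The block matrices with rows $(1 + UV, -U)$, $(0, 1)$ and $(1, -U)$, $(0,
    1 + VU)$ become equal after multiplication by one unipotent block matrix, on the right and on
    the left respectively. *)
Lemma det_1addM m n (U : 'M[F]_(m, n)) (V : 'M[F]_(n, m)) :
  \det (1%:M + U *m V) = \det (1%:M + V *m U).
Proof.
have E : block_mx (1%:M + U *m V) (- U) 0 1%:M *m block_mx 1%:M 0 V 1%:M
       = block_mx 1%:M 0 V 1%:M *m block_mx 1%:M (- U) 0 (1%:M + V *m U).
  rewrite !mulmx_block !(mul1mx, mulmx1, mul0mx, mulmx0, add0r, addr0).
  by rewrite !mulNmx !mulmxN addrK [- _ + (_ + _)]addrCA addNr addr0.
have /(congr1 determinant) := E.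
by rewrite !det_mulmx !det_ublock !det_lblock !det1 !mulr1 !mul1r.
Qed.

End Sylvester.

Section CharSer.
Variable F : comNzRingType.

(** Rows outside [S] are replaced by rows of the identity, so that the principal minor is a
    determinant of fixed size and no enumeration of [S] is needed. *)
Definition principal_det N (A : 'M[F]_N) (S : {set 'I_N}) : F :=
  \det (\matrix_(i, j) if i \in S then A i j else (i == j)%:R).

(** With [P] the inclusion matrix of [h], the small matrix is $1 + VP$ and the large one is $1 +
    PV$, so Sylvester's identity compares them. *)
Lemma principal_detE N m (A : 'M[F]_N) (h : 'I_m -> 'I_N) : injective h ->
  \det (\matrix_(a, b) A (h a) (h b)) = principal_det A [set h a | a : 'I_m].
Proof.
move=> hI.
pose P : 'M[F]_(N, m) := \matrix_(i, a) (i == h a)%:R.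
pose V : 'M[F]_(m, N) := \matrix_(a, j) (A (h a) j - (h a == j)%:R).
have -> : \matrix_(a, b) A (h a) (h b) = 1%:M + V *m P.
  apply/matrixP => a b; rewrite !mxE (bigD1 (h b)) //= big1 => [|j jb].
    by rewrite !mxE eqxx mulr1 addr0 (inj_eq hI) addrC subrK.
  by rewrite !mxE (negPf jb) mulr0.
rewrite -det_1addM; congr (\det _); apply/matrixP => i j; rewrite !mxE.
case: imsetP => [[a _ ->]|Hi].
  rewrite (bigD1 a) //= big1 => [|b ba].
    by rewrite !mxE eqxx mul1r addr0 addrC subrK.
  by rewrite !mxE (inj_eq hI) eq_sym (negPf ba) mul0r.
rewrite big1 ?addr0 // => a _; rewrite !mxE; case: eqP => [ia|]; last by rewrite mul0r.
by case: Hi; exists a.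
Qed.

Definition char_ser N (A : 'M[F]_N) : {poly F} :=
  \det (1%:M - 'X *: map_mx polyC A).

(** By multilinearity in the rows of $1 - XA$: the set [S] records the rows in which the summand
    $-XA$ is chosen. *)
Lemma char_ser_coef N (A : 'M[F]_N) m :
  (char_ser A)`_m = (-1) ^+ m * \sum_(S : {set 'I_N} | #|S| == m) principal_det A S.
Proof.
have -> : char_ser A = \sum_(S : {set 'I_N}) (- 'X) ^+ #|S| * (principal_det A S)%:P.
  rewrite /char_ser {1}/determinant.
  under eq_bigr => s _.
    under eq_bigr => i _ do rewrite !mxE addrC.
    rewrite bigA_distr /= big_distrr /=.
    over.
  rewrite exchange_big /=; apply: eq_bigr => S _.
  rewrite /principal_det rmorph_sum big_distrr /=; apply: eq_bigr => s _.
  rewrite rmorphM rmorphXn rmorphN1 mulrCA; congr (_ * _).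
  rewrite rmorph_prod /= (bigID (mem S)) /= [in RHS](bigID (mem S)) /= mulrA.
  congr (_ * _); last first.
    apply: eq_bigr => i /negPf iS; rewrite iS !mxE iS.
    by case: eqP => _ /=; rewrite ?rmorph1 ?rmorph0 ?mulr1n ?mulr0n.
  rewrite -prodr_const -big_split /=.
  by apply: eq_bigr => i iS; rewrite !mxE iS mulNr.
have signE (k : nat) : (-1) ^+ k = ((-1) ^+ k)%:P :> {poly F}.
  by rewrite rmorphXn /= polyCN polyC1.
rewrite coef_sum (bigID (fun S : {set 'I_N} => #|S| == m)) /= addrC big1 => [|S Sm].
  rewrite add0r big_distrr /=; apply: eq_bigr => S /eqP Sm.
  rewrite [(- 'X) ^+ _]exprNn -mulrA signE coefCM Sm; congr (_ * _).
  by rewrite mulrC coefCM coefXn eqxx mulr1.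
rewrite [(- 'X) ^+ _]exprNn -mulrA signE !coefCM coefMC coefXn.
by rewrite eq_sym (negPf Sm) !(mulr0, mul0r).
Qed.

(** This cyclicity is the source of the Cauchy-Binet formula and of the later invariances: change of
    basis and choice of the point in a closed point. *)
Lemma char_serC m n (A : 'M[F]_(m, n)) (B : 'M[F]_(n, m)) :
  char_ser (A *m B) = char_ser (B *m A).
Proof.
have E k l (U : 'M[F]_(k, l)) V : char_ser (U *m V) =
    \det (1%:M + (- 'X *: map_mx polyC U) *m map_mx polyC V).
  by rewrite /char_ser map_mxM -scalemxAl scaleNr.
by rewrite !E det_1addM -scalemxAl -scalemxAr.
Qed.

Lemma char_ser0 N (A : 'M[F]_N) : (char_ser A)`_0 = 1.
Proof.
rewrite char_ser_coef expr0 mul1r (eq_bigl (pred1 finset.set0)) => [|S]; last first.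
  by rewrite cards_eq0.
rewrite big_pred1_eq /principal_det -[RHS](det1 F N); congr (\det _).
by apply/matrixP => i j; rewrite !mxE inE.
Qed.

Definition set_nth N (S : {set 'I_N.+1}) (a : nat) : 'I_N.+1 := nth ord0 (enum S) a.

Lemma set_nth_inj N (S : {set 'I_N.+1}) m : #|S| = m ->
  injective (fun a : 'I_m => set_nth S a).
Proof.
move=> Sm a b /eqP; rewrite /set_nth nth_uniq ?enum_uniq -?cardE ?Sm //.
by move/eqP/val_inj.
Qed.

Lemma set_nth_im N (S : {set 'I_N.+1}) m : #|S| = m ->
  [set set_nth S a | a : 'I_m] = S.
Proof.
move=> Sm; apply/eqP; rewrite eqEcard card_imset; last exact: set_nth_inj.
rewrite card_ord Sm leqnn andbT; apply/fintype.subsetP => _ /imsetP[a _ ->].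
by rewrite -mem_enum mem_nth // -cardE Sm.
Qed.

(** Up to the sign $(-1)^m$, both sides are the coefficient of $T^m$ in $\det(1 - TAB) = \det(1 -
    TBA)$. For $AB$ the only principal minor of size $m$ is the full determinant, and each principal
    minor of $BA$ is a product of two determinants. *)
Lemma cauchy_binet N m (A : 'M[F]_(m, N.+1)) (B : 'M[F]_(N.+1, m)) :
  \det (A *m B) = \sum_(W : {set 'I_N.+1} | #|W| == m)
    \det (\matrix_(a < m, b < m) A a (set_nth W b)) *
    \det (\matrix_(a < m, b < m) B (set_nth W a) b).
Proof.
have /(congr1 (fun p : {poly F} => (-1) ^+ m * p`_m)) := char_serC A B.
rewrite !char_ser_coef !mulrA -!expr2 !sqrr_sign !mul1r => E.
have <- : \sum_(S : {set 'I_m} | #|S| == m) principal_det (A *m B) S = \det (A *m B).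
  rewrite (eq_bigl (pred1 [set: 'I_m])) => [|S]; last first.
    rewrite /= eqEcard finset.subsetT cardsT card_ord eqn_leq.
    by have := max_card (mem S); rewrite card_ord => ->.
  rewrite big_pred1_eq /principal_det; congr (\det _).
  by apply/matrixP => i j; rewrite !mxE inE.
rewrite E; apply: eq_bigr => W /eqP Wm.
rewrite -{1}(set_nth_im Wm) -principal_detE; last exact: set_nth_inj.
rewrite mulrC -det_mulmx; congr (\det _).
by apply/matrixP => a b; rewrite !mxE; apply: eq_bigr => i _; rewrite !mxE.
Qed.

(** The matrix of the $m$-th exterior power. It is indexed by all subsets and extended by zero to
    those of the wrong size, so that the index type does not depend on $m$. *)
Definition cminor N (m : nat) (A : 'M[F]_N.+1) (S T : {set 'I_N.+1}) : F :=
  if (#|S| == m) && (#|T| == m)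
  then \det (\matrix_(a < m, b < m) A (set_nth S a) (set_nth T b)) else 0.

Lemma cminorM N (m : nat) (A B : 'M[F]_N.+1) S T :
  cminor m (A *m B) S T = \sum_W cminor m A S W * cminor m B W T.
Proof.
rewrite /cminor; case: (boolP (#|S| == m)) => /= Sm; last first.
  by rewrite big1 // => W _; rewrite mul0r.
case: (boolP (#|T| == m)) => /= Tm; last first.
  by rewrite big1 // => W _; rewrite andbF mulr0.
rewrite (bigID (fun W : {set 'I_N.+1} => #|W| == m)) /= [X in _ + X]big1 ?addr0; last first.
  by move=> W /negPf->; rewrite mul0r.
transitivity (\det ((\matrix_(a < m, j < N.+1) A (set_nth S a) j) *m
                    (\matrix_(i < N.+1, b < m) B i (set_nth T b)))).
  by congr (\det _); apply/matrixP => a b; rewrite !mxE; apply: eq_bigr => i _; rewrite !mxE.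
rewrite cauchy_binet; apply: eq_bigr => W Wm; rewrite Wm /=.
by congr (_ * _); congr (\det _); apply/matrixP => a b; rewrite !mxE.
Qed.

Lemma cminor_trace N (m : nat) (A : 'M[F]_N.+1) :
  \sum_S cminor m A S S = (-1) ^+ m * (char_ser A)`_m.
Proof.
rewrite char_ser_coef mulrA -expr2 sqrr_sign mul1r.
rewrite (bigID (fun W : {set 'I_N.+1} => #|W| == m)) /= [X in _ + X]big1 ?addr0; last first.
  by move=> W /negPf W0; rewrite /cminor W0.
apply: eq_bigr => S Sm; rewrite /cminor Sm /= principal_detE ?set_nth_im //; first exact/eqP.
exact/set_nth_inj/eqP.
Qed.

Lemma cminor1 N (m : nat) (S T : {set 'I_N.+1}) :
  cminor m 1%:M S T = ((S == T) && (#|S| == m))%:R.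
Proof.
rewrite /cminor; case: (eqVneq S T) => [->|ST] /=.
  rewrite andbb; case: eqP => // Tm.
  rewrite -[RHS](det1 F m); congr (\det _); apply/matrixP => a b; rewrite !mxE.
  by rewrite (inj_eq (set_nth_inj Tm)).
case: ifP => // /andP[/eqP Sm /eqP Tm].
have [i iS iT] : exists2 i, i \in S & i \notin T.
  apply/fintype.subsetPn; apply: contraNN ST => sST.
  by rewrite eqEcard sST Sm Tm /=.
have [a _ ia] : exists2 a, a \in 'I_m & i = set_nth S a.
  by apply/imsetP; rewrite set_nth_im.
rewrite (expand_det_row _ a) big1 // => b _; rewrite !mxE -ia; case: eqP => [ib|]; last by rewrite mul0r.
by move: iT; rewrite ib -{2}(set_nth_im Tm) mem_imset //; exact: set_nth_inj.
Qed.

Lemma deriv_prod_seq (I : eqType) (r : seq I) (p : I -> {poly F}) : uniq r ->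
  (\prod_(i <- r) p i)^`() =
  \sum_(i <- r) \prod_(j <- r) (if j == i then (p j)^`() else p j).
Proof.
elim: r => [|a r IH] /=; first by rewrite !big_nil -polyC1 derivC.
case/andP=> ar ur; rewrite !big_cons derivM IH // eqxx; congr (_ * _ + _).
  apply: eq_big_seq => j jr; case: eqP => // ja; by rewrite -ja jr in ar.
rewrite mulr_sumr; apply: eq_big_seq => i ir; rewrite big_cons; case: eqP => // ai.
by rewrite ai ir in ar.
Qed.

(* Jacobi's formula for the derivative of a determinant, combined with
   adj(1 - X A) = det(1 - X A) * sum_i A^i X^i. *)
Lemma char_ser_newton N (A : 'M[F]_N) m :
  (char_ser A)`_m.+1 *+ m.+1 =
  - \sum_(i < m.+1) \tr (A ^+ i.+1) * (char_ser A)`_(m - i).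
Proof.
rewrite -coef_deriv.
set M := 1%:M - 'X *: map_mx polyC A.
have dM i j : (M i j)^`() = - (A i j)%:P.
  rewrite !mxE derivB [X in _ - X^`()]mulrC deriv_mulC derivX mulr1.
  by case: (i == j); rewrite ?mulr1n ?mulr0n -?polyC1 derivC sub0r.
have dD : (char_ser A)^`() = - \tr (map_mx polyC A *m \adj M).
  transitivity (\sum_i \det (\matrix_(k, j) if k == i then - (A k j)%:P else M k j)).
    rewrite /char_ser -/M /determinant raddf_sum exchange_big /=; apply: eq_bigr => s _.
    rewrite -polyC1 -polyCN -rmorphXn /= deriv_mulC -mulr_sumr; congr (_ * _).
    rewrite deriv_prod_seq ?index_enum_uniq //; apply: eq_bigr => i _.
    by apply: eq_bigr => j _; rewrite mxE dM.
  rewrite -sumrN; apply: eq_bigr => i _.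
  rewrite (expand_det_row _ i) !mxE -sumrN; apply: eq_bigr => j _; rewrite !mxE eqxx.
  rewrite mulNr; congr (- (_ * _)); rewrite /cofactor; congr (_ * \det _).
  by apply/matrixP => k l; rewrite !mxE eq_sym (negPf (neq_lift _ _)).
pose adjc k : 'M[F]_N := map_mx (fun p : {poly F} => p`_k) (\adj M).
have adjE k : adjc k = \sum_(i < k.+1) (char_ser A)`_(k - i) *: A ^+ i.
  have E := mul_mx_adj M; rewrite -/(char_ser A) in E.
  have Ek l : adjc l = ((char_ser A)`_l)%:M + (if l is l'.+1 then A *m adjc l' else 0).
    have /(congr1 (map_mx (fun p : {poly F} => p`_l))) := E.
    rewrite /M mulmxBl mul1mx -scalemxAl => /matrixP E'; apply/matrixP => i j.
    move/(_ i j): E'; rewrite !mxE coefB => /(canRL (subrK _)) ->.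
    rewrite coefMn coefXM; case: l => [|l] /=; rewrite ?mxE //.
    congr (_ + _); rewrite coef_sum.
    apply: eq_bigr => o _.
    by rewrite !mxE coefCM.
  elim: k => [|k IH].
    by rewrite Ek big_ord1 subnn expr0 addr0 scalemx1.
  rewrite Ek IH [RHS]big_ord_recl subn0 expr0 scalemx1; congr (_ + _).
  rewrite mulmx_sumr; apply: eq_bigr => i _.
  by rewrite -scalemxAr exprS.
rewrite dD coefN; congr (- _).
transitivity (\tr (A *m adjc m)).
  rewrite coef_sum; apply: eq_bigr => i _; rewrite !mxE coef_sum; apply: eq_bigr => j _.
  by rewrite !mxE coefCM.
rewrite adjE mulmx_sumr linear_sum /=; apply: eq_bigr => i _.
by rewrite -scalemxAr linearZ /= exprS mulrC.
Qed.
End CharSer.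

(** * Power series and their logarithmic derivatives *)

Section ExpSeries.
Variable A : comNzRingType.
Implicit Types f g S : nat -> A.

Lemma ps_mulDl f g h : ps_mul (fun m => f m + g m) h = (fun m => ps_mul f h m + ps_mul g h m).
Proof.
by apply/funext => m; rewrite /ps_mul -big_split /=; apply: eq_bigr => i _; rewrite mulrDl.
Qed.

(* [ps_log_deriv S f] says that [f] is the formal exponential of
   \sum_(m >= 1) S_m T^m / m, i.e. f(0) = 1 and T f' = (\sum_(m >= 1) S_m T^m) f;
   the value [S 0] is irrelevant. *)
Definition ps_log_deriv S f : Prop :=
  f 0%N = 1 /\ forall m, f m.+1 *+ m.+1 = \sum_(i < m.+1) S i.+1 * f (m - i)%N.

(** Clearing the irrelevant value at 0 turns the recursion into the identity $T f' = S f$ of power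
    series. *)
Let S0 S m : A := if m is 0%N then 0 else S m.

Let ps_log_derivE S f : ps_log_deriv S f <->
  f 0%N = 1 /\ forall m, f m *+ m = ps_mul (S0 S) f m.
Proof.
have E m : ps_mul (S0 S) f m.+1 = \sum_(i < m.+1) S i.+1 * f (m - i)%N.
  by rewrite /ps_mul big_ord_recl mul0r add0r.
split=> -[f0 H]; split=> // m; last by rewrite H E.
case: m => [|m]; last by rewrite H E.
by rewrite mulr0n /ps_mul big_ord_recl big_ord0 mul0r addr0.
Qed.

Lemma ps_log_deriv_mul S S' f g : ps_log_deriv S f -> ps_log_deriv S' g ->
  ps_log_deriv (fun m => S m + S' m) (ps_mul f g).
Proof.
move=> /ps_log_derivE[f0 Hf] /ps_log_derivE[g0 Hg]; apply/ps_log_derivE; split.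
  by rewrite /ps_mul big_ord_recl big_ord0 f0 g0 mulr1 addr0.
move=> m.
have -> : ps_mul (S0 (fun m => S m + S' m)) (ps_mul f g) =
          (fun m => ps_mul (ps_mul (S0 S) f) g m + ps_mul f (ps_mul (S0 S') g) m).
  have -> : S0 (fun m => S m + S' m) = (fun m => S0 S m + S0 S' m).
    by apply/funext => -[|i] //=; rewrite addr0.
  apply/funext => i; rewrite ps_mulDl; congr (_ + _); first by rewrite ps_mulA.
  by rewrite ps_mulA [in RHS]ps_mulA [ps_mul f _]ps_mulC.
rewrite /= {1 2 4}/ps_mul -sumrMnl -big_split /=; apply: eq_bigr => i _.
rewrite -Hf -Hg mulrnAl mulrnAr -mulrnDr subnKC //.
by rewrite -ltnS.
Qed.

Lemma ps_log_deriv1 : ps_log_deriv (fun _ => 0) (@ps_one A).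
Proof.
split=> // m; rewrite {1}/ps_one /= mul0rn.
by rewrite big1 // => i _; rewrite mul0r.
Qed.

Lemma ps_log_deriv_big (I : Type) (r : seq I) (S f : I -> nat -> A) :
  (forall i, ps_log_deriv (S i) (f i)) ->
  ps_log_deriv (fun m => \sum_(i <- r) S i m) (\big[@ps_mul A/@ps_one A]_(i <- r) f i).
Proof.
move=> H; elim: r => [|i r IH].
  rewrite big_nil; have -> : (fun m => \sum_(i <- [::]) S i m) = fun _ => 0.
    by apply/funext => m; rewrite big_nil.
  exact: ps_log_deriv1.
rewrite big_cons; have -> : (fun m => \sum_(j <- i :: r) S j m) =
  fun m => S i m + \sum_(j <- r) S j m by apply/funext => m; rewrite big_cons.
exact: ps_log_deriv_mul.
Qed.

Lemma ps_log_deriv_eq S S' f : (forall i, S i.+1 = S' i.+1) ->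
  ps_log_deriv S f -> ps_log_deriv S' f.
Proof.
move=> E [f0 H]; split=> // m; rewrite H; apply: eq_bigr => i _; by rewrite E.
Qed.

(** The substitution $T \mapsto aT$. With $a = q$ it absorbs the factors $q^m$ that come from the
    trace formula. *)
Lemma ps_log_deriv_scale a S f : ps_log_deriv S f ->
  ps_log_deriv (fun m => a ^+ m * S m) (fun m => a ^+ m * f m).
Proof.
case=> f0 H; split=> [|m]; first by rewrite f0 mulr1.
rewrite -mulrnAr H mulr_sumr; apply: eq_bigr => i _.
by rewrite mulrACA -exprD addSn subnKC // -ltnS.
Qed.

Lemma ps_log_deriv_euler (a : A) d : (0 < d)%N ->
  ps_log_deriv (fun m => if (d %| m)%N then a ^+ (m %/ d) *+ d else 0) (ps_euler a d).
Proof.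
move=> d0; split=> [|m]; first by rewrite /ps_euler dvdn0 div0n.
rewrite /ps_euler; case: ifP => dm; last first.
  rewrite mul0rn big1 // => i _; case: ifP => di; last by rewrite mul0r.
  case: ifP => dmi; last by rewrite mulr0.
  by rewrite -(subnKC (ltn_ord i : (i <= m)%N)) -addSn dvdn_addr // dmi in dm.
pose k := (m.+1 %/ d)%N.
have Ek : m.+1 = (k * d)%N by rewrite divnK.
(* The numbers $i + 1 \le m + 1$ divisible by $d$ are $k = (m+1)/d$ in number, and each contributes
   $d a^k$. *)
transitivity (\sum_(i < m.+1 | (d %| i.+1)%N) a ^+ k *+ d).
  transitivity (a ^+ k *+ (d * k)); first by rewrite mulnC -Ek.
  rewrite sumr_const -mulrnA; congr (_ *+ (_ * _)%N).
  rewrite /k divn_count_dvd big_add1 /= big_mkord -sum1_card [RHS]big_mkcond /=.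
  by apply: eq_bigr => i _; rewrite unfold_in /dvdn -eqnE; case: eqn.
rewrite big_mkcond /=; apply: eq_bigr => i _; case: ifP => di; last by rewrite mul0r.
have le : (i <= m)%N by rewrite -ltnS.
have dmi : (d %| m - i)%N by rewrite -(dvdn_addr _ di) addSn subnKC.
rewrite dmi mulrnAl -exprD; congr (_ ^+ _ *+ _).
by rewrite /k -divnDl // addSn subnKC.
Qed.

(** Recursion on all previous values, realised by building the prefixes of the sequence as lists;
    [h m] reads only the first [m] values of its argument. *)
Lemma course_of_values (h : nat -> (nat -> A) -> A) :
  (forall m s t, (forall i, (i < m)%N -> s i = t i) -> h m s = h m t) ->
  exists S, forall m, S m = h m S.
Proof.
move=> hE; pose s := fix s n := if n is n'.+1 then rcons (s n') (h n' (nth 0 (s n'))) else [::].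
have ss n : size (s n) = n by elim: n => //= n IH; rewrite size_rcons IH.
have sS n i : (i < n)%N -> nth 0 (s n) i = nth 0 (s i.+1) i.
  elim: n => // n IH; rewrite ltnS leq_eqVlt => /orP[/eqP->//|lin].
  by rewrite [s n.+1]/= nth_rcons ss lin IH.
exists (fun n => nth 0 (s n.+1) n) => m.
rewrite [s m.+1]/= nth_rcons ss ltnn eqxx; apply: hE => i im; exact: sS.
Qed.

(** Newton's identities can be solved for $S$ over any commutative ring, since the unknown $S_{m+1}$
    is multiplied by $G_0 = 1$. No integer is inverted, in contrast to [ps_log_deriv_exists]. *)
Lemma power_sums_exist G : G 0%N = 1 -> exists S, ps_log_deriv (fun j => - S j) G.
Proof.
move=> G0.
pose h m (S : nat -> A) := if m is m'.+1 then
   - (G m'.+1 *+ m'.+1) - \sum_(i < m') S i.+1 * G (m' - i)%N else 0.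
have [|S SE] := @course_of_values h.
  move=> [|m] s t st //=; congr (_ - _); apply: eq_bigr => i _; by rewrite st // ltnS.
exists S; split=> // m; rewrite big_ord_recr /= subnn G0 mulr1 SE /= opprB opprK.
by rewrite addrA -big_split /= big1 ?add0r // => i _; rewrite mulNr addNr.
Qed.

(** The power sums of the reciprocal zeros of [G], defined formally so that they make sense without
    any factorisation of [G]. The value at 0 carries no information. *)
Definition power_sums G : nat -> A :=
  xget (fun=> 0) [set S | ps_log_deriv (fun j => - S j) G].

Lemma power_sumsP G : G 0%N = 1 -> ps_log_deriv (fun j => - power_sums G j) G.
Proof.
move=> /power_sums_exist[S HS]; rewrite /power_sums.
by case: xgetP => [T _ //|/(_ S)].
Qed.

Lemma power_sums_rec G j : G 0%N = 1 -> power_sums G j.+1 =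
  - (G j.+1 *+ j.+1) - \sum_(i < j) power_sums G i.+1 * G (j - i)%N.
Proof.
move=> G0; have [_ ->] := power_sumsP G0.
rewrite big_ord_recr /= subnn G0 mulr1 opprD opprK addrAC -sumrN -sumrB big1 ?add0r //.
by move=> i _; rewrite mulNr opprK subrr.
Qed.

Lemma power_sums_uniq S G j : ps_log_deriv (fun j => - S j) G -> S j.+1 = power_sums G j.+1.
Proof.
move=> HS; have G0 := HS.1; have HP := power_sumsP G0.
elim/ltn_ind: j => j IH.
have := HS.2 j; rewrite HP.2 !big_ord_recr /= subnn G0 !mulr1.
have -> : \sum_(i < j) - power_sums G i.+1 * G (j - i)%N =
          \sum_(i < j) - S i.+1 * G (j - i)%N.
  by apply: eq_bigr => i _; rewrite IH.
by move/addrI/oppr_inj.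
Qed.

Lemma power_sums_mul f g j : f 0%N = 1 -> g 0%N = 1 ->
  power_sums (ps_mul f g) j.+1 = power_sums f j.+1 + power_sums g j.+1.
Proof.
move=> f0 g0; symmetry.
apply: (@power_sums_uniq (fun j => power_sums f j + power_sums g j)).
apply: ps_log_deriv_eq (ps_log_deriv_mul (power_sumsP f0) (power_sumsP g0)) => i.
by rewrite opprD.
Qed.

Lemma char_ser_log_deriv N (M : 'M[A]_N) :
  ps_log_deriv (fun j => - \tr (M ^+ j)) (fun m => (char_ser M)`_m).
Proof.
split=> [|m]; first exact: char_ser0.
by rewrite char_ser_newton -sumrN; apply: eq_bigr => i _; rewrite mulNr.
Qed.

Lemma power_sums_char_ser N (M : 'M[A]_N) j :
  power_sums (fun m => (char_ser M)`_m) j.+1 = \tr (M ^+ j.+1).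
Proof. by rewrite -(power_sums_uniq _ (char_ser_log_deriv M)). Qed.

End ExpSeries.

Section ExpSeriesField.
Variable F : fieldType.
Hypothesis F0 : forall m, m.+1%:R != 0 :> F.

(** Only the values up to [m] enter, so a single coefficient can be computed after replacing a
    series or an infinite product by a truncation. *)
Lemma ps_log_deriv_uniq (S S' f g : nat -> F) m :
  (forall i, (0 < i <= m)%N -> S i = S' i) ->
  ps_log_deriv S f -> ps_log_deriv S' g -> f m = g m.
Proof.
move=> + [f0 Hf] [g0 Hg]; elim/ltn_ind: m => -[|m] IH E; first by rewrite f0 g0.
apply: (mulIf (F0 m)); rewrite !mulr_natr Hf Hg.
apply: eq_bigr => i _; rewrite E ?ltn_ord // IH //.
  by rewrite ltnS leq_subr.
by move=> k /andP[k0 km]; apply: E; rewrite k0 /= (leq_trans km) // (leq_trans (leq_subr _ _)).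
Qed.

Lemma ps_log_deriv_exists (S : nat -> F) : exists f, ps_log_deriv S f.
Proof.
pose h m (f : nat -> F) := if m is m'.+1 then
   (\sum_(i < m'.+1) S i.+1 * f (m' - i)%N) / m'.+1%:R else 1.
have [|f fE] := @course_of_values _ h.
  move=> [|m] s t st //=; congr (_ / _); apply: eq_bigr => i _; rewrite st //.
  by rewrite ltnS leq_subr.
exists f; split=> [|m]; first by rewrite fE.
by rewrite -mulr_natr fE /= divfK.
Qed.

End ExpSeriesField.

Lemma ps_log_deriv_map (A B : comNzRingType) (h : {rmorphism A -> B}) (S f : nat -> A) :
  ps_log_deriv S f -> ps_log_deriv (h \o S) (h \o f).
Proof.
case=> f0 H; split=> [|m]; first by rewrite /= f0 rmorph1.
rewrite /= -rmorphMn H rmorph_sum; apply: eq_bigr => i _; by rewrite rmorphM.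
Qed.

(** * Sums over complete ultrametric fields *)

Local Open Scope classical_set_scope.
Lemma cvg0P (R : realType) (u : nat -> R) : (forall i, 0 <= u i) ->
  (u i @[i --> \oo] --> (0 : R)) <->
  (forall e : R, 0 < e -> exists N, forall i, (N <= i)%N -> u i < e).
Proof.
move=> u0; split=> [H e e0|H].
  have /cvgrPdist_lt /(_ e e0)[N _ HN] := H; exists N => i Ni.
  by have := HN i Ni; rewrite /= sub0r normrN ger0_norm.
apply/cvgrPdist_lt => e e0; have [N HN] := H e e0; exists N => // i /= Ni.
by rewrite sub0r normrN ger0_norm // HN.
Qed.

Section Ultrametric.
Context {R : realType} {F : fieldType} {abs : F -> R} (U : ultrametric_abs abs).

Lemma abs0 : abs 0 = 0.
Proof. by apply/(abs_eq0 U). Qed.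

Lemma abs_ge0' x : 0 <= abs x. Proof. exact: abs_ge0 U x. Qed.
Hint Resolve abs_ge0' : core.

Lemma abs1 : abs 1 = 1.
Proof.
have n0 : abs 1 != 0 by apply/eqP => /(abs_eq0 U)/eqP; rewrite oner_eq0.
by apply: (mulfI n0); rewrite -(absM U) !mulr1.
Qed.

Lemma abs_gt0 x : (0 < abs x) = (x != 0).
Proof.
rewrite lt0r abs_ge0' andbT; congr negb; apply/eqP/eqP; first by move/(abs_eq0 U).
by move=> ->; rewrite abs0.
Qed.

Lemma absX x n : abs (x ^+ n) = abs x ^+ n.
Proof. by elim: n => [|n IH]; rewrite ?expr0 ?abs1 // !exprS (absM U) IH. Qed.

Lemma absN1 : abs (-1) = 1.
Proof.
have : abs (-1) ^+ 2 = 1 by rewrite -absX sqrrN expr1n abs1.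
by move/eqP; rewrite sqrf_eq1 => /orP[/eqP//|/eqP E]; have := abs_ge0' (-1); rewrite E ler0N1.
Qed.

Lemma absN x : abs (- x) = abs x.
Proof. by rewrite -mulN1r (absM U) absN1 mul1r. Qed.

Lemma absBC x y : abs (x - y) = abs (y - x).
Proof. by rewrite -absN opprB. Qed.

Lemma absV x : abs x^-1 = (abs x)^-1.
Proof.
have [->|x0] := eqVneq x 0; first by rewrite invr0 abs0 invr0.
have ax : abs x != 0 by rewrite gt_eqF // abs_gt0.
by apply: (mulfI ax); rewrite -(absM U) !divff // abs1.
Qed.

Lemma absXz x (z : int) : abs (x ^ z) = abs x ^ z.
Proof. by case: z => n; rewrite ?NegzE -?exprnN ?absV -?exprnP absX. Qed.

Lemma abs_prod I (r : seq I) (P : pred I) f :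
  abs (\prod_(i <- r | P i) f i) = \prod_(i <- r | P i) abs (f i).
Proof. by elim/big_rec2: _ => [|i y1 y2 _ <-]; rewrite ?abs1 ?(absM U). Qed.

Lemma absD_le e x y : abs x <= e -> abs y <= e -> abs (x + y) <= e.
Proof. by move=> xe ye; apply: le_trans (abs_ultra U _ _) _; rewrite ge_max xe. Qed.

Lemma absB_le e x y : abs x <= e -> abs y <= e -> abs (x - y) <= e.
Proof. by move=> xe ye; apply: absD_le; rewrite ?absN. Qed.

Lemma absD_lt e x y : abs x < e -> abs y < e -> abs (x + y) < e.
Proof. by move=> xe ye; apply: le_lt_trans (abs_ultra U _ _) _; rewrite gt_max xe. Qed.

Lemma absB_lt e x y : abs x < e -> abs y < e -> abs (x - y) < e.
Proof. by move=> xe ye; apply: absD_lt; rewrite ?absN. Qed.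

Lemma abs_trans e y x z : abs (x - y) <= e -> abs (y - z) <= e -> abs (x - z) <= e.
Proof. by move=> xy yz; rewrite -(subrKA y); exact: absD_le. Qed.

Lemma abs_close_le e y x : abs (x - y) <= e -> abs y <= e -> abs x <= e.
Proof. by move=> xy ye; rewrite -(subrK y x); exact: absD_le. Qed.

Lemma abs_eq_close x y : abs (x - y) < abs y -> abs x = abs y.
Proof.
move=> xy; apply/eqP; rewrite eq_le.
have le1 : abs x <= abs y by apply: abs_close_le (ltW xy) (lexx _).
rewrite le1 leNgt; apply/negP => lt.
have := absB_lt lt xy; by rewrite opprB addrC subrK ltxx.
Qed.

Lemma abs_sum_le e I (r : seq I) (P : pred I) f : 0 <= e ->
  (forall i, P i -> abs (f i) <= e) -> abs (\sum_(i <- r | P i) f i) <= e.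
Proof.
move=> e0 H; elim/big_ind: _ => [|x y|//]; [by rewrite abs0 | exact: absD_le].
Qed.

Lemma abs_sum_seq_le e (I : eqType) (r : seq I) (P : pred I) f : 0 <= e ->
  (forall i, i \in r -> P i -> abs (f i) <= e) -> abs (\sum_(i <- r | P i) f i) <= e.
Proof.
move=> e0 H; rewrite big_seq_cond; apply: abs_sum_le => // i /andP[]; exact: H.
Qed.

Lemma abs_natr n : abs n%:R <= 1.
Proof.
elim: n => [|n IH]; first by rewrite abs0.
by rewrite -natr1; apply: absD_le; rewrite ?abs1.
Qed.

Lemma abs_mulrn x n : abs (x *+ n) <= abs x.
Proof. by rewrite -mulr_natr (absM U) ler_piMr // abs_natr. Qed.

Lemma absM_le1 x y : abs x <= 1 -> abs y <= 1 -> abs (x * y) <= 1.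
Proof. by move=> x1 y1; rewrite (absM U) mulr_ile1. Qed.

Lemma absX_le1 x n : abs x <= 1 -> abs (x ^+ n) <= 1.
Proof. by move=> x1; rewrite absX exprn_ile1. Qed.

Lemma absM_close e x y x' y' : abs x <= 1 -> abs y' <= 1 ->
  abs (x - x') <= e -> abs (y - y') <= e -> abs (x * y - x' * y') <= e.
Proof.
move=> x1 y1 xx yy.
have -> : x * y - x' * y' = x * (y - y') + (x - x') * y'.
  by rewrite mulrBr mulrBl addrA subrK.
apply: absD_le; rewrite (absM U).
  by apply: le_trans yy; rewrite ler_piMl.
by apply: le_trans xx; rewrite ler_piMr.
Qed.

Lemma abs_prod_close e I (r : seq I) (P : pred I) f g : 0 <= e ->
  (forall i, P i -> abs (f i) <= 1) -> (forall i, P i -> abs (g i) <= 1) ->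
  (forall i, P i -> abs (f i - g i) <= e) ->
  abs (\prod_(i <- r | P i) f i - \prod_(i <- r | P i) g i) <= e.
Proof.
move=> e0 f1 g1 fg.
have : [/\ abs (\prod_(i <- r | P i) f i) <= 1, abs (\prod_(i <- r | P i) g i) <= 1 &
  abs (\prod_(i <- r | P i) f i - \prod_(i <- r | P i) g i) <= e].
  elim/big_rec2: _ => [|i y1 y2 Pi [a b c]]; first by rewrite abs1 subrr abs0.
  by split; [apply: absM_le1 => //; apply: f1 | apply: absM_le1 => //; apply: g1 |
    apply: absM_close => //; [apply: f1 | apply: fg]].
by case.
Qed.

Lemma abs_sum_close e I (r : seq I) (P : pred I) f g : 0 <= e ->
  (forall i, P i -> abs (f i - g i) <= e) ->
  abs (\sum_(i <- r | P i) f i - \sum_(i <- r | P i) g i) <= e.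
Proof. by move=> e0 H; rewrite -sumrB; apply: abs_sum_le. Qed.

Lemma abs_eq_lim x y : (forall e, 0 < e -> abs (x - y) <= e) -> x = y.
Proof.
move=> H; apply/eqP; rewrite -subr_eq0 -[_ == 0]negbK -abs_gt0; apply/negP => xy.
have := H _ (divr_gt0 xy (ltr0n R 2)).
by rewrite leNgt ltr_pdivrMr ?ltr0n // ltr_pMr // ltr1n.
Qed.

Lemma abs_det_le m (A : 'M[F]_m) (b : 'I_m -> R) : (forall j, 0 <= b j) ->
  (forall i j, abs (A i j) <= b j) -> abs (\det A) <= \prod_j b j.
Proof.
move=> b0 H; rewrite /determinant; apply: abs_sum_le; first exact: prodr_ge0.
move=> s _; rewrite (absM U) absX absN1 expr1n mul1r abs_prod.
rewrite (reindex_inj (@perm_inj _ s^-1%g)) /=; apply: ler_prod => j _.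
by rewrite abs_ge0' permKV H.
Qed.

Lemma abs_det_close e m (A B : 'M[F]_m) : 0 <= e ->
  (forall i j, abs (A i j) <= 1) -> (forall i j, abs (B i j) <= 1) ->
  (forall i j, abs (A i j - B i j) <= e) -> abs (\det A - \det B) <= e.
Proof.
move=> e0 A1 B1 AB; apply: abs_sum_close => // s _.
rewrite -mulrBr (absM U) absX absN1 expr1n mul1r; exact: abs_prod_close.
Qed.

Lemma abs_mulmx_le1 m n k (A : 'M[F]_(m, n)) (B : 'M[F]_(n, k)) :
  (forall i j, abs (A i j) <= 1) -> (forall i j, abs (B i j) <= 1) ->
  forall i j, abs ((A *m B) i j) <= 1.
Proof. by move=> HA HB i j; rewrite mxE; apply: abs_sum_le => // l _; apply: absM_le1. Qed.

Lemma abs_char_ser_close e N (A B : 'M[F]_N) m : 0 <= e ->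
  (forall i j, abs (A i j) <= 1) -> (forall i j, abs (B i j) <= 1) ->
  (forall i j, abs (A i j - B i j) <= e) ->
  abs ((char_ser A)`_m - (char_ser B)`_m) <= e.
Proof.
move=> e0 A1 B1 AB; rewrite !char_ser_coef -mulrBr (absM U) absX absN1 expr1n mul1r.
apply: abs_sum_close => // S _; apply: abs_det_close => // i j; rewrite !mxE;
  case: ifP => // _; rewrite ?subrr ?abs0 //; by case: eqP; rewrite ?abs1 ?abs0.
Qed.

Section Sums.
Variable T : choiceType.
Implicit Types (f g : T -> F) (A B : {fset T}).

(** Convergence to 0 along complements of finite sets; over a complete ultrametric field it is
    equivalent to summability. *)
Definition vanish f := forall e : R, 0 < e ->
  exists A, forall i, i \notin A -> abs (f i) <= e.

Lemma fset_sum_sub e f A B : 0 <= e -> (A `<=` B)%fset ->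
  (forall i, i \notin A -> abs (f i) <= e) ->
  abs (\sum_(i <- B) f i - \sum_(i <- A) f i) <= e.
Proof.
move=> e0 /fsubsetP AB H; rewrite (bigID (fun i => i \in A)) /=.
have -> : \sum_(i <- B | i \in A) f i = \sum_(i <- A) f i.
  rewrite -big_filter; apply: perm_big; apply: uniq_perm; rewrite ?filter_uniq ?fset_uniq //.
  by move=> i; rewrite mem_filter; case iA: (i \in A) => //=; rewrite AB.
rewrite addrAC subrr add0r; exact: abs_sum_le.
Qed.

Lemma is_sum_uniq f s t : is_sum abs f s -> is_sum abs f t -> s = t.
Proof.
move=> Hs Ht; apply: abs_eq_lim => e e0.
have [A HA] := Hs _ e0; have [B HB] := Ht _ e0.
apply: (@abs_trans _ (\sum_(i <- (A `|` B)%fset) f i)).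
  by apply/ltW/HA/fsubsetUl.
by rewrite absBC; apply/ltW/HB/fsubsetUr.
Qed.

Lemma is_sum_vanish f s : is_sum abs f s -> vanish f.
Proof.
move=> H e e0; have [A HA] := H _ e0; exists A => i iA.
have h1 := HA A (fsubset_refl _).
have h2 := HA (i |` A)%fset (fsubsetUr _ _).
rewrite big_fsetU1 //= in h2; apply: ltW.
have -> : f i = (s - \sum_(j <- A) f j) - (s - (f i + \sum_(j <- A) f j)).
  by rewrite opprB addrC addrA subrK addrK.
exact: absB_lt.
Qed.

Hypothesis complete : abs_complete abs.

(** There are increasing finite sets $B_n$ outside of which the terms are at most $1/(n+1)$, and by
    the ultrametric inequality the partial sums over the $B_n$ form a Cauchy sequence. *)
Lemma vanish_is_sum f : vanish f -> exists s, is_sum abs f s.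
Proof.
move=> Hf; pose ee n : R := n.+1%:R^-1.
have ee0 n : 0 < ee n by rewrite invr_gt0 ltr0n.
have eele n m : (n <= m)%N -> ee m <= ee n.
  by move=> nm; rewrite lef_pV2 ?posrE ?ltr0n // ler_nat.
have eelim e : 0 < e -> exists n, ee n < e.
  move=> e0; exists (Num.truncn e^-1).
  by rewrite -[ltRHS]invrK ltf_pV2 ?posrE ?invr_gt0 ?ltr0n // truncnS_gt // ?invr_ge0 ltW.
have /choice[A HA] : forall n, exists A, forall i, i \notin A -> abs (f i) <= ee n.
  by move=> n; exact: Hf.
pose B n := (\bigcup_(i <- iota 0 n.+1) A i)%fset.
have AB n m : (n <= m)%N -> (A n `<=` B m)%fset.
  by move=> nm; apply: bigfcup_sup; rewrite // mem_iota.
have BB n m : (n <= m)%N -> (B n `<=` B m)%fset.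
  move=> nm; apply/bigfcupsP => i; rewrite mem_iota add0n ltnS => /andP[_ im] _.
  by apply: AB; exact: leq_trans nm.
have HB n i : i \notin B n -> abs (f i) <= ee n.
  by move=> iB; apply: HA; apply: contraNN iB; apply/fsubsetP/AB.
have [l Hl] : exists l, abs (\sum_(i <- B n) f i - l) @[n --> \oo] --> (0 : R).
  apply: complete => e e0; have [N HN] := eelim _ e0; exists N => // M /= NM i j Mi Mj.
  apply: le_lt_trans HN; apply: (@abs_trans _ (\sum_(i <- B N) f i)).
    apply: fset_sum_sub => //; [exact: ltW| apply: BB; exact: leq_trans Mi | exact: HB].
  rewrite absBC; apply: fset_sum_sub => //; [exact: ltW| apply: BB; exact: leq_trans Mj | exact: HB].
exists l => e e0; have [N HN] := eelim _ e0.
have /cvg0P /(_ e e0)[//|M HM] := Hl.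
exists (B (maxn N M)) => C BC.
rewrite -(subrKA (\sum_(i <- B (maxn N M)) f i)); apply: absD_lt.
  by rewrite absBC; apply: HM; exact: leq_maxr.
rewrite absBC; apply: le_lt_trans HN; apply: fset_sum_sub => //; first exact: ltW.
by move=> i /HB H; apply: (le_trans H); apply: eele; exact: leq_maxl.
Qed.

Lemma tsumP f : vanish f -> is_sum abs f (tsum abs f).
Proof. by move/vanish_is_sum => [s Hs]; rewrite /tsum; case: xgetP => [x _ //|/(_ s)]. Qed.

Lemma is_sum_tsum f s : is_sum abs f s -> tsum abs f = s.
Proof. move=> H; exact: is_sum_uniq (tsumP (is_sum_vanish H)) H. Qed.

Lemma tsum_trunc e A f : 0 <= e -> vanish f -> (forall i, i \notin A -> abs (f i) <= e) ->
  abs (tsum abs f - \sum_(i <- A) f i) <= e.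
Proof.
move=> e0 /tsumP Hf HA; apply/ler_addgt0Pl => d d0.
have [B HB] := Hf _ d0; apply: (@abs_trans _ (\sum_(i <- (A `|` B)%fset) f i)).
  apply: (le_trans (ltW (HB _ (fsubsetUr _ _)))); by rewrite lerDl.
apply: (@le_trans _ _ e); last by rewrite lerDr ltW.
by apply: fset_sum_sub => //; exact: fsubsetUl.
Qed.

Lemma tsum_le e f : 0 <= e -> vanish f -> (forall i, abs (f i) <= e) -> abs (tsum abs f) <= e.
Proof.
move=> e0 Hf H; have := @tsum_trunc e fset0 f e0 Hf (fun i _ => H i).
by rewrite big_seq_fset0 subr0.
Qed.

Lemma vanish_le f g : vanish f -> (forall i, abs (g i) <= abs (f i)) -> vanish g.
Proof.
move=> H gf e e0; have [A HA] := H _ e0; exists A => i /HA; exact: le_trans.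
Qed.

Lemma vanishD f g : vanish f -> vanish g -> vanish (fun i => f i + g i).
Proof.
move=> Hf Hg e e0; have [A HA] := Hf _ e0; have [B HB] := Hg _ e0; exists (A `|` B)%fset => i.
by rewrite in_fsetU negb_or => /andP[/HA a /HB b]; exact: absD_le.
Qed.

Lemma vanishZ c f : vanish f -> vanish (fun i => c * f i).
Proof.
move=> Hf e e0; have c1 : 0 < abs c + 1 by rewrite ltr_wpDl.
have [A HA] := Hf _ (divr_gt0 e0 c1); exists A => i /HA H; rewrite (absM U).
apply: (@le_trans _ _ ((abs c + 1) * abs (f i))); first by rewrite ler_wpM2r // lerDl.
by rewrite mulrC -ler_pdivlMr.
Qed.

Lemma vanish_finite A f : (forall i, i \notin A -> f i = 0) -> vanish f.
Proof. by move=> H e e0; exists A => i /H ->; rewrite abs0 ltW. Qed.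

Lemma tsum_finite A f : (forall i, i \notin A -> f i = 0) -> tsum abs f = \sum_(i <- A) f i.
Proof.
move=> H; apply: abs_eq_lim => e e0; apply: tsum_trunc (ltW e0) (vanish_finite H) _.
by move=> i /H ->; rewrite abs0 ltW.
Qed.

Lemma tsumD f g : vanish f -> vanish g ->
  tsum abs (fun i => f i + g i) = tsum abs f + tsum abs g.
Proof.
move=> Hf Hg; apply: is_sum_tsum => e e0.
have [A HA] := tsumP Hf e0; have [B HB] := tsumP Hg e0; exists (A `|` B)%fset => C.
rewrite fsubUset => /andP[/HA a /HB b]; rewrite big_split /= opprD addrACA.
exact: absD_lt.
Qed.

Lemma tsumZ c f : vanish f -> tsum abs (fun i => c * f i) = c * tsum abs f.
Proof.
move=> Hf; apply: is_sum_tsum => e e0; have c1 : 0 < abs c + 1 by rewrite ltr_wpDl.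
have [A HA] := tsumP Hf (divr_gt0 e0 c1); exists A => C /HA.
rewrite -mulr_sumr -mulrBr (absM U) ltr_pdivlMr // mulrC; apply: le_lt_trans.
by rewrite ler_wpM2r // lerDl.
Qed.


Lemma eq_tsum (f g : T -> F) : (forall i, f i = g i) -> tsum abs f = tsum abs g.
Proof. by move=> /funext->. Qed.

End Sums.

Lemma vanish_reindex (T T' : choiceType) (h : T' -> T) (f : T -> F) : injective h ->
  vanish f -> vanish (f \o h).
Proof.
move=> hI Hf e e0; have [A HA] := Hf _ e0.
have fin : finite_set (h @^-1` [set` A]).
  apply: finite_preimage; last exact: finite_fset.
  by move=> x y _ _; exact: hI.
exists (fset_set (h @^-1` [set` A])) => i; rewrite in_fset_set // notin_setE => H.
by apply: HA; apply/negP.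
Qed.

Lemma tsum_reindex (T T' : choiceType) (h : T' -> T) (f : T -> F) :
  abs_complete abs -> injective h ->
  (forall i, (forall j, i <> h j) -> f i = 0) ->
  vanish f -> tsum abs f = tsum abs (f \o h).
Proof.
move=> C hI hS Hf; symmetry; apply: is_sum_tsum => // e e0.
have [A HA] := tsumP C Hf e0.
pose D := fset_set (h @^-1` [set` A]).
have fin : finite_set (h @^-1` [set` A]).
  apply: finite_preimage; last exact: finite_fset.
  by move=> x y _ _; exact: hI.
exists D => B DB.
have := HA (A `|` [fset h i | i in B])%fset (fsubsetUl _ _).
congr (abs (_ - _) < e).
transitivity (\sum_(i <- [fset h i | i in B]%fset) f i); last first.
  rewrite big_imfset //=; move=> x y _ _; exact: hI.
symmetry; apply: big_fset_incl; first exact: fsubsetUr.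
move=> i; rewrite in_fsetU => iAB iB; apply: hS => j ij.
move/negP: iB; apply; apply/imfsetP; exists j => //=.
move: iAB => /orP[iA|/imfsetP[j' /= j'B ij']]; last by rewrite (hI j j') // -ij.
apply: (fsubsetP DB); rewrite in_fset_set //; apply/mem_set.
by rewrite /preimage /= -ij.
Qed.

(** The hypothesis bounds [f] uniformly off a finite rectangle, and both iterated sums differ by at
    most [e] from the finite sum over that rectangle. *)
Lemma tsum_fubini (T T' : choiceType) (f : T -> T' -> F) :
  abs_complete abs ->
  (forall e : R, 0 < e -> exists A : {fset T}, exists B : {fset T'},
     forall i j, (i \notin A) || (j \notin B) -> abs (f i j) <= e) ->
  [/\ vanish (fun i => tsum abs (f i)), vanish (fun j => tsum abs (f^~ j)) &
   tsum abs (fun i => tsum abs (f i)) = tsum abs (fun j => tsum abs (f^~ j))].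
Proof.
move=> C H.
have v1 i : vanish (f i).
  by move=> e /H[A [B HAB]]; exists B => j jB; apply: HAB; rewrite jB orbT.
have v2 j : vanish (f^~ j).
  by move=> e /H[A [B HAB]]; exists A => i iA; apply: HAB; rewrite iA.
have w1 : vanish (fun i => tsum abs (f i)).
  move=> e e0; have [A [B HAB]] := H _ e0; exists A => i iA; apply: tsum_le (ltW e0) (v1 i) _ => //.
  by move=> j; apply: HAB; rewrite iA.
have w2 : vanish (fun j => tsum abs (f^~ j)).
  move=> e e0; have [A [B HAB]] := H _ e0; exists B => j jB; apply: tsum_le (ltW e0) (v2 j) _ => //.
  by move=> i; apply: HAB; rewrite jB orbT.
split=> //; apply: abs_eq_lim => e e0; have [A [B HAB]] := H _ e0.
apply: (@abs_trans _ (\sum_(i <- A) \sum_(j <- B) f i j)).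
  apply: (@abs_trans _ (\sum_(i <- A) tsum abs (f i))).
    apply: tsum_trunc (ltW e0) w1 _ => // i iA; apply: tsum_le (ltW e0) (v1 i) _ => // j.
    by apply: HAB; rewrite iA.
  apply: abs_sum_close (ltW e0) _ => i _; apply: tsum_trunc (ltW e0) (v1 i) _ => // j jB.
  by apply: HAB; rewrite jB orbT.
rewrite exchange_big /= absBC.
apply: (@abs_trans _ (\sum_(j <- B) tsum abs (f^~ j))).
  apply: tsum_trunc (ltW e0) w2 _ => // j jB; apply: tsum_le (ltW e0) (v2 j) _ => // i.
  by apply: HAB; rewrite jB orbT.
apply: abs_sum_close (ltW e0) _ => j _; apply: tsum_trunc (ltW e0) (v2 j) _ => // i iA.
by apply: HAB; rewrite iA.
Qed.

End Ultrametric.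

#[export] Hint Extern 0 (is_true (0 <= _ _)) => solve [apply: abs_ge0'; eassumption] : core.

Section Isometry.
Context {R : realType} {F F' : fieldType} {abs : F -> R} {abs' : F' -> R}.
Hypothesis U : ultrametric_abs abs.
Hypothesis U' : ultrametric_abs abs'.
Variable h : {rmorphism F -> F'}.
Hypothesis hE : forall x, abs' (h x) = abs x.

Lemma vanish_map (T : choiceType) (f : T -> F) : vanish (abs := abs) f ->
  vanish (abs := abs') (h \o f).
Proof. by move=> H e /H[A HA]; exists A => i /HA; rewrite /= hE. Qed.

Lemma tsum_map (T : choiceType) (f : T -> F) : abs_complete abs -> abs_complete abs' ->
  vanish (abs := abs) f -> h (tsum abs f) = tsum abs' (h \o f).
Proof.
move=> C C' Hf; symmetry; apply: (is_sum_tsum U' C') => e e0.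
have [A HA] := tsumP U C Hf e0; exists A => B /HA.
by rewrite -rmorph_sum -rmorphB hE.
Qed.
End Isometry.

Local Close Scope classical_set_scope.

(** * Fredholm determinants as limits of characteristic series *)

Fixpoint mx_prod (F : pzRingType) N (A : nat -> 'M[F]_N) d : 'M[F]_N :=
  if d is d'.+1 then mx_prod A d' *m A d' else 1%:M.

Section FredholmApprox.
Context {R : realType} {p q : nat} (D : padic_setting R p q).
Local Notation Om := (Om D).
Local Notation abs := (@absOm _ _ _ D).
Let U : ultrametric_abs abs := absOm_ultra D.
Let cpl : abs_complete abs := @Om_complete _ _ _ D.

(** Extension by zero to all pairs of naturals, so that truncations are matrices over ordinals
    whatever the index sets are. *)
Definition zext (I J : set nat) (C : I -> J -> Om) (i j : nat) : Om :=
  oapp (fun a : I => oapp (C a) 0 (insub j)) 0 (insub i).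

Variable J : set nat.
Implicit Types (C : J -> J -> Om) (N : nat).

Lemma zextE C (a b : J) : zext C (val a) (val b) = C a b.
Proof. by rewrite /zext !valK. Qed.

(** Nuclearity, uniform in the row. The identity matrix of an infinite index set does not have it,
    which is why empty products are treated apart below. *)
Definition col_decay (C : J -> J -> Om) : Prop := forall e : R, 0 < e ->
  exists N, forall a b : J, (N <= val b)%N -> abs (C a b) <= e.

Definition below N : {fset J} := [fset x in pmap insub (iota 0 N)]%fset.

Lemma in_below N (x : J) : (x \in below N) = (val x < N)%N.
Proof. by rewrite !inE mem_pmap_sub mem_iota. Qed.

Fixpoint imx_prod (C : nat -> J -> J -> Om) d : J -> J -> Om :=
  if d is d'.+1 then imx_mul (imx_prod C d') (C d') else imx_id D (J := J).

Lemma col_decay_vanish C a : col_decay C -> vanish (abs := abs) (C a).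
Proof.
move=> H e /H[N HN]; exists (below N) => j; rewrite in_below -leqNgt; exact: HN.
Qed.

Lemma vanish_mul (f g : J -> Om) : vanish (abs := abs) f -> (forall j, abs (g j) <= 1) ->
  vanish (abs := abs) (fun j => f j * g j).
Proof. by move=> Hf Hg; apply: vanish_le Hf _ => i; rewrite (absM U) ler_piMr ?(abs_ge0' U). Qed.

Lemma sum_below N (f : J -> Om) :
  \sum_(l <- below N) f l = \sum_(i < N) oapp f 0 (insub (i : nat)).
Proof.
rewrite -(big_mkord xpredT (fun i => oapp f 0 (insub i))) /index_iota subn0.
rewrite -(big_pmap (insub : nat -> option J)); apply: perm_big; apply: uniq_perm.
- exact: fset_uniq.
- by apply: pmap_sub_uniq; exact: iota_uniq.
- by move=> x; rewrite !inE.
Qed.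

Lemma zext_le1 (I J' : set nat) (C : I -> J' -> Om) i j : (forall a b, abs (C a b) <= 1) -> abs (zext C i j) <= 1.
Proof.
move=> H; rewrite /zext; case: (insub i : option I) => [a|] /=; rewrite ?(abs0 U) //.
by case: (insub j : option J') => [b|] /=; rewrite ?(abs0 U).
Qed.

Lemma zext_mul C C' N e (i j : 'I_N) : 0 <= e ->
  (forall a, vanish (abs := abs) (C a)) -> (forall a b, abs (C' a b) <= 1) ->
  (forall a b : J, (val a < N)%N -> (N <= val b)%N -> abs (C a b) <= e) ->
  abs (zext (imx_mul C C') i j - \sum_(l < N) zext C i l * zext C' l j) <= e.
Proof.
move=> e0 Cv C1 Ct; rewrite /zext; have := insubK J (i : nat).
case: (insub (i : nat) : option J) => [a|] /= ai; last first.
  by rewrite big1 ?subrr ?(abs0 U) // => l _; rewrite mul0r.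
case: (insub (j : nat) : option J) => [b|] /=; last first.
  rewrite big1 ?subrr ?(abs0 U) // => l _; case: (insub (l : nat) : option J) => [c|] /=;
  by rewrite mulr0.
have -> : \sum_(l < N) oapp (C a) 0 (insub (l : nat)) *
    oapp (fun a : J => C' a b) 0 (insub (l : nat)) = \sum_(l <- below N) C a l * C' l b.
  rewrite sum_below; apply: eq_bigr => l _.
  by case: (insub (l : nat) : option J) => [c|] //=; rewrite mul0r.
apply: (tsum_trunc U cpl e0); first exact: vanish_mul.
move=> l; rewrite in_below -leqNgt => Nl; rewrite (absM U).
apply: le_trans (Ct a l _ Nl); last by move: ai => /= ->.
by rewrite ler_piMr ?(abs_ge0' U).
Qed.

Section Product.
Variables (C : nat -> J -> J -> Om).
Hypothesis C1 : forall i a b, abs (C i a b) <= 1.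
Hypothesis Cd : forall i, col_decay (C i).

Lemma imx_prod_bound d : [/\ forall a b, abs (imx_prod C d a b) <= 1,
   forall a, vanish (abs := abs) (imx_prod C d a) &
   (0 < d)%N -> col_decay (imx_prod C d)].
Proof.
elim: d => [|d [IH1 IH2 IH3]].
  split=> // [a b|a] /=; first by rewrite /imx_id; case: eqP; rewrite ?(abs1 U) ?(abs0 U).
  apply: (vanish_finite U (A := [fset a]%fset)) => i; rewrite in_fset1 eq_sym => /negPf ai.
  by rewrite /imx_id ai.
have v a b : vanish (abs := abs) (fun l => imx_prod C d a l * C d l b).
  exact: vanish_mul.
have cd : col_decay (imx_prod C d.+1).
  move=> e e0; have [N HN] := Cd d e0; exists N => a b Nb.
  apply: (tsum_le U cpl (ltW e0) (v a b)) => l.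
  rewrite (absM U); apply: le_trans (HN l b Nb); rewrite ler_piMl ?(abs_ge0' U) //.
split=> //; last by move=> a; exact: col_decay_vanish.
move=> a b; apply: (tsum_le U cpl ler01 (v a b)) => l; exact: (absM_le1 U).
Qed.

Variables (N : nat) (e : R).
Hypothesis e0 : 0 <= e.
Hypothesis Ct : forall i (a b : J), (N <= val b)%N -> abs (C i a b) <= e.

Lemma imx_prod_tail d (a b : J) : (val a < N)%N -> (N <= val b)%N ->
  abs (imx_prod C d a b) <= e.
Proof.
case: d => [|d] aN Nb /=.
  (* The identity does not decay, but its off-diagonal entries are zero; hence the hypothesis that
     [a] lies below [N] while [b] does not. *)
  by rewrite /imx_id; case: eqP => [ab|]; rewrite ?(abs0 U) //; move: aN; rewrite ab ltnNge Nb.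
have [B1 B2 _] := imx_prod_bound d.
apply: (tsum_le U cpl e0); first exact: vanish_mul.
move=> l; rewrite (absM U); apply: le_trans (Ct d l Nb); by rewrite ler_piMl ?(abs_ge0' U).
Qed.

Variable A : nat -> 'M[Om]_N.
Hypothesis A1 : forall i a b, abs (A i a b) <= 1.
Hypothesis CA : forall i (a b : 'I_N), abs (zext (C i) a b - A i a b) <= e.

Lemma mx_prod_bound d a b : abs (mx_prod A d a b) <= 1.
Proof.
elim: d a b => [|d IH] a b /=; last exact: (abs_mulmx_le1 U).
by rewrite mxE; case: eqP; rewrite ?(abs1 U) ?(abs0 U).
Qed.

Lemma imx_mul1 C' a b : imx_mul (imx_id D (J := J)) C' a b = C' a b.
Proof.
rewrite /imx_mul (tsum_finite U cpl (A := [fset a]%fset)) => [|i].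
  by rewrite big_seq_fset1 /imx_id eqxx mul1r.
by rewrite in_fset1 eq_sym => /negPf ai; rewrite /imx_id ai mul0r.
Qed.

(** The error does not grow with the number of factors, since all entries are integral and the
    inequality is ultrametric. *)
Lemma imx_prod_close d (a b : 'I_N) : abs (zext (imx_prod C d.+1) a b - mx_prod A d.+1 a b) <= e.
Proof.
elim: d a b => [|d IH] a b.
  rewrite [mx_prod _ _]/= mul1mx.
  have -> : imx_prod C 1 = C 0%N by apply/funext => x; apply/funext => y; exact: imx_mul1.
  exact: CA.
have [B1 B2 _] := imx_prod_bound d.+1.
apply: (abs_trans U (y := \sum_(l < N) zext (imx_prod C d.+1) a l * zext (C d.+1) l b)).
  by apply: (zext_mul _ _ e0 B2 (C1 _)) => x y; apply: imx_prod_tail.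
have -> : mx_prod A d.+2 a b = \sum_l mx_prod A d.+1 a l * A d.+1 l b by rewrite mxE.
apply: (abs_sum_close U) => // l _.
by apply: (absM_close U) => //; apply: zext_le1.
Qed.
End Product.

(** A set that leaves the first [N] indices contributes a column bounded by [e], and all other
    entries are integral. *)
Lemma minor_tail N e C (S : {fset J}) : 0 <= e -> (forall a b, abs (C a b) <= 1) ->
  (forall a b : J, (N <= val b)%N -> abs (C a b) <= e) ->
  S \notin fpowerset (below N) -> abs (principal_minor C S) <= e.
Proof.
move=> e0 C1 Ct; rewrite fpowersetE => /fsubsetPn[x xS]; rewrite in_below -leqNgt => Nx.
pose c := enum_rank (FSetSub xS).
apply: (@le_trans _ _ (\prod_j (if j == c then e else 1))); last first.
  by rewrite (bigD1 c) //= eqxx big1 ?mulr1 // => j /negPf ->.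
apply: (abs_det_le U) => [j|i j]; first by case: eqP.
rewrite mxE; case: eqP => [->|_] //; apply: Ct; by rewrite /c enum_rankK.
Qed.

Lemma minor_vanish C m : (forall a b, abs (C a b) <= 1) -> col_decay C ->
  vanish (abs := abs) (fun S : {fset J} => if #|` S| == m then principal_minor C S else 0).
Proof.
move=> C1 Cd e e0; have [N HN] := Cd _ e0; exists (fpowerset (below N)) => S HS.
case: eqP => _; last by rewrite (abs0 U) ltW.
exact: minor_tail (ltW e0) C1 HN HS.
Qed.

Section FredClose.
Variables (C : J -> J -> Om) (N : nat) (e : R) (A : 'M[Om]_N.+1).
Hypothesis C1 : forall a b, abs (C a b) <= 1.
Hypothesis Cd : col_decay C.
Hypothesis e0 : 0 <= e.
Hypothesis Ct : forall (a b : J), (N.+1 <= val b)%N -> abs (C a b) <= e.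
Hypothesis A1 : forall a b, abs (A a b) <= 1.
Hypothesis CA : forall (a b : 'I_N.+1), abs (zext C a b - A a b) <= e.

Let Z : 'M[Om]_N.+1 := \matrix_(i, j) zext C i j.
Let g (S : {fset J}) : {set 'I_N.+1} := [set inord (val (fsval x)) | x : S].

Let in_g (S : {fset J}) (x : J) (xN : (val x < N.+1)%N) : (S `<=` below N.+1)%fset ->
  (Ordinal xN \in g S) = (x \in S).
Proof.
move=> SN; apply/imsetP/idP => [[[y yS] _ /= E]|xS].
  have yN : (val y < N.+1)%N by rewrite -in_below (fsubsetP SN).
  suff -> : x = y by [].
  by apply: val_inj; move/(congr1 val): E; rewrite /= inordK.
by exists (FSetSub xS) => //; apply: val_inj; rewrite /= inordK.
Qed.

Let gE (S : {fset J}) : (S `<=` below N.+1)%fset ->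
  #|g S| = #|` S| /\ principal_minor C S = principal_det Z (g S).
Proof.
move=> SN; pose h (a : 'I_#|{: S}|) : 'I_N.+1 := inord (val (fsval (enum_val a))).
have vN (x : S) : (val (fsval x) < N.+1)%N.
  by rewrite -in_below (fsubsetP SN) // fsvalP.
have hI : injective h.
  move=> a b E; apply/enum_val_inj/val_inj/val_inj.
  by have := congr1 (@nat_of_ord _) E; rewrite /h !(inordK (vN _)).
have hg : g S = [set h a | a : 'I_#|{: S}|].
  apply/setP => i; apply/imsetP/imsetP => [[x _ ->]|[a _ ->]].
    by exists (enum_rank x) => //; rewrite /h enum_rankK.
  by exists (enum_val a).
split; first by rewrite hg card_imset // card_ord cardfE.
rewrite hg -principal_detE // /principal_minor; congr (\det _).
by apply/matrixP => a b; rewrite !mxE /h !inordK // zextE.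
Qed.

(** Minors with an index beyond the truncation are at most [e]; the remaining ones are principal
    minors of the zero extension [Z], and replacing [Z] by [A] changes integral determinants by at
    most [e]. *)
Lemma fredholm_det_close m : abs (fredholm_det C m - (char_ser A)`_m) <= e.
Proof.
apply: (abs_trans U (y := (char_ser Z)`_m)); last first.
  apply: (abs_char_ser_close U) => // i j; rewrite mxE //; exact: zext_le1.
rewrite char_ser_coef /fredholm_det -mulrBr (absM U) (absX U) (absN1 U) expr1n mul1r.
have -> : \sum_(S : {set 'I_N.+1} | #|S| == m) principal_det Z S =
  \sum_(S <- fpowerset (below N.+1)) (if #|` S| == m then principal_minor C S else 0).
  transitivity (\sum_(T <- [seq g X | X <- fpowerset (below N.+1)] | #|T| == m) principal_det Z T).
    have ug : uniq [seq g X | X <- fpowerset (below N.+1)].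
      rewrite map_inj_in_uniq ?fset_uniq // => S S'; rewrite !fpowersetE => SN S'N E.
      apply/fsetP => x; case: (boolP (val x < N.+1)%N) => xN.
        by rewrite -(in_g xN SN) -(in_g xN S'N) E.
      transitivity false; first by apply: contraNF xN => /(fsubsetP SN); rewrite in_below.
      by apply/esym; apply: contraNF xN => /(fsubsetP S'N); rewrite in_below.
    rewrite -[RHS]big_filter [RHS]big_uniq ?filter_uniq //= [RHS]big_mkcond [LHS]big_mkcond /=.
    apply: eq_bigr => T _; rewrite mem_filter; case: eqP => //= Tm.
    (* A set of ordinals that does not come from a subset of [J] contains an index outside [J], and
       the corresponding row of [Z] is zero. *)
    case: ifP => // /negbT HT.
    have [i iT iJ] : exists2 i, i \in T & (insub (i : nat) : option J) = None.
      apply: contrapT => H; move/negP: HT; apply.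
      pose S := [fset x in below N.+1 | [exists i in T, val x == i]]%fset.
      have SN : (S `<=` below N.+1)%fset by apply/fsubsetP => x; rewrite !inE => /andP[].
      apply/mapP; exists S; first by rewrite fpowersetE.
      apply/setP => i; case iJ : (insub (i : nat) : option J) => [x|]; last first.
        apply/idP/imsetP => [iT|[x _ ix]]; first by case: H; exists i.
        have xN : (val (fsval x) < N.+1)%N by rewrite -in_below (fsubsetP SN) // fsvalP.
        by move: iJ; rewrite ix inordK // valK.
      have xi : val x = i by have := insubK J (i : nat); rewrite iJ.
      have xN : (val x < N.+1)%N by rewrite xi.
      have -> : i = Ordinal xN by apply: val_inj; rewrite /= -xi.
      rewrite (in_g xN SN) !inE mem_pmap_sub mem_iota [X in X && _]xN /=; apply/idP/existsP => [xT|[j /andP[jT /eqP xj]]].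
        by exists (Ordinal xN); rewrite xT /=.
      by have -> : Ordinal xN = j by apply: val_inj; rewrite /= -xj.
    rewrite /principal_det (expand_det_row _ i) big1 // => j _.
    by rewrite !mxE iT /zext iJ /= mul0r.
  rewrite big_map big_mkcond /=; apply: eq_big_seq => S; rewrite fpowersetE => SN.
  by have [-> ->] := gE SN.
apply: (tsum_trunc U cpl e0); first exact: minor_vanish.
move=> S HS; case: eqP => _; last by rewrite (abs0 U).
exact: minor_tail HS.
Qed.
End FredClose.

Lemma fredholm_prod_close (C : nat -> J -> J -> Om) N e (A : nat -> 'M[Om]_N.+1) d m :
  (forall i a b, abs (C i a b) <= 1) -> (forall i, col_decay (C i)) -> 0 <= e ->
  (forall i (a b : J), (N.+1 <= val b)%N -> abs (C i a b) <= e) ->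
  (forall i a b, abs (A i a b) <= 1) ->
  (forall i (a b : 'I_N.+1), abs (zext (C i) a b - A i a b) <= e) ->
  (0 < d)%N ->
  abs (fredholm_det (imx_prod C d) m - (char_ser (mx_prod A d))`_m) <= e.
Proof.
move=> C1 Cd e0 Ct A1 CA; case: d => // d _.
have [B1 _ /(_ isT) B3] := imx_prod_bound C1 Cd d.+1.
apply: fredholm_det_close => //.
- move=> a b Nb /=; have [B1' _ _] := imx_prod_bound C1 Cd d.
  apply: (tsum_le U cpl e0).
    by apply: vanish_mul => //; have [] := imx_prod_bound C1 Cd d.
  by move=> l; rewrite (absM U); apply: le_trans (Ct d l b Nb); rewrite ler_piMl ?(abs_ge0' U).
- exact: mx_prod_bound.
- exact: imx_prod_close.
Qed.
End FredholmApprox.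

(** * Completeness of K *)

Local Open Scope classical_set_scope.

Section Generic.
Context {R : realType} {F : fieldType} {abs : F -> R} (U : ultrametric_abs abs).
Hypothesis C : abs_complete abs.

Lemma tsum_nat_trunc e N (f : nat -> F) : 0 <= e -> vanish (abs := abs) f ->
  (forall k, (N <= k)%N -> abs (f k) <= e) ->
  abs (tsum abs f - \sum_(k < N) f k) <= e.
Proof.
move=> e0 v H.
have -> : \sum_(k < N) f k = \sum_(k <- [fset k in iota 0 N]%fset) f k.
  rewrite -(big_mkord xpredT) /index_iota subn0; apply: perm_big; apply: uniq_perm.
  - exact: iota_uniq.
  - exact: fset_uniq.
  - by move=> k; rewrite !inE.
apply: (tsum_trunc U C) => // k; rewrite !inE /= mem_iota add0n -leqNgt; exact: H.
Qed.

Lemma vanish_nat (f : nat -> F) (r : R) : 0 <= r -> r < 1 ->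
  (forall k, abs (f k) <= r ^+ k) -> vanish (abs := abs) f.
Proof.
move=> r0 r1 H e e0.
have : (r ^+ k) @[k --> \oo] --> (0 : R) by apply: cvg_expr; rewrite ger0_norm.
move/cvg0P => /(_ (fun i => exprn_ge0 i r0)) /(_ e e0)[N HN].
exists [fset k in iota 0 N]%fset => k; rewrite !inE /= mem_iota add0n -leqNgt => /HN H1.
by apply: le_trans (H k) _; exact: ltW.
Qed.
End Generic.

Section Setting.
Context {R : realType} {p q : nat} (D : padic_setting R p q).
Hypothesis pp : prime p.
Local Notation K := (K D).
Local Notation Om := (Om D).
Local Notation absK := (@absK _ _ _ D).
Local Notation absQp := (@absQp _ _ _ D).
Local Notation absOm := (@absOm _ _ _ D).
Local Notation iotaK := (iotaK D).
Local Notation pi := (uniformizer D).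
Let UK : ultrametric_abs absK := absK_ultra D.
Let UO : ultrametric_abs absOm := absOm_ultra D.
Let UQ : ultrametric_abs absQp := Qp_abs (QpP D).

Lemma p_gt1R : 1 < p%:R :> R.
Proof. by rewrite ltr1n prime_gt1. Qed.

Lemma pV_lt1 : (p%:R^-1 : R) < 1.
Proof. by rewrite invf_lt1 ?p_gt1R // (lt_trans _ p_gt1R). Qed.

Lemma pV_gt0 : 0 < (p%:R^-1 : R).
Proof. by rewrite invr_gt0 (lt_trans _ p_gt1R). Qed.

Lemma Qp_nat_neq0 m : m.+1%:R != 0 :> Qp D.
Proof.
rewrite -(abs_gt0 UQ) (Qp_padic (QpP D)) //.
by rewrite invr_gt0 exprn_gt0 // ltr0n prime_gt0.
Qed.

Lemma K_natE m : (m%:R : K) = (m%:R : Qp D)%:A.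
Proof. by rewrite scaler_nat. Qed.

Lemma K_char0 m : m.+1%:R != 0 :> K.
Proof.
have [e e0 E] := @absK_Qp _ _ _ D.
by rewrite -(abs_gt0 UK) K_natE E exprn_gt0 // (abs_gt0 UQ) Qp_nat_neq0.
Qed.

Lemma Om_char0 m : m.+1%:R != 0 :> Om.
Proof. by rewrite -(rmorph_nat iotaK) fmorph_eq0 K_char0. Qed.

Lemma absQp_p : absQp p%:R = p%:R^-1.
Proof. by rewrite (Qp_padic (QpP D)) ?prime_gt0 // logn_prime // eqxx expr1. Qed.

Lemma absOm_p_lt1 : absOm p%:R < 1.
Proof.
rewrite -(rmorph_nat iotaK) absOm_iota K_natE.
have [e e0 E] := @absK_Qp _ _ _ D.
by rewrite E absQp_p exprn_ilt1 ?ltW ?pV_gt0 ?pV_lt1 // -lt0n.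
Qed.

Lemma absK_pi_neq0 : pi != 0.
Proof. by rewrite -(abs_gt0 UK) uniformizer_abs pV_gt0. Qed.

(** Representatives of $R/pR$: the $\pi$-adic expansion with digits lifted from $\mathbf F_q$ is
    stopped at $\pi^e$. The exponent $e$ relating the absolute values of $K$ and $\mathbf Q_p$ is
    the one with $|p| = |\pi^e|$. *)
Lemma K_digit : exists2 b : seq K, (forall x, x \in b -> absK x <= 1) &
  forall z, absK z <= 1 -> exists2 x, x \in b & exists2 y, absK y <= 1 & z = x + p%:R * y.
Proof.
have [e e0 E] := @absK_Qp _ _ _ D.
have /choice[l Hl] : forall c : Fq D, exists x, absK x <= 1 /\ redK x = c.
  by move=> c; have [x] := red_surj (redKP D) c; exists x.
pose b t (g : {ffun 'I_e -> Fq D}) := \sum_(i < e | (i < t)%N) pi ^+ i * l (g i).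
have key t z : (t <= e)%N -> absK z <= 1 -> exists g, exists2 y, absK y <= 1 & z = b t g + pi ^+ t * y.
  move=> + z1; elim: t => [|t IH] te.
    by exists [ffun=> 0]; exists z => //; rewrite /b big_pred0 ?add0r ?mul1r.
  have [g [y y1 zE]] := IH (ltnW te).
  pose g' := [ffun i : 'I_e => if i == t :> nat then redK y else g i].
  have ly : absK (y - l (redK y)) < 1.
    apply/(red_eq0 (redKP D)); first by apply: (absB_le UK) => //; have [] := Hl (redK y).
    rewrite (redD (redKP D)) //; last by rewrite (absN UK); have [] := Hl (redK y).
    have [l1 lr] := Hl (redK y).
    have : redK (l (redK y)) + redK (- l (redK y)) = 0.
      rewrite -(redD (redKP D)) ?(absN UK) // subrr.
      by apply/(red_eq0 (redKP D)); rewrite (abs0 UK).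
    by rewrite lr.
  exists g'; exists ((y - l (redK y)) / pi).
    rewrite (absM UK) (absV UK) ler_pdivrMr ?(abs_gt0 UK) ?absK_pi_neq0 // mul1r.
    exact: uniformizer_max.
  have -> : pi ^+ t.+1 * ((y - l (redK y)) / pi) = pi ^+ t * y - pi ^+ t * l (redK y).
    by rewrite exprSr -mulrA [pi * _]mulrC divfK ?absK_pi_neq0 // mulrBr.
  have -> : b t.+1 g' = pi ^+ t * l (redK y) + b t g.
    rewrite /b (bigD1 (Ordinal te)) //= ffunE /= eqxx; congr (_ + _).
    apply: eq_big => i; first by rewrite ltnS -val_eqE /= andbC ltn_neqAle.
    by move=> /andP[it]; rewrite -val_eqE ffunE /= => /negPf->.
  by rewrite zE; ring.
exists [seq b e g | g : {ffun 'I_e -> Fq D}].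
  move=> x /mapP[g _ ->]; apply: (abs_sum_le UK) => // i _.
  apply: (absM_le1 UK); last by have [] := Hl (g i).
  apply: (absX_le1 UK); by rewrite uniformizer_abs ltW ?pV_lt1.
move=> z z1; have [g [y y1 zE]] := key e z (leqnn _) z1.
have pE : absK p%:R = absK (pi ^+ e).
  by rewrite K_natE E absQp_p (absX UK) uniformizer_abs.
have p0 : (p%:R : K) != 0 by have := K_char0 p.-1; rewrite prednK ?prime_gt0.
exists (b e g); first by apply/mapP; exists g; rewrite ?mem_enum.
exists (pi ^+ e * y / p%:R); last by rewrite zE [p%:R * _]mulrC divfK.
rewrite 2!(absM UK) (absV UK) pE mulrC mulrA mulVf ?mul1r //.
by rewrite gt_eqF // (abs_gt0 UK) expf_neq0 // absK_pi_neq0.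
Qed.

(* The ring of integers of K is generated over Z_p by finitely many elements:
   expand z = \sum_k p^k b_k with digits b_k in a finite set and regroup the
   powers of p according to the value of the digit. *)
Lemma K_generators : exists m (b : 'I_m -> K), (forall j, absK (b j) <= 1) /\
  forall z, absK z <= 1 -> exists c : 'I_m -> Qp D,
    (forall j, absQp (c j) <= 1) /\ z = \sum_j (c j)%:A * b j.
Proof.
have [b b1 Hb] := K_digit; have [e e0 E] := @absK_Qp _ _ _ D.
pose bb (j : 'I_(size b)) := b`_j; exists (size b), bb.
have bb1 j : absK (bb j) <= 1 by apply: b1; rewrite mem_nth.
split=> // z z1.
have /choice[f Hf] : forall y, exists u : 'I_(size b) * K, absK y <= 1 ->
    absK u.2 <= 1 /\ y = bb u.1 + p%:R * u.2.
  move=> y; case: (boolP (absK y <= 1)) => [y1|_].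
    have [x xb [w w1 ->]] := Hb _ y1.
    have xi : (index x b < size b)%N by rewrite index_mem.
    by exists (Ordinal xi, w) => _; rewrite /bb /= nth_index.
  have [x xb _] := Hb _ z1.
  have xi : (index x b < size b)%N by rewrite index_mem.
  by exists (Ordinal xi, 0).
pose zz := fix zz k := if k is k'.+1 then (f (zz k')).2 else z.
have zz1 k : absK (zz k) <= 1 by elim: k => //= k /Hf[].
pose d k := (f (zz k)).1.
have zE N : z = \sum_(k < N) p%:R ^+ k * bb (d k) + p%:R ^+ N * zz N.
  elim: N => [|N IH]; first by rewrite big_ord0 add0r mul1r.
  rewrite {1}IH big_ord_recr /= -addrA; congr (_ + _).
  by rewrite {1}(Hf _ (zz1 N)).2 mulrDr mulrA -exprSr.
pose h j k : Qp D := if d k == j then p%:R ^+ k else 0.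
have h1 j k : absQp (h j k) <= p%:R^-1 ^+ k.
  rewrite /h; case: eqP => _; first by rewrite (absX UQ) absQp_p.
  by rewrite (abs0 UQ) exprn_ge0 // ltW ?pV_gt0.
have hv j : vanish (abs := absQp) (h j).
  by apply: vanish_nat (ltW pV_gt0) pV_lt1 (h1 j).
exists (fun j => tsum absQp (h j)); split=> [j|].
  apply: (tsum_le UQ (Qp_complete (QpP D))) => // k; apply: le_trans (h1 j k) _.
  by rewrite exprn_ile1 // ltW ?pV_gt0 ?pV_lt1.
have aA (x : Qp D) y : absK (x%:A * y) = absQp x ^+ e * absK y by rewrite (absM UK) E.
have small N : absK (z - \sum_j (tsum absQp (h j))%:A * bb j) <= (p%:R^-1 ^+ e) ^+ N.
  have pN0 : 0 <= (p%:R^-1 : R) ^+ N by rewrite exprn_ge0 // ltW ?pV_gt0.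
  have pe0 : 0 <= ((p%:R^-1 : R) ^+ e) ^+ N by rewrite -exprM exprn_ge0 // ltW ?pV_gt0.
  have absp k : absK (p%:R ^+ k) = (p%:R^-1 ^+ e) ^+ k by rewrite (absX UK) K_natE E absQp_p.
  rewrite {1}(zE N) addrAC; apply: (absD_le UK); last first.
    by rewrite (absM UK) absp ler_piMr.
  have -> : \sum_(k < N) p%:R ^+ k * bb (d k) = \sum_j (\sum_(k < N) h j k)%:A * bb j.
    under [RHS]eq_bigr => j _ do rewrite scaler_suml mulr_suml.
    rewrite exchange_big /=; apply: eq_bigr => k _.
    rewrite (bigD1 (d k)) //= big1 ?addr0 => [|j jd].
      by rewrite /h eqxx K_natE exprZn expr1n.
    by rewrite /h eq_sym (negPf jd) scale0r mul0r.
  rewrite -sumrB; apply: (abs_sum_le UK) => // j _.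
  rewrite -mulrBl -scalerBl aA.
  apply: (@le_trans _ _ ((p%:R^-1 ^+ N) ^+ e)); last by rewrite -!exprM mulnC.
  apply: (@le_trans _ _ (absQp (\sum_(k < N) h j k - tsum absQp (h j)) ^+ e)).
    by rewrite ler_piMr // exprn_ge0 // (abs_ge0 UQ).
  rewrite lerXn2r ?nnegrE ?(abs_ge0 UQ) // (absBC UQ).
  apply: (tsum_nat_trunc UQ (Qp_complete (QpP D))) => // k Nk.
  apply: le_trans (h1 j k) _; rewrite ler_wiXn2l ?ltW ?pV_gt0 ?pV_lt1 //.
apply: (abs_eq_lim UK) => t t0.
have lt1 : (p%:R^-1 : R) ^+ e < 1 by rewrite exprn_ilt1 ?ltW ?pV_gt0 ?pV_lt1 // -lt0n.
have : (((p%:R^-1 : R) ^+ e) ^+ k) @[k --> \oo] --> (0 : R).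
  by apply: cvg_expr; rewrite ger0_norm // exprn_ge0 // ltW ?pV_gt0.
move/cvg0P => /(_ _)/(_ t t0)[|N /(_ N (leqnn _)) H].
  by move=> i; rewrite !exprn_ge0 // ltW ?pV_gt0.
by apply: le_trans (small N) (ltW H).
Qed.

(** Completeness is given for $\mathbf Q_p$ only. Along a subsequence the successive differences lie
    in $p^k R$; expanded in the generators of [K_generators] they yield one convergent series over
    $\mathbf Z_p$ for each generator. *)
Lemma K_complete : abs_complete absK.
Proof.
have [m [b [b1 Hb]]] := K_generators; have [e e0 E] := @absK_Qp _ _ _ D.
have p0 : (p%:R : K) != 0 by have := K_char0 p.-1; rewrite prednK ?prime_gt0.
pose r : R := p%:R^-1 ^+ e.
have r0 : 0 < r by rewrite exprn_gt0 ?pV_gt0.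
have r1 : r < 1 by rewrite exprn_ilt1 ?ltW ?pV_gt0 ?pV_lt1 // -lt0n.
have absp k : absK (p%:R ^+ k) = r ^+ k by rewrite (absX UK) K_natE E absQp_p.
move=> s Hs.
have /choice[t Ht] : forall k, exists N, forall i j, (N <= i)%N -> (N <= j)%N ->
    absK (s i - s j) <= r ^+ k.
  move=> k; have [N _ HN] := Hs _ (exprn_gt0 k r0); exists N => i j Ni Nj.
  by apply/ltW/(HN N (leqnn _)).
pose T k := (\max_(i < k.+1) t i)%N.
have tT k i : (i <= k)%N -> (t i <= T k)%N.
  by move=> ik; rewrite -ltnS in ik; have := @leq_bigmax _ (fun i : 'I_k.+1 => t i) (Ordinal ik).
have TT k l : (k <= l)%N -> (T k <= T l)%N.
  move=> kl; apply/bigmax_leqP => i _; by apply: tT; rewrite -ltnS (leq_trans (ltn_ord i)).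
have /choice[c Hc] : forall k, exists c : 'I_m -> Qp D, (forall j, absQp (c j) <= 1) /\
    s (T k.+1) - s (T k) = p%:R ^+ k * \sum_j (c j)%:A * b j.
  move=> k; have [|c [c1 cE]] := Hb ((s (T k.+1) - s (T k)) / p%:R ^+ k).
    rewrite (absM UK) (absV UK) absp ler_pdivrMr; last exact: exprn_gt0.
    by rewrite mul1r; apply: Ht; exact: tT.
  by exists c; rewrite -cE mulrC divfK // expf_neq0.
pose h j k : Qp D := p%:R ^+ k * c k j.
have h1 j k : absQp (h j k) <= p%:R^-1 ^+ k.
  rewrite (absM UQ) (absX UQ) absQp_p ler_piMr //.
  by have [] := Hc k.
have hv j : vanish (abs := absQp) (h j).
  by apply: vanish_nat (ltW pV_gt0) pV_lt1 (h1 j).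
pose l := s (T 0%N) + \sum_j (tsum absQp (h j))%:A * b j.
have small N : absK (s (T N) - l) <= r ^+ N.
  have -> : s (T N) = s (T 0%N) + \sum_j (\sum_(k < N) h j k)%:A * b j.
    under eq_bigr => j _ do rewrite scaler_suml mulr_suml.
    rewrite exchange_big /=; elim: N => [|N IH]; first by rewrite big_ord0 addr0.
    rewrite big_ord_recr /= addrA -IH; apply/eqP; rewrite addrC -subr_eq (Hc N).2; apply/eqP.
    rewrite mulr_sumr; apply: eq_bigr => j _.
    by rewrite mulrA; congr (_ * _); rewrite /h K_natE exprZn expr1n -scalerAl mul1r scalerA.
  rewrite /l opprD addrACA subrr add0r -sumrB; apply: (abs_sum_le UK) => [|j _].
    by rewrite exprn_ge0 // ltW.
  rewrite -mulrBl -scalerBl (absM UK) E.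
  apply: (@le_trans _ _ ((p%:R^-1 ^+ N) ^+ e)); last by rewrite -!exprM mulnC.
  apply: (@le_trans _ _ (absQp (\sum_(k < N) h j k - tsum absQp (h j)) ^+ e)).
    by rewrite ler_piMr // exprn_ge0 // (abs_ge0 UQ).
  have pN0 : 0 <= (p%:R^-1 : R) ^+ N by rewrite exprn_ge0 // ltW ?pV_gt0.
  rewrite lerXn2r ?nnegrE ?(abs_ge0 UQ) // (absBC UQ).
  apply: (tsum_nat_trunc UQ (Qp_complete (QpP D))) => // k Nk.
  apply: le_trans (h1 j k) _; rewrite ler_wiXn2l ?ltW ?pV_gt0 ?pV_lt1 //.
exists l; apply/cvg0P => [i|d d0]; first exact: (abs_ge0 UK).
have : (r ^+ k) @[k --> \oo] --> (0 : R) by apply: cvg_expr; rewrite ger0_norm // ltW.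
move/cvg0P => /(_ _)/(_ d d0)[|N /(_ N (leqnn _)) H].
  by move=> i; rewrite exprn_ge0 // ltW.
exists (T N) => i Ti; apply: le_lt_trans H; apply: (abs_trans UK (y := s (T N))) => //.
by apply: Ht; [apply: leq_trans (tT _ _ (leqnn _)) Ti | exact: tT].
Qed.
End Setting.

Local Close Scope classical_set_scope.

(** * The ring A_0 and its evaluation maps *)

Local Open Scope classical_set_scope.
Section Box.
Variable n : nat.
Implicit Types (u : 'rV[int]_n).

(** The cube $[-W, W]^n$, shifted by $W$ so that it is parametrised by a finite type. *)
Definition box_pt W (b : {ffun 'I_n -> 'I_(W.*2.+1)}) : 'rV[int]_n :=
  \row_i ((b i : nat)%:Z - W%:Z).

Lemma box_ptP W u : (forall i, (absz (u 0%R i) <= W)%N) <-> exists b : {ffun 'I_n -> 'I_(W.*2.+1)}, u = box_pt b.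
Proof.
split=> [H|[b ->] i]; last by rewrite mxE; have := ltn_ord (b i); lia.
have B i : (absz (u 0 i + W%:Z)%R < W.*2.+1)%N by have := H i; lia.
exists [ffun i => Ordinal (B i)]; apply/rowP => i; rewrite mxE ffunE /=.
have := H i; lia.
Qed.

Lemma box_pt_inj W : injective (@box_pt W).
Proof.
move=> b b' /rowP E; apply/ffunP => i; apply: val_inj => /=.
have := E i; rewrite !mxE; lia.
Qed.

End Box.

Section Laurent.
Context {R : realType} {p q : nat} (D : padic_setting R p q) (n : nat).
Hypothesis pp : prime p.
Local Notation K := (K D).
Local Notation Om := (Om D).
Local Notation absK := (@absK _ _ _ D).
Local Notation absOm := (@absOm _ _ _ D).
Local Notation iotaK := (iotaK D).
Local Notation laurent := (laurent D n).
Local Notation lmul := (@laurent_mul _ _ _ D n).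
Let UK : ultrametric_abs absK := absK_ultra D.
Let UO : ultrametric_abs absOm := absOm_ultra D.
Let CK : abs_complete absK := @K_complete _ _ _ D pp.
Let CO : abs_complete absOm := @Om_complete _ _ _ D.
Implicit Types (a b c : laurent) (u v w : 'rV[int]_n).

Definition zball W : {fset 'rV[int]_n} :=
  [fset u in [seq box_pt b | b : {ffun 'I_n -> 'I_(W.*2.+1)}] | (size1 u <= W)%N]%fset.

Lemma size1_ge u i : (absz (u 0%R i) <= size1 u)%N.
Proof.
rewrite /size1 (bigD1 i) //= (_ : ord0 = 0%R) ?leq_addr //; exact: val_inj.
Qed.

Lemma in_zball W u : (u \in zball W) = (size1 u <= W)%N.
Proof.
rewrite !inE /= andbC; case: leqP => //= uW.
have [|b ->] := (box_ptP W u).1; last by apply/mapP; exists b; rewrite ?mem_enum.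
by move=> i; exact: leq_trans (size1_ge u i) uW.
Qed.

Lemma size1D u v : (size1 (u + v) <= size1 u + size1 v)%N.
Proof.
rewrite /size1 -big_split /=; apply: leq_sum => i _; rewrite mxE.
by move: (u ord0 i) (v ord0 i) => x y; lia.
Qed.

Lemma size1_triangle u v : (size1 u <= size1 v + size1 (u - v))%N.
Proof. by rewrite -{1}(subrK v u) addrC size1D. Qed.

(** The balls $|u| \le N$ in $\mathbf Z^n$ are finite, and every finite set lies in one of them. *)
Lemma vanish_size1 (F : fieldType) (abs : F -> R) (f : 'rV[int]_n -> F) :
  vanish (abs := abs) f <-> forall e : R, 0 < e ->
    exists N, forall u, (N <= size1 u)%N -> abs (f u) <= e.
Proof.
split=> H e e0; have [A HA] := H e e0; last first.
  exists (zball A) => u; rewrite in_zball -ltnNge => /ltnW; exact: HA.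
exists (\max_(u <- A) size1 u).+1%N => u Au; apply: HA; apply: contraTN Au => uA.
by rewrite -ltnNge ltnS (big_fsetD1 u) //= leq_maxl.
Qed.

Lemma A0P a : A0 a <-> (forall u, absK (a u) <= 1) /\ vanish (abs := absK) a.
Proof.
rewrite vanish_size1; split=> -[a1 H]; split=> //.
  move=> e e0; have : nbhs (0 : R) [set x : R | `|x| < e].
    by have := nbhsx_ballx (0 : R) e e0; rewrite /ball /=; under eq_fun do rewrite sub0r normrN.
  move/H => [N _ HN]; exists N => u /HN /=; rewrite ger0_norm ?(abs_ge0 UK) //; exact: ltW.
move=> P [e /= e0 HP]; have [N HN] := H _ (divr_gt0 e0 (ltr0n R 2)).
exists N => // u /= /HN Hu; apply: HP => /=; rewrite sub0r normrN ger0_norm ?(abs_ge0 UK) //.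
by apply: le_lt_trans Hu _; rewrite ltr_pdivrMr ?ltr0n // ltr_pMr // ltr1n.
Qed.

Lemma laurentBE a b u : (a - b) u = a u - b u. Proof. by []. Qed.
Lemma laurentDE a b u : (a + b) u = a u + b u. Proof. by []. Qed.

Lemma A0_0 : A0 (0 : laurent).
Proof.
apply/A0P; split=> [u|]; first by rewrite (abs0 UK).
by apply: (vanish_finite UK (A := fset0)).
Qed.

Lemma A0D a b : A0 a -> A0 b -> A0 (a + b).
Proof.
move=> /A0P[a1 va] /A0P[b1 vb]; apply/A0P; split=> [u|]; first exact: (absD_le UK).
exact: (vanishD UK).
Qed.

Lemma A0N a : A0 a -> A0 (- a).
Proof.
move=> /A0P[a1 va]; apply/A0P; split=> [u|]; first by rewrite (absN UK).
by apply: vanish_le va _ => u; rewrite (absN UK).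
Qed.

Lemma A0B a b : A0 a -> A0 b -> A0 (a - b).
Proof. by move=> Ha Hb; apply: A0D => //; exact: A0N. Qed.

Lemma A0_sum (I : Type) (r : seq I) (f : I -> laurent) : (forall i, A0 (f i)) ->
  A0 (\sum_(i <- r) f i).
Proof. by move=> H; elim/big_ind: _ => [|a b|//]; [exact: A0_0 | exact: A0D]. Qed.

Lemma A0_1 : A0 (laurent1 D (n := n)).
Proof.
apply/A0P; split=> [u|]; first by rewrite /laurent1; case: eqP; rewrite ?(abs1 UK) ?(abs0 UK).
apply: (vanish_finite UK (A := [fset 0]%fset)) => u; rewrite in_fset1 /laurent1.
by move=> /negPf->.
Qed.

Lemma lmul_vanish a b u : A0 a -> A0 b -> vanish (abs := absK) (fun v => a v * b (u - v)).
Proof.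
move=> /A0P[a1 va] /A0P[b1 vb]; apply: vanish_le va _ => v.
by rewrite (absM UK) ler_piMr ?(abs_ge0 UK).
Qed.

Lemma lmul_le e a b u : 0 <= e -> A0 a -> A0 b -> (forall v, absK (a v) <= e) ->
  absK (lmul a b u) <= e.
Proof.
move=> e0 Ha Hb ae; apply: (tsum_le UK CK) => [//||v]; first exact: lmul_vanish.
have /A0P[b1 _] := Hb; apply: le_trans (ae v).
by rewrite (absM UK) ler_piMr ?(abs_ge0 UK).
Qed.

Lemma lmul_ler e a b u : 0 <= e -> A0 a -> A0 b -> (forall v, absK (b v) <= e) ->
  absK (lmul a b u) <= e.
Proof.
move=> e0 Ha Hb ae; apply: (tsum_le UK CK) => [//||v]; first exact: lmul_vanish.
have /A0P[a1 _] := Ha; apply: le_trans (ae (u - v)).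
by rewrite (absM UK) ler_piMl ?(abs_ge0 UK).
Qed.

Lemma A0M a b : A0 a -> A0 b -> A0 (lmul a b).
Proof.
move=> Ha Hb; have /A0P[a1 va] := Ha; have /A0P[b1 vb] := Hb.
apply/A0P; split=> [u|]; first exact: lmul_le.
apply/vanish_size1 => e e0.
have [N HN] := (vanish_size1 _ _).1 va e e0; have [N' HN'] := (vanish_size1 _ _).1 vb e e0.
exists (N + N')%N => u Nu; apply: (tsum_le UK CK) => [||v]; [exact: ltW|exact: lmul_vanish|].
case: (leqP N (size1 v)) => Nv.
  by apply: le_trans (HN _ Nv); rewrite (absM UK) ler_piMr ?(abs_ge0 UK).
have N'u : (N' <= size1 (u - v))%N by have := size1_triangle u v; lia.
by apply: le_trans (HN' _ N'u); rewrite (absM UK) ler_piMl ?(abs_ge0 UK).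
Qed.

Lemma lmulDr a b c : A0 a -> A0 b -> A0 c -> lmul a (b + c) = lmul a b + lmul a c.
Proof.
move=> Ha Hb Hc; apply/funext => u; rewrite laurentDE /laurent_mul -(tsumD UK CK); try exact: lmul_vanish.
by apply: eq_tsum => v; rewrite laurentDE mulrDr.
Qed.

Lemma lmulDl a b c : A0 a -> A0 b -> A0 c -> lmul (a + b) c = lmul a c + lmul b c.
Proof.
move=> Ha Hb Hc; apply/funext => u; rewrite laurentDE /laurent_mul -(tsumD UK CK); try exact: lmul_vanish.
by apply: eq_tsum => v; rewrite laurentDE mulrDl.
Qed.

Lemma lmul0 a : A0 a -> lmul a 0 = 0.
Proof.
move=> Ha; have E := lmulDr Ha A0_0 A0_0; rewrite addr0 in E.
by move/(congr1 (fun x => x - lmul a 0)): E; rewrite subrr addrK.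
Qed.

Lemma lmul0l a : A0 a -> lmul 0 a = 0.
Proof.
move=> Ha; have E := lmulDl A0_0 A0_0 Ha; rewrite addr0 in E.
by move/(congr1 (fun x => x - lmul 0 a)): E; rewrite subrr addrK.
Qed.

Lemma lmulN a b : A0 a -> A0 b -> lmul a (- b) = - lmul a b.
Proof.
move=> Ha Hb; have E := lmulDr Ha Hb (A0N Hb); rewrite subrr lmul0 // in E.
by apply/eqP; rewrite -addr_eq0 addrC -E.
Qed.

Lemma lmulNl a b : A0 a -> A0 b -> lmul (- a) b = - lmul a b.
Proof.
move=> Ha Hb; have E := lmulDl Ha (A0N Ha) Hb; rewrite subrr lmul0l // in E.
by apply/eqP; rewrite -addr_eq0 addrC -E.
Qed.

Lemma lmulBr a b c : A0 a -> A0 b -> A0 c -> lmul a (b - c) = lmul a b - lmul a c.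
Proof. by move=> Ha Hb Hc; rewrite lmulDr ?lmulN //; exact: A0N. Qed.

Lemma lmulBl a b c : A0 a -> A0 b -> A0 c -> lmul (a - b) c = lmul a c - lmul b c.
Proof. by move=> Ha Hb Hc; rewrite lmulDl ?lmulNl //; exact: A0N. Qed.

Lemma lmul_sumr (I : Type) (r : seq I) a (f : I -> laurent) : A0 a -> (forall i, A0 (f i)) ->
  lmul a (\sum_(i <- r) f i) = \sum_(i <- r) lmul a (f i).
Proof.
move=> Ha Hf; elim: r => [|i r IH]; first by rewrite !big_nil lmul0.
by rewrite !big_cons lmulDr ?IH //; exact: A0_sum.
Qed.

Lemma lmul1 a : lmul (laurent1 D (n := n)) a = a.
Proof.
apply/funext => u; rewrite /laurent_mul (tsum_finite UK CK (A := [fset 0]%fset)) => [|v].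
  by rewrite big_seq_fset1 /laurent1 eqxx mul1r subr0.
by rewrite in_fset1 /laurent1 => /negPf->; rewrite mul0r.
Qed.

(** Fubini for the family $a_v b_{t-v} c_{u-t}$, whose terms are small unless both $|v|$ and $|t -
    v|$ are bounded. *)
Lemma lmulA a b c : A0 a -> A0 b -> A0 c -> lmul a (lmul b c) = lmul (lmul a b) c.
Proof.
move=> Ha Hb Hc; have /A0P[a1 va] := Ha; have /A0P[b1 vb] := Hb; have /A0P[c1 vc] := Hc.
apply/funext => u.
pose f (v t : 'rV[int]_n) := a v * b (t - v) * c (u - t).
have fle v t : absK (f v t) <= absK (a v).
  rewrite /f 2!(absM UK) -mulrA ler_piMr ?(abs_ge0 UK) // mulr_ile1 ?(abs_ge0 UK) //.
have fle' v t : absK (f v t) <= absK (b (t - v)).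
  rewrite /f 2!(absM UK) mulrAC mulrC ler_piMr ?(abs_ge0 UK) // mulr_ile1 ?(abs_ge0 UK) //.
have [|_ _ E] := tsum_fubini UK (f := f) CK.
  move=> e e0; have [N HN] := (vanish_size1 _ _).1 va e e0.
  have [N' HN'] := (vanish_size1 _ _).1 vb e e0.
  exists (zball N), (zball (N + N')) => v t; rewrite !in_zball -!ltnNge.
  case: (ltnP N (size1 v)) => [/ltnW/HN H _|Nv /= Nt]; first exact: le_trans (fle v t) H.
  apply: le_trans (fle' v t) (HN' _ _); rewrite -(leq_add2l (size1 v)).
  apply: leq_trans (size1_triangle t v); apply: leq_trans (ltnW Nt).
  by rewrite leq_add2r.
transitivity (tsum absK (fun v => tsum absK (f v))).
  apply: eq_tsum => v; rewrite /laurent_mul -(tsumZ UK CK); last exact: lmul_vanish.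
  have hI : injective (fun w : 'rV[int]_n => w + v) by move=> x y /addIr.
  have fv : vanish (abs := absK) (f v).
    have H := vanish_reindex (h := fun t : 'rV[int]_n => t - v) (f := b) (fun x y => @addIr _ (- v) x y) vb.
    by apply: vanish_le H _ => t; exact: fle'.
  rewrite (tsum_reindex UK CK hI _ fv); last first.
    by move=> t H; case: (H (t - v)); rewrite subrK.
  by apply: eq_tsum => w; rewrite /f /= addrK opprD addrA addrAC mulrA.
rewrite E; apply: eq_tsum => t.
rewrite [RHS]mulrC {1}/laurent_mul -(tsumZ UK CK); last exact: lmul_vanish.
by apply: eq_tsum => v; rewrite /f mulrC.
Qed.

(** At such points every monomial has absolute value 1, so all elements of $A_0$ converge there and
    values are bounded by coefficients. *)
Definition unit_pt (x : 'rV[Om]_n) : Prop := forall i, absOm (x 0 i) = 1.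
Definition xpow (x : 'rV[Om]_n) u : Om := \prod_i x 0 i ^ u 0 i.

Lemma xpow_abs x u : unit_pt x -> absOm (xpow x u) = 1.
Proof.
move=> Hx; rewrite /xpow (abs_prod UO) big1 // => i _.
by rewrite (absXz UO) Hx exp1rz.
Qed.

Lemma unit_pt_neq0 x i : unit_pt x -> x 0 i != 0.
Proof. by move=> Hx; rewrite -(abs_gt0 UO) Hx ltr01. Qed.

Lemma xpowD x u v : unit_pt x -> xpow x (u + v) = xpow x u * xpow x v.
Proof.
move=> Hx; rewrite /xpow -big_split /=; apply: eq_bigr => i _.
by rewrite mxE expfzDr // unit_pt_neq0.
Qed.

Lemma xpow0 x : xpow x 0 = 1.
Proof. by rewrite /xpow big1 // => i _; rewrite mxE expr0z. Qed.

Lemma unit_ptX x k : unit_pt x -> unit_pt (map_mx (fun t => t ^+ k) x).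
Proof. by move=> Hx i; rewrite mxE (absX UO) Hx expr1n. Qed.

Section Eval.
Variable x : 'rV[Om]_n.
Hypothesis Hx : unit_pt x.

Lemma eval_term_abs a u : absOm (iotaK (a u) * xpow x u) = absK (a u).
Proof. by rewrite (absM UO) absOm_iota xpow_abs // mulr1. Qed.

Lemma eval_vanish a : A0 a -> vanish (abs := absOm) (fun u => iotaK (a u) * xpow x u).
Proof. by move=> /A0P[_ H] e /H[A HA]; exists A => u /HA; rewrite eval_term_abs. Qed.

Lemma eval_le e a : 0 <= e -> A0 a -> (forall u, absK (a u) <= e) ->
  absOm (laurent_eval a x) <= e.
Proof.
move=> e0 Ha H; apply: (tsum_le UO CO) => [//||u]; first exact: eval_vanish.
by rewrite -/(xpow x u) eval_term_abs.
Qed.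

Lemma eval_le1 a : A0 a -> absOm (laurent_eval a x) <= 1.
Proof. by move=> Ha; apply: eval_le => //; have /A0P[] := Ha. Qed.

Lemma evalD a b : A0 a -> A0 b -> laurent_eval (a + b) x = laurent_eval a x + laurent_eval b x.
Proof.
move=> Ha Hb; rewrite /laurent_eval -(tsumD UO CO); try exact: eval_vanish.
by apply: eq_tsum => u; rewrite laurentDE rmorphD mulrDl.
Qed.

Lemma eval0 : laurent_eval 0 x = 0.
Proof.
rewrite /laurent_eval (tsum_finite UO CO (A := fset0)) ?big_seq_fset0 // => u _.
by rewrite [X in iotaK X](_ : _ = 0) // rmorph0 mul0r.
Qed.

Lemma evalB a b : A0 a -> A0 b -> laurent_eval (a - b) x = laurent_eval a x - laurent_eval b x.
Proof.
move=> Ha Hb; apply/eqP; rewrite eq_sym subr_eq; apply/eqP.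
by rewrite -evalD ?subrK //; exact: A0B.
Qed.

Lemma eval_sum (I : Type) (r : seq I) (f : I -> laurent) : (forall i, A0 (f i)) ->
  laurent_eval (\sum_(i <- r) f i) x = \sum_(i <- r) laurent_eval (f i) x.
Proof.
move=> H; elim: r => [|i r IH]; first by rewrite !big_nil eval0.
by rewrite !big_cons evalD ?IH //; exact: A0_sum.
Qed.

Lemma eval_close e a b : 0 <= e -> A0 a -> A0 b -> (forall u, absK (a u - b u) <= e) ->
  absOm (laurent_eval a x - laurent_eval b x) <= e.
Proof. by move=> e0 Ha Hb H; rewrite -evalB //; apply: eval_le => //; exact: A0B. Qed.

Lemma evalM a b : A0 a -> A0 b ->
  laurent_eval (lmul a b) x = laurent_eval a x * laurent_eval b x.
Proof.
move=> Ha Hb; have /A0P[a1 va] := Ha; have /A0P[b1 vb] := Hb.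
pose f (u v : 'rV[int]_n) := iotaK (a v * b (u - v)) * xpow x u.
have fE u v : absOm (f u v) = absK (a v) * absK (b (u - v)).
  by rewrite /f (absM UO) absOm_iota xpow_abs // mulr1 (absM UK).
have [|_ _ E] := tsum_fubini UO (f := f) CO.
  move=> e e0; have [N HN] := (vanish_size1 _ _).1 va e e0.
  have [N' HN'] := (vanish_size1 _ _).1 vb e e0.
  exists (zball (N + N')), (zball N) => u v; rewrite !in_zball -!ltnNge orbC fE.
  case: (ltnP N (size1 v)) => [/ltnW/HN H _|Nv /= Nt].
    by apply: le_trans H; rewrite ler_piMr ?(abs_ge0 UK).
  have /HN' H : (N' <= size1 (u - v))%N.
    rewrite -(leq_add2l (size1 v)).
    apply: leq_trans (size1_triangle u v); apply: leq_trans (ltnW Nt).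
    by rewrite leq_add2r.
  by apply: le_trans H; rewrite ler_piMl ?(abs_ge0 UK).
transitivity (tsum absOm (fun u => tsum absOm (f u))).
  apply: eq_tsum => u; rewrite -/(xpow x u) /laurent_mul.
  rewrite (tsum_map UK UO (@absOm_iota _ _ _ D) CK CO); last exact: lmul_vanish.
  rewrite mulrC -(tsumZ UO CO); last by apply: (vanish_map (@absOm_iota _ _ _ D)); exact: lmul_vanish.
  by apply: eq_tsum => v; rewrite /f mulrC.
rewrite E {2}/laurent_eval.
rewrite mulrC -(tsumZ UO CO); last exact: eval_vanish.
apply: eq_tsum => v; rewrite mulrC /laurent_eval -(tsumZ UO CO); last exact: eval_vanish.
have hI : injective (fun w : 'rV[int]_n => w + v) by move=> y z /addIr.
have fv : vanish (abs := absOm) (f^~ v).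
  have H := vanish_reindex (h := fun t : 'rV[int]_n => t - v) (f := b) (fun y z => @addIr _ (- v) y z) vb.
  move=> e /H[A HA]; exists A => u /HA /= H1; apply: le_trans H1.
  by rewrite fE ler_piMl ?(abs_ge0 UK).
rewrite (tsum_reindex UO CO hI _ fv); last first.
  by move=> t H; case: (H (t - v)); rewrite subrK.
apply: eq_tsum => w; rewrite /f /= addrK xpowD // rmorphM -!/(xpow x _); ring.
Qed.

End Eval.

Hypothesis q0 : (0 < q)%N.
Definition qmul u : 'rV[int]_n := map_mx (fun z => z * q%:Z) u.

Lemma qmul_inj : injective qmul.
Proof.
move=> u v /rowP E; apply/rowP => i; have := E i; rewrite !mxE; apply: mulIf.
by rewrite eqz_nat -lt0n.
Qed.

Lemma sigma_qmul a u : sigma a (qmul u) = a u.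
Proof.
rewrite /sigma; case: ifP => [_|/negP[]].
  congr (a _); apply/rowP => i; rewrite !mxE mulzK //; by rewrite eqz_nat -lt0n.
by apply/forallP => i; rewrite mxE dvdz_mull.
Qed.

Lemma sigma_out a u : (forall v, u <> qmul v) -> sigma a u = 0.
Proof.
move=> H; rewrite /sigma; case: ifP => // /forallP Hd.
case: (H (map_mx (fun z => (z %/ q%:Z)%Z) u)).
by apply/rowP => i; rewrite !mxE divzK.
Qed.

Lemma sigma_le (e : R) a u : 0 <= e -> (forall v, absK (a v) <= e) -> absK (sigma a u) <= e.
Proof.
move=> e0 H; case: (pselect (exists v, u = qmul v)) => [[v ->]|h]; first by rewrite sigma_qmul.
by rewrite sigma_out ?(abs0 UK) // => v uv; case: h; exists v.
Qed.

Lemma A0_sigma a : A0 a -> A0 (sigma a).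
Proof.
move=> /A0P[a1 va]; apply/A0P; split=> [u|e e0]; first exact: sigma_le.
have [A HA] := va e e0; exists [fset qmul v | v in A]%fset => u uA.
case: (pselect (exists v, u = qmul v)) => [[v uv]|h].
  rewrite uv sigma_qmul; apply: HA; apply: contraNN uA => vA.
  by apply/imfsetP; exists v.
by rewrite sigma_out ?(abs0 UK) ?ltW // => v uv; case: h; exists v.
Qed.

Lemma eval_sigma a x : unit_pt x -> A0 a ->
  laurent_eval (sigma a) x = laurent_eval a (map_mx (fun t => t ^+ q) x).
Proof.
move=> Hx Ha.
rewrite /laurent_eval (tsum_reindex UO CO qmul_inj); first last.
- by apply: eval_vanish => //; exact: A0_sigma.
- by move=> u H; rewrite sigma_out // rmorph0 mul0r.
apply: eq_tsum => u /=; rewrite sigma_qmul; congr (_ * _); apply: eq_bigr => i _.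
by rewrite !mxE mulrC -exprz_exp.
Qed.

Lemma gauss_le e a : (forall u, absK (a u) <= e) -> gauss_norm a <= e.
Proof.
move=> H; apply: ge_sup; first by exists (absK (a 0)); exists 0.
by move=> _ [u _ <-].
Qed.

Lemma gauss_ge a u : A0 a -> absK (a u) <= gauss_norm a.
Proof.
move=> /A0P[a1 _]; apply: ub_le_sup; last by exists u.
by exists 1 => _ [v _ <-].
Qed.

(** * Formal sums with coefficients in $A_0$ *)

Section FormalModule.
Variable I : set nat.
Implicit Types m : fvec D n I.

Lemma fnorm_le e m : 0 <= e -> (forall i u, absK (m i u) <= e) -> fnorm m <= e.
Proof.
move=> e0 H; rewrite /fnorm; set S := [set _ | _ in _].
(* The index set may be empty; the supremum is then 0. *)
case: (pselect (S !=set0)) => [S0|/nonemptyPn ->]; last by rewrite sup0.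
by apply: ge_sup => // _ [i _ <-]; exact: gauss_le.
Qed.

Lemma fnorm_ge m i u : fmodule m -> absK (m i u) <= fnorm m.
Proof.
move=> Hm; apply: le_trans (gauss_ge u (Hm i)) _; apply: ub_le_sup; last by exists i.
by exists 1 => _ [j _ <-]; apply: gauss_le => v; have /A0P[] := Hm j.
Qed.

Lemma fmoduleB m m' : fmodule m -> fmodule m' -> fmodule (fun i => m i - m' i).
Proof. by move=> H H' i; exact: A0B. Qed.

Variable J : set nat.
Implicit Types (f : J -> fvec D n I) (x y : fvec D n I) (g h : J -> laurent).

Lemma formal_sumB g h f x y : (forall j, fmodule (f j)) -> fmodule (I := J) g ->
  fmodule (I := J) h -> fmodule x -> fmodule y ->
  is_formal_sum g f x -> is_formal_sum h f y ->
  is_formal_sum (fun j => g j - h j) f (fun i => x i - y i).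
Proof.
move=> Hf Hc Hd Hx Hy H H' l e e0; have e2 : 0 < e / 2 by rewrite divr_gt0.
have [A HA] := H l _ e2; have [B HB] := H' l _ e2; exists (A `|` B)%fset => C.
rewrite fsubUset => /andP[/HA a /HB b].
have S0 (k : J -> laurent) : fmodule (I := J) k -> A0 (\sum_(j <- C) lmul (k j) (f j l)).
  by move=> H0; apply: A0_sum => j; apply: A0M => //; exact: Hf.
(* The Gauss norm is a supremum, so bounds on coefficients pass to it only in non-strict form; hence
   the room between $e/2$ and $e$. *)
apply: le_lt_trans (_ : e / 2 < e); last by rewrite ltr_pdivrMr ?ltr0n // ltr_pMr // ltr1n.
apply: gauss_le => u.
have -> : \sum_(j <- C) lmul (g j - h j) (f j l) =
   \sum_(j <- C) lmul (g j) (f j l) - \sum_(j <- C) lmul (h j) (f j l).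
  by rewrite -sumrB; apply: eq_bigr => j _; apply: lmulBl; [exact: Hc|exact: Hd|exact: Hf].
set Sg := \sum_(j <- C) lmul (g j) (f j l); set Sh := \sum_(j <- C) lmul (h j) (f j l).
have -> : (x l - y l - (Sg - Sh)) u = (x l - Sg) u - (y l - Sh) u.
  by rewrite !laurentBE; ring.
apply: (absB_le UK).
  by apply: le_trans (ltW a); apply: gauss_ge; apply: A0B; [exact: Hx|exact: S0].
by apply: le_trans (ltW b); apply: gauss_ge; apply: A0B; [exact: Hy|exact: S0].
Qed.

Lemma formal_sumZ b g f x : (forall j, fmodule (f j)) -> A0 b -> fmodule (I := J) g ->
  fmodule x -> is_formal_sum g f x ->
  is_formal_sum (fun j => lmul b (g j)) f (fun i => lmul b (x i)).
Proof.
move=> Hf Hb Hc Hx H l e e0; have e2 : 0 < e / 2 by rewrite divr_gt0.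
have [A HA] := H l _ e2; exists A => C /HA a.
have S0 : A0 (\sum_(j <- C) lmul (g j) (f j l)).
  by apply: A0_sum => j; apply: A0M; [exact: Hc | exact: Hf].
apply: le_lt_trans (_ : e / 2 < e); last by rewrite ltr_pdivrMr ?ltr0n // ltr_pMr // ltr1n.
have -> : \sum_(j <- C) lmul (lmul b (g j)) (f j l) =
  lmul b (\sum_(j <- C) lmul (g j) (f j l)).
  rewrite lmul_sumr //; last by move=> j; apply: A0M; [exact: Hc | exact: Hf].
  by apply: eq_bigr => j _; rewrite lmulA //; exact: Hf.
rewrite -(lmulBr Hb (Hx l) S0).
apply: gauss_le => u; apply: lmul_ler => [|//||v]; first exact: ltW.
  by apply: A0B => //; exact: Hx.
by apply: le_trans (ltW a); apply: gauss_ge; apply: A0B => //; exact: Hx.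
Qed.

Lemma formal_sum0 f : (forall j, fmodule (f j)) ->
  is_formal_sum (fun j : J => 0 : laurent) f (fun i : I => 0 : laurent).
Proof.
move=> Hf l e e0; exists fset0 => C _; rewrite big1 => [|j _]; last first.
  by apply: lmul0l; exact: Hf.
by rewrite subrr; apply: le_lt_trans e0; apply: gauss_le => u; rewrite (abs0 UK).
Qed.

Lemma fmodule0 (L : set nat) : fmodule (fun _ : L => 0 : laurent).
Proof. by move=> i; exact: A0_0. Qed.

Lemma formal_sum_sum (T : Type) (r : seq T) (g : T -> J -> laurent) f (x : T -> fvec D n I) :
  (forall j, fmodule (f j)) -> (forall t, fmodule (I := J) (g t)) ->
  (forall t, fmodule (x t)) -> (forall t, is_formal_sum (g t) f (x t)) ->
  is_formal_sum (fun j => \sum_(t <- r) g t j) f (fun i => \sum_(t <- r) x t i).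
Proof.
move=> Hf Hg Hx H; elim: r => [|t r IH].
  have -> : (fun j => \sum_(t <- [::]) g t j) = fun _ => 0 by apply/funext => j; rewrite big_nil.
  have -> : (fun i => \sum_(t <- [::]) x t i) = fun _ => 0 by apply/funext => j; rewrite big_nil.
  exact: formal_sum0.
have mg : fmodule (I := J) (fun j => \sum_(t <- r) g t j).
  by move=> j; apply: A0_sum => s; exact: Hg.
have mx : fmodule (fun i => \sum_(t <- r) x t i).
  by move=> j; apply: A0_sum => s; exact: Hx.
(* Addition is obtained from differences as $a - (0 - b)$. *)
have H1 := formal_sumB Hf (@fmodule0 J) mg (@fmodule0 I) mx (formal_sum0 Hf) IH.
have mg1 : fmodule (I := J) (fun j => 0 - \sum_(t <- r) g t j) by move=> i; apply: A0B; [exact: A0_0|].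
have mx1 : fmodule (fun i => 0 - \sum_(t <- r) x t i) by move=> i; apply: A0B; [exact: A0_0|].
have := formal_sumB Hf (Hg t) mg1 (Hx t) mx1 (H t) H1.
have G (V : zmodType) (a b : V) : a - (0 - b) = a + b by rewrite sub0r opprK.
have -> : (fun j => \sum_(t0 <- t :: r) g t0 j) = fun j => g t j - (0 - \sum_(t <- r) g t j).
  by apply/funext => j; rewrite big_cons; apply/esym; exact: G.
have -> // : (fun j => \sum_(t0 <- t :: r) x t0 j) = fun j => x t j - (0 - \sum_(t <- r) x t j).
by apply/funext => j; rewrite big_cons; apply/esym; exact: G.
Qed.
End FormalModule.
End Laurent.

Local Close Scope classical_set_scope.

(** * Independence of the basis *)

Local Open Scope classical_set_scope.
Lemma mx_prod_shift (F : pzRingType) (k m : nat) (A : nat -> 'M[F]_(k, m)) (V : nat -> 'M[F]_(m, k)) d :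
  mx_prod (fun i => A i *m V i) d *m A d = A 0%N *m mx_prod (fun i => V i *m A i.+1) d.
Proof.
elim: d => [|d IH]; first by rewrite /= mul1mx mulmx1.
by rewrite /= -mulmxA -[A d *m V d *m _]mulmxA mulmxA IH -!mulmxA.
Qed.

(** The chain $A_0 V_0 A_1 V_1 \cdots$ closes up at $A_d = A_0$, so moving the first factor to the
    end turns one product into the other. *)
Lemma char_ser_shift (F : comNzRingType) (k m : nat) (A : nat -> 'M[F]_(k, m)) (V : nat -> 'M[F]_(m, k)) d :
  (0 < d)%N -> A d = A 0%N ->
  char_ser (mx_prod (fun i => A i *m V i) d) = char_ser (mx_prod (fun i => V i *m A i.+1) d).
Proof.
case: d => // d _ E /=.
by rewrite mulmxA mx_prod_shift -mulmxA char_serC E mulmxA.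
Qed.

Section BasisChange.
Context {R : realType} {p q : nat} (D : padic_setting R p q) (n : nat).
Hypothesis pp : prime p.
Hypothesis q0 : (0 < q)%N.
Local Notation K := (K D).
Local Notation Om := (Om D).
Local Notation absK := (@absK _ _ _ D).
Local Notation absOm := (@absOm _ _ _ D).
Local Notation iotaK := (iotaK D).
Local Notation laurent := (laurent D n).
Local Notation lmul := (@laurent_mul _ _ _ D n).
Let UK : ultrametric_abs absK := absK_ultra D.
Let UO : ultrametric_abs absOm := absOm_ultra D.
Let CK : abs_complete absK := @K_complete _ _ _ D pp.
Let CO : abs_complete absOm := @Om_complete _ _ _ D.

Definition nuclear_mx (J : set nat) (B : J -> J -> laurent) : Prop :=
  (forall i j, A0 (B i j)) /\
  forall e : R, 0 < e -> exists N, forall i j : J, (N <= val j)%N ->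
    forall u, absK (B i j u) <= e.

Definition frob_pt (x : 'rV[Om]_n) i : 'rV[Om]_n := map_mx (fun t => t ^+ (q ^ i)) x.

Lemma frob_product_prod (J : set nat) (B : J -> J -> laurent) x d :
  frob_product B x d = imx_prod (fun i => imx_eval B (frob_pt x i)) d.
Proof. by elim: d => //= d ->. Qed.

Lemma frob_ptS x i : frob_pt x i.+1 = map_mx (fun t => t ^+ q) (frob_pt x i).
Proof. by apply/rowP => j; rewrite !mxE expnSr exprM. Qed.

Lemma unit_frob_pt x i : unit_pt x -> unit_pt (frob_pt x i).
Proof. exact: unit_ptX. Qed.

Section Nuclear.
Variables (J : set nat) (B : J -> J -> laurent) (x : 'rV[Om]_n).
Hypothesis HB : nuclear_mx B.
Hypothesis Hx : unit_pt x.

Lemma nuclear_eval_le1 i a b : absOm (imx_eval B (frob_pt x i) a b) <= 1.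
Proof. apply: eval_le1 => //; [exact: unit_frob_pt | exact: HB.1]. Qed.

Lemma nuclear_eval_tail N e : 0 <= e ->
  (forall (i j : J), (N <= val j)%N -> forall u, absK (B i j u) <= e) ->
  forall i (a b : J), (N <= val b)%N -> absOm (imx_eval B (frob_pt x i) a b) <= e.
Proof.
move=> e0 H i a b Nb; apply: eval_le => //; [exact: unit_frob_pt|exact: HB.1|exact: H].
Qed.

Lemma nuclear_eval_decay i : col_decay (imx_eval B (frob_pt x i)).
Proof.
move=> e e0; have [N HN] := HB.2 e e0; exists N => a b; exact: (nuclear_eval_tail (ltW e0) HN).
Qed.
End Nuclear.

Section Basis.
Variables (M : nuclear_sigma_module D n) (J : set nat) (f : J -> fvec D n (mindex M))
  (B : J -> J -> laurent).
Hypotheses (Bf : is_basis f) (HB : is_matrix_of f B).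
Local Notation I := (mindex M).
Local Notation S := (@std_matrix _ _ _ D n M).

Lemma evec_fmodule l : fmodule (evec D (n := n) (I := I) l).
Proof. by move=> i; rewrite /evec; case: eqP => _; [exact: A0_1 | exact: A0_0]. Qed.

Lemma std_A0 i j : A0 (S i j).
Proof. exact: (phi_stable (evec_fmodule j)). Qed.

Lemma std_nuclear : nuclear_mx S.
Proof.
split; first exact: std_A0.
move=> e e0; have [N _ HN] := @phi_nuclear _ _ _ _ _ M e e0; exists N => i j Nj u.
apply: le_trans (ltW (HN N (leqnn N) j Nj)).
by apply: (fnorm_ge i u); exact: phi_stable (evec_fmodule j).
Qed.

Lemma basis_A0 j l : A0 (f j l).
Proof. exact: Defs.basis_mem Bf j l. Qed.

(** By the basis axiom the formal sum with all coefficients equal to 1 converges, so its terms tend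
    to 0 in each coordinate. *)
Lemma basis_row_decay l (e : R) : 0 < e ->
  exists N, forall j : J, (N <= val j)%N -> forall u, absK (f j l u) <= e.
Proof.
move=> e0; have [|x xm Hx] := basis_sum Bf (a := fun=> laurent1 D (n := n)).
  by move=> j; exact: A0_1.
have [A HA] := Hx l e e0; exists (\max_(j <- A) val j).+1%N => j jN u.
have jA : j \notin A.
  apply/negP => jA; move: jN; rewrite ltnNge => /negP; apply.
  by rewrite (big_fsetD1 j) //= leq_maxl.
have SA (C : {fset J}) : A0 (x l - \sum_(j <- C) lmul (laurent1 D (n := n)) (f j l)).
  apply: A0B => //; apply: A0_sum => i; apply: A0M => //; [exact: A0_1 | exact: basis_A0].
have h1 := le_trans (gauss_ge u (SA A)) (ltW (HA A (fsubset_refl _))).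
have h2 := le_trans (gauss_ge u (SA (j |` A)%fset)) (ltW (HA _ (fsubsetU1 _ _))).
rewrite big_fsetU1 //= (lmul1 pp) in h2.
have -> : f j l u = (x l - \sum_(j <- A) lmul (laurent1 D (n := n)) (f j l)) u -
  (x l - (f j l + \sum_(j <- A) lmul (laurent1 D (n := n)) (f j l))) u.
  by rewrite !laurentBE laurentDE; ring.
exact: (absB_le UK).
Qed.

Lemma is_formal_sum_close (L : set nat) (g : L -> laurent) (h : L -> fvec D n I) x l u e (A : {fset L}) :
  0 <= e -> (forall j, A0 (g j)) -> (forall j, fmodule (h j)) -> fmodule x ->
  is_formal_sum g h x -> (forall j, j \notin A -> forall v, absK (lmul (g j) (h j l) v) <= e) ->
  absK ((x l - \sum_(j <- A) lmul (g j) (h j l)) u) <= e.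
Proof.
move=> e0 Hg Hh Hx H HA; apply/ler_addgt0Pl => d d0.
have [C HC] := H l d d0.
have SA (T : {fset L}) : A0 (x l - \sum_(j <- T) lmul (g j) (h j l)).
  by apply: A0B; [exact: Hx|]; apply: A0_sum => i; apply: A0M => //; exact: Hh.
pose E := (A `|` C)%fset.
have hE := le_trans (gauss_ge u (SA E)) (ltW (HC E (fsubsetUr _ _))).
have evS (T : {fset L}) : (\sum_(j <- T) lmul (g j) (h j l)) u = \sum_(j <- T) lmul (g j) (h j l) u.
  by elim/big_rec2: _ => // i a b _ <-.
have -> : (x l - \sum_(j <- A) lmul (g j) (h j l)) u = (x l - \sum_(j <- E) lmul (g j) (h j l)) u
  + (\sum_(j <- E) lmul (g j) (h j l) u - \sum_(j <- A) lmul (g j) (h j l) u).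
  by rewrite !laurentBE !evS; ring.
apply: (absD_le UK); first by apply: le_trans hE _; rewrite lerDl.
apply: le_trans (_ : e <= _); last by rewrite lerDr ltW.
apply: (fset_sum_sub UK (f := fun j => lmul (g j) (h j l) u)) => //; first exact: fsubsetUl.
by move=> j jA; exact: HA.
Qed.

Lemma mx_A0 i j : A0 (B i j).
Proof. by have [H _] := HB j; exact: H. Qed.

Lemma mx_col_norm j : fnorm (phi (f j)) = fnorm (fun i => B i j).
Proof.
have [H1 H2] := HB j; apply: (basis_norm Bf H1 _ H2).
exact: phi_stable (Defs.basis_mem Bf j).
Qed.

(** The norm of column [j] is that of $\phi(f_j) = \sum_l \sigma(f_{j,l}) \phi(e_l)$. Terms with
    large $l$ are small by nuclearity of the standard matrix, the finitely many others because
    $f_{j,l} \to 0$ as $j$ grows. *)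
Lemma mx_nuclear : nuclear_mx B.
Proof.
split; first exact: mx_A0.
move=> e e0; have [N HN] := std_nuclear.2 e e0.
have [N' HN'] : exists N', forall l : I, (val l < N)%N -> forall j : J, (N' <= val j)%N ->
    forall u, absK (f j l u) <= e.
  elim: (N) => [|k [N' IH]]; first by exists 0%N.
  case kI : (insub k : option I) => [l|]; last first.
    exists N' => l; rewrite ltnS leq_eqVlt => /orP[/eqP lk|]; last exact: IH.
    by move: kI; rewrite -lk valK.
  have [N2 H2] := basis_row_decay l e0; exists (maxn N' N2) => l'.
  rewrite ltnS leq_eqVlt => /orP[/eqP lk|lk] j; rewrite geq_max => /andP[j1 j2]; last exact: IH.
  have -> : l' = l by move: kI; rewrite -lk valK => -[].
  exact: H2.
exists N' => i j jN u.
apply: le_trans (fnorm_ge i u (m := fun i => B i j) _) _; first by move=> k; exact: mx_A0.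
rewrite -mx_col_norm; apply: fnorm_le => [|i' v]; first exact: ltW.
have sA l : A0 (sigma (f j l)) by apply: A0_sigma => //; exact: basis_A0.
have pA : fmodule (phi (f j)) := phi_stable (Defs.basis_mem Bf j).
have := @is_formal_sum_close I (fun l => sigma (f j l)) (fun l => phi (evec D l)) (phi (f j)) i' v e
  fset0 (ltW e0) sA (fun l => phi_stable (evec_fmodule l)) pA (phi_semilinear (Defs.basis_mem Bf j)).
rewrite big_seq_fset0 subr0; apply => l _ w.
case: (ltnP (val l) N) => lN.
  apply: lmul_le => //; [exact: ltW|exact: std_A0|] => w'.
  by apply: sigma_le => // [|v']; [exact: ltW | exact: HN'].
apply: lmul_ler => //; [exact: ltW|exact: std_A0|] => w'; exact: HN.
Qed.

(** Let $U$ be the matrix of the basis [f] and $W$ the coordinates of the $\phi(e_l)$ in that basis.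
    The standard matrix is $UW$ and [B] is $W \sigma(U)$; these two factorisations replace the usual
    conjugation and need no inverse of $U$. *)
Lemma transfer_exists : exists W : J -> I -> laurent,
  [/\ forall j l, A0 (W j l),
   forall l, is_formal_sum (fun j => W j l) f (phi (evec D l)) &
   forall (e : R) l, (forall i u, absK (S i l u) <= e) -> 0 <= e -> forall j u, absK (W j l u) <= e].
Proof.
have /choice[W HW] : forall l : I, exists a : fvec D n J, fmodule a /\ is_formal_sum a f (phi (evec D l)).
  by move=> l; have [a [Ha _]] := basis_coord Bf (phi_stable (evec_fmodule l)); exists a.
exists (fun j l => W l j); split=> [j l|l|e l H e0 j u].
- exact: (HW l).1.
- exact: (HW l).2.
apply: le_trans (fnorm_ge j u (HW l).1) _.
rewrite -(basis_norm Bf (HW l).1 (phi_stable (evec_fmodule l)) (HW l).2).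
exact: fnorm_le.
Qed.

Variable W : J -> I -> laurent.
Hypothesis W0 : forall j l, A0 (W j l).
Hypothesis Wsum : forall l, is_formal_sum (fun j => W j l) f (phi (evec D l)).

Lemma transfer_std x (l' l : I) (A : {fset J}) e : unit_pt x -> 0 <= e ->
  (forall j, j \notin A -> forall u, absK (f j l' u) <= e) ->
  absOm (laurent_eval (S l' l) x -
         \sum_(j <- A) laurent_eval (f j l') x * laurent_eval (W j l) x) <= e.
Proof.
move=> Hx e0 HA.
have -> : \sum_(j <- A) laurent_eval (f j l') x * laurent_eval (W j l) x =
  laurent_eval (\sum_(j <- A) lmul (W j l) (f j l')) x.
  rewrite (eval_sum Hx) //; last by move=> j; apply: A0M => //; exact: basis_A0.
  apply: eq_bigr => j _; rewrite (evalM pp Hx) //; [exact: mulrC | exact: basis_A0].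
apply: eval_close => //; first exact: std_A0.
  by apply: A0_sum => j; apply: A0M => //; exact: basis_A0.
move=> u; rewrite -laurentBE; apply: (is_formal_sum_close u e0 _ _ _ (Wsum l)).
- by move=> j; exact: W0.
- by move=> j; exact: Defs.basis_mem.
- exact: phi_stable (evec_fmodule l).
by move=> j /HA H v; apply: lmul_ler => //; exact: basis_A0.
Qed.

Lemma transfer_mx x (j' j : J) (A : {fset I}) e : unit_pt x -> 0 <= e ->
  (forall l, l \notin A -> forall i u, absK (S i l u) <= e) ->
  absOm (laurent_eval (B j' j) x -
    \sum_(l <- A) laurent_eval (W j' l) x * laurent_eval (f j l) (map_mx (fun t => t ^+ q) x)) <= e.
Proof.
move=> Hx e0 HA.
have sA l : A0 (sigma (f j l)) by apply: A0_sigma => //; exact: basis_A0.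
have -> : \sum_(l <- A) laurent_eval (W j' l) x * laurent_eval (f j l) (map_mx (fun t => t ^+ q) x) =
  laurent_eval (\sum_(l <- A) lmul (sigma (f j l)) (W j' l)) x.
  rewrite (eval_sum Hx) //; last by move=> l; apply: A0M.
  apply: eq_bigr => l _; rewrite (evalM pp Hx) // mulrC eval_sigma //; exact: basis_A0.
apply: eval_close => //; first exact: mx_A0.
  by apply: A0_sum => l; apply: A0M.
move=> u; rewrite -laurentBE.
have [Bm Bs] := HB j.
have gm l : fmodule (I := J) (fun j' => lmul (sigma (f j l)) (W j' l)).
  by move=> i; apply: A0M => //; exact: W0.
have xm l : fmodule (fun i => lmul (sigma (f j l)) (phi (evec D l) i)).
  by move=> i; apply: A0M => //; exact: std_A0.
have Fs l := formal_sumZ pp (Defs.basis_mem Bf) (sA l) (fun j' => W0 j' l) (phi_stable (evec_fmodule l)) (Wsum l).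
have Fs2 := formal_sum_sum pp A (Defs.basis_mem Bf) gm xm Fs.
have gm2 : fmodule (I := J) (fun j' => \sum_(l <- A) lmul (sigma (f j l)) (W j' l)).
  by move=> i; apply: A0_sum => l; exact: gm.
have xm2 : fmodule (fun i => \sum_(l <- A) lmul (sigma (f j l)) (phi (evec D l) i)).
  by move=> i; apply: A0_sum => l; exact: xm.
have pm : fmodule (phi (f j)) := phi_stable (Defs.basis_mem Bf j).
have Fs3 := formal_sumB pp (Defs.basis_mem Bf) Bm gm2 pm xm2 Bs Fs2.
have dm : fmodule (I := J) (fun j' => B j' j - \sum_(l <- A) lmul (sigma (f j l)) (W j' l)).
  exact: fmoduleB.
have dx : fmodule (fun i => phi (f j) i - \sum_(l <- A) lmul (sigma (f j l)) (phi (evec D l) i)).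
  exact: fmoduleB.
apply: le_trans (fnorm_ge j' u dm) _.
rewrite -(basis_norm Bf dm dx Fs3); apply: fnorm_le => // i v.
apply: (is_formal_sum_close v e0 sA _ pm (phi_semilinear (Defs.basis_mem Bf j))).
  by move=> l; exact: phi_stable (evec_fmodule l).
move=> l /HA H w; apply: lmul_ler => //; first exact: std_A0.
by move=> v'; exact: H.
Qed.
End Basis.

(** At $x^{q^i}$ the two matrices are $U_i W_i$ and $W_i U_{i+1}$, with $U_d = U_0$ because $x^{q^d}
    = x$. So [char_ser_shift] identifies the characteristic series of truncations that approximate
    both determinants within [e]. *)
Lemma fredholm_basis (M : nuclear_sigma_module D n) (J : set nat)
    (f : J -> fvec D n (mindex M)) (B : J -> J -> laurent) x d m :
  is_basis f -> is_matrix_of f B -> unit_pt x -> (0 < d)%N -> frob_pt x d = x ->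
  fredholm_det (frob_product (@std_matrix _ _ _ D n M) x d) m = fredholm_det (frob_product B x d) m.
Proof.
move=> Bf HB Hx d0 xd; have [W [W0 Wsum Wle]] := transfer_exists Bf.
have SN := std_nuclear M; have BN := mx_nuclear Bf HB.
apply: (abs_eq_lim UO) => e e0; rewrite !frob_product_prod.
have [N HN] := SN.2 e e0; have [N1 HN1] := BN.2 e e0.
have [N2 HN2] : exists N', forall l : mindex M, (val l < N.+1)%N -> forall j : J, (N' <= val j)%N ->
    forall u, absK (f j l u) <= e.
  elim: (N.+1) => [|k [N' IH]]; first by exists 0%N.
  case kI : (insub k : option (mindex M)) => [l|]; last first.
    exists N' => l; rewrite ltnS leq_eqVlt => /orP[/eqP lk|]; last exact: IH.
    by move: kI; rewrite -lk valK.
  have [N2 H2] := basis_row_decay Bf l e0; exists (maxn N' N2) => l'.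
  rewrite ltnS leq_eqVlt => /orP[/eqP lk|lk] j; rewrite geq_max => /andP[j1 j2]; last exact: IH.
  have -> : l' = l by move: kI; rewrite -lk valK => -[].
  exact: H2.
(* The second truncation is chosen after the first: from [N'] on, the basis vectors are small in all
   coordinates up to [N]. *)
pose N' := maxn N1 N2.
pose Ue y (l : mindex M) (j : J) := laurent_eval (f j l) y.
pose We y (j : J) (l : mindex M) := laurent_eval (W j l) y.
pose A i : 'M[Om]_(N.+1, N'.+1) := \matrix_(a, b) zext (Ue (frob_pt x i)) a b.
pose V i : 'M[Om]_(N'.+1, N.+1) := \matrix_(a, b) zext (We (frob_pt x i)) a b.
have ux i := unit_frob_pt i Hx.
have U1 i a b : absOm (Ue (frob_pt x i) a b) <= 1.
  by apply: eval_le1; [exact: ux | exact: basis_A0].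
have W1 i a b : absOm (We (frob_pt x i) a b) <= 1 by apply: eval_le1.
have A1 i a b : absOm (A i a b) <= 1 by rewrite mxE; exact: zext_le1.
have V1 i a b : absOm (V i a b) <= 1 by rewrite mxE; exact: zext_le1.
have AV1 i a b : absOm ((A i *m V i) a b) <= 1 by apply: (abs_mulmx_le1 UO).
have VA1 i a b : absOm ((V i *m A i.+1) a b) <= 1 by apply: (abs_mulmx_le1 UO).
have zmul (I1 I2 I3 : set nat) (F : I1 -> I2 -> Om) (G : I2 -> I3 -> Om) (H : I1 -> I3 -> Om) k (a b : nat) :
    (forall x y, (val x = a) -> (val y = b) -> absOm (H x y - \sum_(j <- below I2 k) F x j * G j y) <= e) ->
    absOm (zext H a b - \sum_(j < k) zext F a j * zext G j b) <= e.
  move=> K1; rewrite /zext; have := insubK I1 a; case: (insub a : option I1) => [x1|] /= E1; last first.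
    by rewrite big1 ?subrr ?(abs0 UO) ?ltW // => j _; rewrite mul0r.
  have := insubK I3 b; case: (insub b : option I3) => [y1|] /= E2; last first.
    rewrite big1 ?subrr ?(abs0 UO) ?ltW // => j _; case: (insub (j : nat) : option I2) => [c|] /=;
    by rewrite mulr0.
  have -> : \sum_(j < k) oapp (F x1) 0 (insub (j : nat)) * oapp (fun a => G a y1) 0 (insub (j : nat)) =
      \sum_(j <- below I2 k) F x1 j * G j y1.
    rewrite sum_below; apply: eq_bigr => j _.
    by case: (insub (j : nat) : option I2) => [c|] //=; rewrite mul0r.
  exact: K1.
have c1 : absOm (fredholm_det (imx_prod (fun i => imx_eval (@std_matrix _ _ _ D n M) (frob_pt x i)) d) m
    - (char_ser (mx_prod (fun i => A i *m V i) d))`_m) <= e.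
  apply: fredholm_prod_close => //.
  - by move=> i a b; exact: nuclear_eval_le1.
  - by move=> i; exact: nuclear_eval_decay.
  - exact: ltW.
  - move=> i a b Nb; apply: nuclear_eval_tail (ltW e0) HN _ _ _ _ => //; exact: ltnW.
  move=> i a b; rewrite mxE.
  under eq_bigr => j _ do rewrite !mxE.
  apply: zmul => l' l la lb.
  apply: (transfer_std Bf W0 Wsum) => //; first exact: ltW.
  move=> j; rewrite in_below -leqNgt => Nj u; apply: HN2; first by rewrite la.
  by apply: leq_trans Nj; rewrite leqW // leq_maxr.
have c2 : absOm (fredholm_det (imx_prod (fun i => imx_eval B (frob_pt x i)) d) m
    - (char_ser (mx_prod (fun i => V i *m A i.+1) d))`_m) <= e.
  apply: fredholm_prod_close => //.
  - by move=> i a b; exact: nuclear_eval_le1.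
  - by move=> i; exact: nuclear_eval_decay.
  - exact: ltW.
  - move=> i a b Nb; apply: nuclear_eval_tail (ltW e0) HN1 _ _ _ _ => //.
    by apply: leq_trans Nb; rewrite leqW // leq_maxl.
  move=> i a b; rewrite mxE.
  under eq_bigr => j _ do rewrite !mxE.
  apply: zmul => j' j ja jb; rewrite /Ue frob_ptS.
  apply: (transfer_mx Bf HB W0 Wsum) => //; first exact: ltW.
  by move=> l; rewrite in_below -leqNgt => Nl i' u; apply: HN; exact: ltnW.
apply: (abs_trans UO c1); rewrite (absBC UO) (char_ser_shift V d0) //.
have x0 : frob_pt x 0 = x by apply/rowP => i; rewrite !mxE expn0 expr1.
by rewrite /A xd x0.
Qed.

End BasisChange.

Local Close Scope classical_set_scope.

(** * The trace formula *)

Section CharacterSums.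
Variable (F : fieldType).

Lemma sum_root_powers (N : nat) (y : F) : y ^+ N = 1 ->
  \sum_(j < N) y ^+ j = if y == 1 then N%:R else 0.
Proof.
move=> yN; case: eqP => [->|/eqP y1].
  by under eq_bigr do rewrite expr1n; rewrite sumr_const card_ord.
by apply: (mulfI (x := y - 1)); rewrite ?subr_eq0 // -subrX1 yN subrr mulr0.
Qed.

Lemma prim_root_exprz (N : nat) (z : F) (w : int) : N.-primitive_root z ->
  (z ^ w == 1) = (N%:Z %| w)%Z.
Proof.
move=> zP; case: w => k; first by rewrite -exprnP -(prim_order_dvd zP).
rewrite NegzE -exprnN invr_eq1 -(prim_order_dvd zP).
by rewrite dvdzE abszN.
Qed.
Lemma exprn_exprz (x : F) (k : nat) (w : int) : (x ^+ k) ^ w = (x ^ w) ^+ k.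
Proof.
by rewrite -[x ^+ k]/(x ^ k%:Z) -[RHS]/((x ^ w) ^ k%:Z) !exprz_exp mulrC.
Qed.
End CharacterSums.

Section TraceFormula.
Context {R : realType} {p q : nat} (D : padic_setting R p q) (n : nat).
Hypothesis q1 : (1 < q)%N.
Local Notation K := (K D).
Local Notation Om := (Om D).
Local Notation iotaK := (iotaK D).
Local Notation zn := 'rV[int]_n.

(* Laurent polynomials are represented by lists of pairs
   (coefficient, exponent), with possible repetitions of exponents. *)
Definition lpoly := seq (K * zn)%type.
Definition leval (s : lpoly) (x : 'rV[Om]_n) : Om := \sum_(t <- s) iotaK t.1 * xpow x t.2.
Definition lcoef (s : lpoly) (w : zn) : K := \sum_(t <- s | t.2 == w) t.1.

Definition root_pt N (z : Om) (e : {ffun 'I_n -> 'I_N}) : 'rV[Om]_n := \row_i z ^+ e i.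

Lemma xpow_root_sum N (z : Om) (w : zn) : N.-primitive_root z ->
  \sum_(e : {ffun 'I_n -> 'I_N}) xpow (root_pt z e) w =
  if [forall i, (N%:Z %| w 0%R i)%Z] then N%:R ^+ n else 0.
Proof.
move=> zP.
transitivity (\prod_(i < n) \sum_(j < N) (z ^ w 0 i) ^+ j).
  rewrite bigA_distr_bigA /=; apply: eq_bigr => e _; apply: eq_bigr => i _.
  by rewrite mxE exprn_exprz.
have E i : \sum_(j < N) (z ^ w 0 i) ^+ j = if (N%:Z %| w 0%R i)%Z then N%:R else 0.
  rewrite sum_root_powers; first by rewrite (prim_root_exprz _ zP).
  by rewrite -exprn_exprz (prim_expr_order zP) exp1rz.
under eq_bigr => i _ do rewrite E.
case: ifP => [/forallP H|/negbT].
  under eq_bigr => i _ do rewrite H.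
  by rewrite prodr_const card_ord.
rewrite negb_forall => /existsP[i /negPf Hi].
by rewrite (bigD1 i) //= Hi mul0r.
Qed.

Variables (L : finType) (s : L -> L -> lpoly) (W : nat).
Hypothesis sW : forall f g t i, t \in s f g -> (absz (t.2 0%R i) <= W)%N.

(** The entries of the matrix product $s(X) s(X^q) \cdots s(X^{q^{m-1}})$, kept as lists of
    terms. *)
Fixpoint lprod m (f h : L) : lpoly :=
  if m is m'.+1 then
    flatten [seq [seq (t.1.1 * t.2.1, t.1.2 + t.2.2 *+ (q ^ m')) |
                  t <- [seq (a, b) | a <- lprod m' f g, b <- s g h]] | g <- enum L]
  else if f == h then [:: (1, 0)] else [::].

Lemma lprodS (V : nmodType) (F : K * zn -> V) m f h :
  \sum_(t <- lprod m.+1 f h) F t = \sum_g \sum_(a <- lprod m f g) \sum_(b <- s g h)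
    F (a.1 * b.1, a.2 + b.2 *+ (q ^ m)).
Proof.
rewrite /= big_flatten big_map big_enum /=; apply: eq_bigr => g _.
by rewrite big_map big_allpairs.
Qed.

(** The exponents are at most $W(1 + q + \cdots + q^{m-1}) \le W(q^m - 1)$. Those divisible by $q^m
    - 1$ therefore have their quotient in the box of radius $W$. *)
Lemma lprod_supp m f h t i : t \in lprod m f h -> (absz (t.2 0%R i) <= W * (q ^ m - 1))%N.
Proof.
elim: m h t => [|m IH] h t /=.
  by case: eqP => // _; rewrite inE => /eqP -> /=; rewrite mxE.
move=> /flattenP[l /mapP[g _ ->] /mapP[[a b] /allpairsP[[a' b'] /= [aP bP [-> ->]]] ->]] /=.
have := IH _ _ aP; have := sW i bP; rewrite !mxE -scaler_nat mxE natz.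
move: (a'.2 0 i) (b'.2 0 i) => x y Hy Hx.
have Q1 : (0 < q ^ m)%N by rewrite expn_gt0; lia.
rewrite expnS; nia.
Qed.

Lemma xpowMn (x : 'rV[Om]_n) (u : zn) k : xpow x (u *+ k) = xpow (map_mx (fun t => t ^+ k) x) u.
Proof.
apply: eq_bigr => i _; rewrite -scaler_nat !mxE natz.
by rewrite -exprz_exp.
Qed.

Definition lmx (x : 'rV[Om]_n) : 'M[Om]_#|L| :=
  \matrix_(i, j) leval (s (enum_val i) (enum_val j)) x.

Lemma lprod_eval m x i j : unit_pt x ->
  (mx_prod (fun k => lmx (frob_pt x k)) m) i j = leval (lprod m (enum_val i) (enum_val j)) x.
Proof.
move=> Hx; elim: m j => [|m IH] j.
  rewrite /= mxE (inj_eq enum_val_inj); case: eqP => _; rewrite /leval ?big_nil //.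
  by rewrite big_seq1 /= rmorph1 xpow0 mulr1.
rewrite [mx_prod _ _]/= mxE /leval lprodS.
rewrite (reindex (enum_val : 'I_#|L| -> L)) /=; last first.
  by apply: onW_bij; exact: enum_val_bij.
apply: eq_bigr => g _; rewrite IH mxE /leval big_distrlr /=.
apply: eq_bigr => a _; apply: eq_bigr => b _.
by rewrite xpowD // xpowMn rmorphM mulrACA.
Qed.

Local Notation box := {ffun 'I_n -> 'I_(W.*2.+1)}.
Local Notation bidx := (box * L)%type.

(** Dwork's operator on the monomials $X^u$ with $u$ in the box: multiplication by [s], then $X^{qv}
    \mapsto X^v$ and removal of all other monomials. Rows are indexed by the source. The box is
    stable because $(W + W)/q \le W$. *)
Definition dwork_mx : 'M[K]_#|{: bidx}| :=
  \matrix_(i, j) lcoef (s (enum_val i).2 (enum_val j).2)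
     (box_pt (enum_val j).1 *+ q - box_pt (enum_val i).1).

Lemma box_pt_le (b : box) i : (absz (box_pt b 0%R i) <= W)%N.
Proof.
have H : exists b' : box, box_pt b = box_pt b' by exists b.
exact: ((box_ptP W (box_pt b)).2 H i).
Qed.

Lemma zn_entry (a b : zn) k i : (a *+ k - b) 0 i = k%:Z * a 0 i - b 0 i.
Proof. by rewrite -scaler_nat !mxE natz. Qed.

(** The intermediate exponent is forced to be $w = qv - b$. If the total exponent is right, then
    $q^m w = a + u$ has entries at most $W(q^m - 1) + W = W q^m$, so $w$ lies in the box. *)
Lemma dwork_step m (a b : zn) (u v : box) :
  (forall i, (absz (a 0%R i) <= W * (q ^ m - 1))%N) -> (forall i, (absz (b 0%R i) <= W)%N) ->
  \sum_(w : box) ((a == box_pt w *+ (q ^ m) - box_pt u) && (b == box_pt v *+ q - box_pt w))%:R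
  = (a + b *+ (q ^ m) == box_pt v *+ (q ^ m.+1) - box_pt u)%:R :> K.
Proof.
move=> Ha Hb; have Q1 : (0 < q ^ m)%N by rewrite expn_gt0; lia.
have E w : a = w *+ (q ^ m) - box_pt u -> b = box_pt v *+ q - w ->
    a + b *+ (q ^ m) = box_pt v *+ (q ^ m.+1) - box_pt u.
  by move=> -> ->; rewrite mulrnBl -mulrnA expnS addrAC addrCA subrr addr0.
have E' w : b = box_pt v *+ q - w ->
    a + b *+ (q ^ m) = box_pt v *+ (q ^ m.+1) - box_pt u -> a = w *+ (q ^ m) - box_pt u.
  move=> -> /(canRL (addrK _)) ->; rewrite mulrnBl -mulrnA expnS.
  by rewrite opprB addrC addrA subrK.
pose w0 := box_pt v *+ q - b.
case: (pselect (exists w : box, w0 = box_pt w)) => [[w Ew]|Hw].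
  have bE : b = box_pt v *+ q - box_pt w by rewrite -Ew /w0 opprB addrC subrK.
  rewrite (bigD1 w) //= big1 ?addr0 => [|w' w'w].
    congr (_%:R); congr nat_of_bool; rewrite -bE eqxx andbT; apply/eqP/eqP => H; [exact: E H bE|exact: E' bE H].
  case: (_ =P _) => //= _; case: eqP => // bE'.
  by case/eqP: w'w; apply: box_pt_inj; apply/esym; rewrite -Ew /w0 bE' opprB addrC subrK.
rewrite big1 => [|w _]; last first.
  case: (_ =P _) => //= _; case: eqP => // bE'.
  by case: Hw; exists w; rewrite /w0 bE' opprB addrC subrK.
case: eqP => // H; case: Hw; apply/box_ptP => i.
have bE : b = box_pt v *+ q - w0 by rewrite /w0 opprB addrC subrK.
have /rowP/(_ i) := E' _ bE H; have := Ha i; have := box_pt_le u i.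
have -> : (w0 *+ (q ^ m) - box_pt u) 0 i = (q ^ m)%N%:Z * w0 0 i - box_pt u 0 i.
  exact: zn_entry.
move=> zW xW xE.
have yE : (q ^ m)%N%:Z * w0 0 i = a 0 i + box_pt u 0 i by rewrite xE subrK.
rewrite -(leq_pmul2l Q1) mulnC [leqRHS]mulnC.
have := congr1 absz yE; rewrite abszM absz_nat mulnC => ->.
rewrite (_ : (W * q ^ m = W * (q ^ m - 1) + W)%N); last by rewrite mulnBr muln1 subnK // leq_pmulr.
apply: leq_trans (leq_add xW zW); move: (a 0 i) (box_pt u 0 i) => x z; lia.
Qed.

Lemma dwork_pow m i j : (dwork_mx ^+ m) i j =
  lcoef (lprod m (enum_val i).2 (enum_val j).2)
    (box_pt (enum_val j).1 *+ (q ^ m) - box_pt (enum_val i).1).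
Proof.
elim: m j => [|m IH] j.
  rewrite expr0 mxE /= /lcoef.
  case: (eqVneq (enum_val i).2 (enum_val j).2) => E2; last first.
    by rewrite big_nil; case: (eqVneq i j) => [ij|//]; move: E2; rewrite ij eqxx.
  rewrite big_mkcond big_seq1 /= expn0 mulr1n [0 == _]eq_sym subr_eq0 (inj_eq (@box_pt_inj n W)).
  case: (eqVneq i j) => [->|ij]; first by rewrite eqxx.
  case: eqP => // E1; case/eqP: ij; apply: enum_val_inj.
  by move: E1 E2; case: (enum_val i); case: (enum_val j) => ? ? ? ? /= -> ->.
rewrite exprSr mxE /lcoef.
transitivity (\sum_(wg : bidx) lcoef (lprod m (enum_val i).2 wg.2)
     (box_pt wg.1 *+ (q ^ m) - box_pt (enum_val i).1) *
     lcoef (s wg.2 (enum_val j).2) (box_pt (enum_val j).1 *+ q - box_pt wg.1)).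
  rewrite [RHS](reindex (enum_val : 'I_#|{: bidx}| -> bidx)) /=; last first.
    by apply: onW_bij; exact: enum_val_bij.
  by apply: eq_bigr => k _; rewrite IH mxE.
rewrite [RHS]big_mkcond lprodS /=.
rewrite -(pair_bigA _ (fun w g => lcoef (lprod m (enum_val i).2 g)
     (box_pt w *+ (q ^ m) - box_pt (enum_val i).1) *
     lcoef (s g (enum_val j).2) (box_pt (enum_val j).1 *+ q - box_pt w))) /=.
rewrite exchange_big /=; apply: eq_bigr => g _.
transitivity (\sum_(w : box) \sum_(a <- lprod m (enum_val i).2 g) \sum_(b <- s g (enum_val j).2)
   ((a.2 == box_pt w *+ (q ^ m) - box_pt (enum_val i).1) &&
    (b.2 == box_pt (enum_val j).1 *+ q - box_pt w))%:R * (a.1 * b.1)).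
  apply: eq_bigr => w _; rewrite /lcoef big_distrl big_mkcond /=; apply: eq_bigr => a _.
  case: (a.2 =P _) => _ /=; last by rewrite big1 // => b _; rewrite mul0r.
  by rewrite big_distrr big_mkcond /=; apply: eq_bigr => b _; case: (b.2 =P _) => _; rewrite ?mul1r ?mul0r.
rewrite exchange_big; apply: eq_big_seq => a aP; rewrite exchange_big /=.
apply: eq_big_seq => b bP; rewrite -mulr_suml dwork_step.
- by case: eqP; rewrite ?mul1r ?mul0r.
- by move=> k; exact: lprod_supp aP.
- by move=> k; exact: sW bP.
Qed.

Lemma box_dvd m (w : zn) : (0 < m)%N -> (forall i, (absz (w 0%R i) <= W * (q ^ m - 1))%N) ->
  \sum_(u : box) (w == box_pt u *+ (q ^ m) - box_pt u)%:R =
  [forall i, ((q ^ m - 1)%N%:Z %| w 0%R i)%Z]%:R :> K.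
Proof.
move=> m0 Hw; have Q1 : (1 < q ^ m)%N by rewrite -(expn0 q) ltn_exp2l.
have E (u : box) i : (box_pt u *+ (q ^ m) - box_pt u) 0 i = (q ^ m - 1)%N%:Z * box_pt u 0 i.
  rewrite -scaler_nat !mxE natz -subzn ?(ltnW Q1) //; ring.
case: forallP => H /=; last first.
  rewrite big1 // => u _; case: eqP => // Ew; case: H => i.
  by rewrite Ew E dvdz_mulr.
have [u0 Eu] : exists u0 : box, (\row_i (w 0%R i %/ (q ^ m - 1)%N%:Z)%Z) = box_pt u0.
  apply/box_ptP => i; rewrite mxE; have := Hw i; have := H i.
  move=> /dvdzP[z ->]; rewrite mulzK; last by rewrite eqz_nat; lia.
  rewrite abszM /=; nia.
have wE : w = box_pt u0 *+ (q ^ m) - box_pt u0.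
  apply/rowP => i; rewrite E -Eu mxE mulrC divzK //; exact: H.
rewrite (bigD1 u0) //= -wE eqxx big1 ?addr0 // => u uu0.
case: eqP => // Ew; case/eqP: uu0; apply: box_pt_inj; apply/rowP => i.
have := E u i; rewrite -Ew wE E => /esym/mulfI; apply.
by rewrite eqz_nat; lia.
Qed.

(** Summation over the points with coordinates in the $(q^m - 1)$-th roots of unity kills all
    monomials except those with exponents divisible by $q^m - 1$. Each of these is $q^m u - u$ for
    exactly one $u$ in the box, and so is counted once in the trace of the $m$-th power of the Dwork
    matrix. *)
Lemma trace_formula m (z : Om) : (0 < m)%N -> (q ^ m - 1).-primitive_root z ->
  \sum_(e : {ffun 'I_n -> 'I_(q ^ m - 1)})
     \tr (mx_prod (fun k => lmx (frob_pt (root_pt z e) k)) m) =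
  iotaK (\tr (dwork_mx ^+ m) * (q ^ m - 1)%N%:R ^+ n).
Proof.
move=> m0 zP; have Q1 : (1 < q ^ m)%N by rewrite -(expn0 q) ltn_exp2l.
have upt (e : {ffun 'I_n -> 'I_(q ^ m - 1)}) : unit_pt (root_pt z e).
  move=> i; rewrite mxE; have := prim_expr_order zP => /(congr1 (@absOm _ _ _ D)).
  rewrite (absX (absOm_ultra D)) (abs1 (absOm_ultra D)) => /eqP.
  rewrite pexpr_eq1 ?subn_gt0 ?(abs_ge0 (absOm_ultra D)) // => /eqP Ez.
  by rewrite (absX (absOm_ultra D)) Ez expr1n.
transitivity (\sum_(e : {ffun 'I_n -> 'I_(q ^ m - 1)}) \sum_(f : L) leval (lprod m f f) (root_pt z e)).
  apply: eq_bigr => e _; rewrite /mxtrace (reindex (enum_val : 'I_#|L| -> L)) /=; last first.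
    by apply: onW_bij; exact: enum_val_bij.
  by apply: eq_bigr => i _; exact: lprod_eval.
have -> : \tr (dwork_mx ^+ m) = \sum_(f : L) \sum_(u : box)
    lcoef (lprod m f f) (box_pt u *+ (q ^ m) - box_pt u).
  rewrite exchange_big /= (pair_bigA _ (fun u f => lcoef (lprod m f f) (box_pt u *+ (q ^ m) - box_pt u))) /=.
  rewrite [RHS](reindex (enum_val : 'I_#|{: bidx}| -> bidx)) /=; last first.
    by apply: onW_bij; exact: enum_val_bij.
  by apply: eq_bigr => i _; exact: dwork_pow.
rewrite exchange_big /= mulr_suml rmorph_sum; apply: eq_bigr => f _.
rewrite /leval exchange_big /=.
transitivity (\sum_(t <- lprod m f f) iotaK (t.1 * ([forall i, ((q ^ m - 1)%N%:Z %| t.2 0%R i)%Z]%:R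
   * (q ^ m - 1)%N%:R ^+ n))).
  apply: eq_bigr => t _; rewrite -mulr_sumr xpow_root_sum // rmorphM; congr (_ * _).
  by case: ifP => _; rewrite ?mul1r ?mul0r ?rmorph0 // rmorphXn /= rmorph_nat.
rewrite -rmorph_sum; congr (iotaK _).
transitivity ((\sum_(t <- lprod m f f) t.1 * \sum_(u : box) (t.2 == box_pt u *+ (q ^ m) - box_pt u)%:R) *
   (q ^ m - 1)%N%:R ^+ n).
  rewrite mulr_suml; apply: eq_big_seq => t tP; rewrite box_dvd ?mulrA //.
  by move=> i; exact: lprod_supp tP.
congr (_ * _).
transitivity (\sum_(t <- lprod m f f) \sum_(u : box) t.1 * (t.2 == box_pt u *+ (q ^ m) - box_pt u)%:R).
  by apply: eq_bigr => t _; rewrite mulr_sumr.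
rewrite exchange_big /=; apply: eq_bigr => u _; rewrite /lcoef [RHS]big_mkcond.
by apply: eq_bigr => t _; case: eqP; rewrite ?mulr1 ?mulr0.
Qed.
End TraceFormula.

(** * Growth of the characteristic series of the Dwork matrix *)

Section WeightedBounds.
Context {R : realType} {F : fieldType} {abs : F -> R} (U : ultrametric_abs abs).

(** Conjugation by the diagonal matrix of the [w i] keeps the determinant and leaves columns bounded
    by the [b j]. *)
Lemma abs_det_weight m (A : 'M[F]_m) (w b : 'I_m -> R) : (forall i, 0 < w i) ->
  (forall i, 0 <= b i) -> (forall i j, abs (A i j) <= w i / w j * b j) ->
  abs (\det A) <= \prod_j b j.
Proof.
move=> w0 b0 H; rewrite /determinant; apply: (abs_sum_le U); first exact: prodr_ge0.
move=> s _; rewrite (absM U) (absX U) (absN1 U) expr1n mul1r (abs_prod U).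
apply: (@le_trans _ _ (\prod_i (w i / w (s i) * b (s i)))).
  by apply: ler_prod => i _; rewrite (abs_ge0 U) H.
have reidx (f : 'I_m -> R) : \prod_i f (s i) = \prod_i f i.
  by rewrite [RHS](reindex_inj (@perm_inj _ s)).
rewrite !big_split /= reidx (reidx (fun i => (w i)^-1)) prodfV mulfV ?mul1r //.
by apply/prodf_neq0 => i _; rewrite gt_eqF.
Qed.

(** A principal minor is at most the product of its column bounds; at most [#|bad|] of these exceed
    [rho], and each such column costs a factor [C / rho]. *)
Lemma abs_char_ser_weight N (A : 'M[F]_N) (w b : 'I_N -> R) (bad : {set 'I_N}) (rho C : R) m :
  0 < rho -> rho <= C -> (forall i, 0 < w i) -> (forall i, 0 <= b i) ->
  (forall i, b i <= C) -> (forall i, i \notin bad -> b i <= rho) ->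
  (forall i j, abs (A i j) <= w i / w j * b j) ->
  abs (char_ser A)`_m <= rho ^+ m * (C / rho) ^+ #|bad|.
Proof.
move=> r0 rC w0 b0 bC bbad H.
have C0 : 0 < C by exact: lt_le_trans rC.
have Cr1 : 1 <= C / rho by rewrite ler_pdivlMr // mul1r.
rewrite char_ser_coef (absM U) (absX U) (absN1 U) expr1n mul1r.
apply: (abs_sum_le U) => [|S /eqP <-].
  by rewrite mulr_ge0 ?exprn_ge0 ?divr_ge0 ?ltW.
pose h (a : 'I_#|S|) := enum_val a : 'I_N.
have hI : injective h by exact: enum_val_inj.
have hS : [set h a | a : 'I_#|S|] = S.
  apply/setP => i; apply/imsetP/idP => [[a _ ->]|iS]; first exact: enum_valP.
  by exists (enum_rank_in iS i) => //; rewrite /h enum_rankK_in.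
rewrite -{1}hS -principal_detE //.
apply: le_trans (abs_det_weight (w := w \o h) (b := b \o h) _ _ _) _ => //.
- by move=> i; exact: w0.
- by move=> i; exact: b0.
- by move=> i j; rewrite mxE; exact: H.
apply: (@le_trans _ _ (\prod_(a < #|S|) (rho * (if h a \in bad then C / rho else 1)))).
  apply: ler_prod => a _; rewrite b0 /=; case: ifP => [_|/negbT/bbad]; last by rewrite mulr1.
  by rewrite mulrC divfK ?gt_eqF.
rewrite big_split /= prodr_const card_ord ler_pM2l ?exprn_gt0 // -big_mkcond /=.
rewrite prodr_const; apply: ler_weXn2l => //.
rewrite -(card_imset _ hI); apply: subset_leq_card; apply/fintype.subsetP => _ /imsetP[a aB ->].
by move: aB; rewrite unfold_in.
Qed.
End WeightedBounds.

Lemma inord_shift_inj V (x y : int) : (absz x <= V)%N -> (absz y <= V)%N ->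
  inord (absz (x + V%:Z)) = inord (absz (y + V%:Z)) :> 'I_(V.*2.+1) -> x = y.
Proof. move=> xV yV /(congr1 val) /=; rewrite !inordK; lia. Qed.

Section DworkBound.
Context {R : realType} {p q : nat} (D : padic_setting R p q) (n : nat).
Hypothesis q1 : (1 < q)%N.
Local Notation K := (K D).
Local Notation absK := (@absK _ _ _ D).
Local Notation zn := 'rV[int]_n.
Let UK : ultrametric_abs absK := absK_ultra D.

Variables (U0 g r : R).
Hypotheses (U0_gt0 : 0 < U0) (g0 : 0 < g) (r1 : 1 <= r) (rq : r < q%:R `^ g).

(* The coefficient a of X^u satisfies |a| <= delta * max(1, |u| / (d U0)) ^ -g. *)
Definition term_decay (d : nat) (delta : R) (t : K * zn) : Prop :=
  exists2 y : R, 1 <= y & (size1 t.2)%:R <= d%:R * U0 * y /\ absK t.1 * y `^ g <= delta.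

(** Beyond this value $v (q - r^{1/g}) \ge 1$; the positivity of $q - r^{1/g}$ is the assumption $r
    < q^g$. *)
Definition threshold : R := Num.max 1 (q%:R - r `^ g^-1)^-1.

Let r0 : 0 < r. Proof. exact: lt_le_trans r1. Qed.

Let rg_lt : r `^ g^-1 < q%:R.
Proof.
have q0 : 0 <= (q%:R : R) by [].
have -> : (q%:R : R) = (q%:R `^ g) `^ g^-1 by rewrite -powRrM divff ?gt_eqF // powRr1.
by apply: gt0_ltr_powR; rewrite ?invr_gt0 // nnegrE ?powR_ge0 // ltW.
Qed.

Let thr1 : 1 <= threshold. Proof. by rewrite /threshold le_max lexx. Qed.

Let powR_ge1 (x : R) : 1 <= x -> 1 <= x `^ g.
Proof.
move=> x1; have -> : 1 = 1 `^ g :> R by rewrite powR1.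
by apply: ge0_ler_powR; rewrite ?nnegrE // ltW // (lt_le_trans ltr01).
Qed.

(** From $(x - 1)(y - 1) \ge 0$ follows $qv \le x + y \le xy + 1$, and for $v$ beyond the threshold
    the 1 is absorbed: $xy \ge v r^{1/g}$. *)
Lemma weight_ineq (v x y : R) : 1 <= x -> 1 <= y -> threshold < v -> q%:R * v <= x + y ->
  v `^ g * r <= (x * y) `^ g.
Proof.
move=> x1 y1 tv H.
have xy : x + y <= x * y + 1 by rewrite -subr_ge0 (_ : _ - _ = (x - 1) * (y - 1)) ?mulr_ge0 ?subr_ge0 //; ring.
have v0 : 0 < v by apply: lt_trans tv; exact: lt_le_trans thr1.
have qr0 : 0 < q%:R - r `^ g^-1 by rewrite subr_gt0.
have : (q%:R - r `^ g^-1)^-1 <= v by apply: le_trans (ltW tv); rewrite /threshold le_max lexx orbT.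
rewrite -[X in X <= _]mul1r ler_pdivrMr // mulrBr => H1.
have H2 : v * r `^ g^-1 <= x * y by rewrite [v * q%:R]mulrC in H1; lra.
have -> : v `^ g * r = (v * r `^ g^-1) `^ g.
  rewrite powRM; [|exact: ltW|exact: powR_ge0].
  by rewrite -powRrM mulVf ?gt_eqF // powRr1 // ltW.
apply: (ge0_ler_powR (ltW g0)) => //; rewrite nnegrE mulr_ge0 ?powR_ge0 ?(le_trans ler01) //.
exact: le_trans thr1 (ltW tv).
Qed.

Variables (L : finType) (s : L -> L -> lpoly D n) (W d : nat) (kappa : L -> R).
Hypothesis kappa01 : forall h, 0 <= kappa h <= 1.
Hypothesis d0 : (0 < d)%N.
Hypothesis s_decay : forall f h t, t \in s f h -> term_decay d (kappa h) t.

Definition dworkC : R := threshold `^ g.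

Let Ud : R := d%:R * U0.
Let Ud0 : 0 < Ud. Proof. by rewrite mulr_gt0 // ltr0n. Qed.

Definition ball_bound : nat := Num.truncn (Ud * threshold).

Let M (u : zn) : R := Num.max 1 ((size1 u)%:R / Ud).
Let M1 u : 1 <= M u. Proof. by rewrite /M le_max lexx. Qed.
Let M0 u : 0 < M u. Proof. exact: lt_le_trans (M1 u). Qed.
Let hh (v : zn) : R := if (size1 v)%:R <= Ud * threshold then dworkC else r^-1.

Let C1 : 1 <= dworkC.
Proof. exact: powR_ge1. Qed.

Let hh_ge0 v : 0 <= hh v.
Proof. by rewrite /hh; case: ifP => _; rewrite ?powR_ge0 // invr_ge0 ltW. Qed.

Lemma size1Mn (v : zn) k : size1 (v *+ k) = (k * size1 v)%N.
Proof.
rewrite /size1 big_distrr /=; apply: eq_bigr => i _.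
by rewrite -scaler_nat mxE natz abszM.
Qed.

(** Since $qv = u + t$ with $t$ the exponent of the term, $M(u)$ and $y$ dominate the two summands.
    If $v$ is beyond the threshold, [weight_ineq] gains the factor $1/r$; otherwise only the
    constant [dworkC] is available. *)
Let key (u v : zn) (t : K * zn) h : term_decay d (kappa h) t -> t.2 = v *+ q - u ->
  absK t.1 <= (M u `^ g) / (M v `^ g) * (kappa h * hh v).
Proof.
move=> [y y1 [ty tk]] t2.
have y0 : 0 < y by exact: lt_le_trans y1.
have yg : 0 < y `^ g by rewrite powR_gt0.
have Mg w : 0 < M w `^ g by rewrite powR_gt0.
have /andP[k0 k1] := kappa01 h.
rewrite -(ler_pM2r yg); apply: le_trans tk _.
rewrite -(ler_pM2r (Mg v)).
have -> : M u `^ g / M v `^ g * (kappa h * hh v) * y `^ g * M v `^ g =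
  kappa h * ((M u * y) `^ g * hh v).
  by rewrite powRM ?ltW //; field; rewrite gt_eqF.
rewrite ler_wpM2l //.
have Muy : 1 <= (M u * y) `^ g.
  by apply: powR_ge1; rewrite -[leLHS]mulr1 ler_pM.
rewrite /hh; case: ifP => [vT|/negbT].
  apply: (@le_trans _ _ dworkC); last by rewrite ler_peMl ?powR_ge0.
  apply: (ge0_ler_powR (ltW g0)); rewrite ?nnegrE ?(le_trans ler01) //.
  by rewrite /M ge_max thr1 ler_pdivrMr // mulrC.
rewrite -ltNge => vT.
have tv : threshold < (size1 v)%:R / Ud by rewrite ltr_pdivlMr // mulrC.
have -> : M v = (size1 v)%:R / Ud by rewrite /M max_r // ltW // (le_lt_trans thr1).
rewrite ler_pdivlMr // mulrC mulrC; apply: weight_ineq => //.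
have le1 : (q * size1 v <= size1 u + size1 t.2)%N.
  by rewrite -size1Mn t2; exact: size1_triangle.
rewrite mulrA ler_pdivrMr //.
apply: (@le_trans _ _ (size1 u + size1 t.2)%N%:R); first by rewrite -natrM ler_nat.
rewrite natrD mulrDl; apply: lerD; last by rewrite mulrC.
by rewrite -ler_pdivrMr // /M le_max lexx orbT.
Qed.

(** A column is exceptional only if its exponent has size at most [ball_bound] and its weight
    [kappa h] exceeds $1/(Cr)$ with $C$ = [dworkC]. Once [Z] is given, the number of such columns
    depends neither on the box radius [W] nor on the size of [L], which makes the estimate uniform
    in the truncation. *)
Lemma dwork_bound Z m : (#|[set h | ((dworkC * r)^-1 < kappa h)%R]| <= Z)%N ->
  absK (char_ser (dwork_mx s W))`_m * r ^+ m <=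
    (dworkC * r) ^+ ((ball_bound.*2.+1 ^ n) * Z).
Proof.
move=> HZ; have Cr1 : 1 <= dworkC * r by rewrite -[leLHS]mulr1 ler_pM.
pose bidx := ({ffun 'I_n -> 'I_(W.*2.+1)} * L)%type.
pose w (i : 'I_#|{: bidx}|) := M (box_pt (enum_val i).1) `^ g.
pose b (i : 'I_#|{: bidx}|) := kappa (enum_val i).2 * hh (box_pt (enum_val i).1).
pose bad := [set i | r^-1 < b i].
rewrite -ler_pdivlMr ?exprn_gt0 // mulrC -exprVn.
apply: (@le_trans _ _ (r^-1 ^+ m * (dworkC / r^-1) ^+ #|bad|)).
  apply: (abs_char_ser_weight (w := w) (b := b) UK); rewrite ?invr_gt0 //.
  - by apply: le_trans C1; rewrite invf_le1.
  - by move=> i; rewrite powR_gt0.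
  - by move=> i; rewrite mulr_ge0 //; have /andP[] := kappa01 (enum_val i).2.
  - move=> i; have /andP[k0 k1] := kappa01 (enum_val i).2.
    apply: (@le_trans _ _ (hh (box_pt (enum_val i).1))); first by rewrite ler_piMl.
    by rewrite /hh; case: ifP => // _; apply: le_trans C1; rewrite invf_le1.
  - by move=> i; rewrite inE -leNgt.
  move=> i j; rewrite mxE /lcoef.
  apply: (abs_sum_seq_le UK) => [|t ts /eqP t2].
    rewrite mulr_ge0 ?divr_ge0 ?powR_ge0 // mulr_ge0 //.
    by have /andP[] := kappa01 (enum_val j).2.
  exact: key (s_decay ts) t2.
rewrite invrK ler_pM2l ?exprn_gt0 ?invr_gt0 //; apply: ler_weXn2l => //.
pose V := ball_bound.
pose f0 (i : 'I_#|{: bidx}|) : {ffun 'I_n -> 'I_(V.*2.+1)} * L :=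
  ([ffun k => inord (absz ((box_pt (enum_val i).1) 0 k + V%:Z))], (enum_val i).2).
have badP i : i \in bad -> (size1 (box_pt (enum_val i).1) <= V)%N /\
    (dworkC * r)^-1 < kappa (enum_val i).2.
  rewrite inE /b /hh; have /andP[k0 k1] := kappa01 (enum_val i).2.
  case: ifP => [vT H|_]; last by rewrite ltNge ler_piMl // invr_ge0 ltW.
  split; first by rewrite /V /ball_bound truncn_ge_nat // mulr_ge0 ?ltW // (lt_le_trans _ thr1).
  rewrite invfM mulrC ltr_pdivrMr // (lt_le_trans _ C1) //.
have f0I : {in bad &, injective f0}.
  move=> i j /badP[iV _] /badP[jV _] [/ffunP E1 E2].
  apply: enum_val_inj; move: E1 E2 iV jV.
  case: (enum_val i) => u1 h1; case: (enum_val j) => u2 h2 /= E1 -> iV jV; congr (_, _).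
  apply: box_pt_inj; apply/rowP => k; move: (E1 k); rewrite !ffunE.
  have := leq_trans (size1_ge (box_pt u1) k) iV; have := leq_trans (size1_ge (box_pt u2) k) jV.
  by move=> Hy Hx /(inord_shift_inj Hx Hy).
rewrite -(card_in_imset f0I).
apply: (@leq_trans #|finset.setX [set: {ffun 'I_n -> 'I_(V.*2.+1)}] [set h | ((dworkC * r)^-1 < kappa h)%R]|).
  apply: subset_leq_card; apply/fintype.subsetP => _ /imsetP[i /badP[_ ib] ->].
  by rewrite !inE.
by rewrite cardsX cardsT card_ffun !card_ord leq_mul2l HZ orbT.
Qed.
End DworkBound.

(** * Tensor products of exterior powers *)

Section Compound.
Variable F : comNzRingType.
Variables (N : nat) (lam : seq nat).
Local Notation L := {ffun 'I_(size lam) -> {set 'I_N.+1}}.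

(* The matrix of the tensor product of the exterior powers of orders [lam]. *)
Definition compound (A : 'M[F]_N.+1) (f h : L) : F :=
  \prod_(a < size lam) cminor (nth 0%N lam a) A (f a) (h a).

Lemma compoundM A B f h : compound (A *m B) f h = \sum_g compound A f g * compound B g h.
Proof.
rewrite /compound; under eq_bigr => a _ do rewrite cminorM.
by rewrite bigA_distr_bigA /=; apply: eq_bigr => g _; rewrite -big_split.
Qed.

Lemma compound_prod (A : nat -> 'M[F]_N.+1) (T : nat -> 'M[F]_#|{: L}|) m i j :
  (forall k i j, T k i j = compound (A k) (enum_val i) (enum_val j)) ->
  mx_prod T m.+1 i j = compound (mx_prod A m.+1) (enum_val i) (enum_val j).
Proof.
move=> H; elim: m j => [|m IH] j; first by rewrite /= !mul1mx.
rewrite [mx_prod T _]/= mxE [mx_prod A _]/= compoundM.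
rewrite [RHS](reindex (enum_val : 'I_#|{: L}| -> L)) /=; last first.
  by apply: onW_bij; exact: enum_val_bij.
by apply: eq_bigr => k _; rewrite -H -IH.
Qed.

Definition char_monomial (A : 'M[F]_N.+1) : F :=
  \prod_(a < size lam) ((-1) ^+ nth 0%N lam a * (char_ser A)`_(nth 0%N lam a)).

Lemma compound_trace A : \sum_f compound A f f = char_monomial A.
Proof.
rewrite /char_monomial; under [RHS]eq_bigr => a _ do rewrite -cminor_trace.
by rewrite bigA_distr_bigA.
Qed.
End Compound.

(** * Growth bounds uniform in the truncation *)

Section UniformBound.

Context {R : realType} {p q : nat} (D : padic_setting R p q) (n : nat).
Hypothesis pp : prime p.
Hypothesis q1 : (1 < q)%N.
Local Notation K := (K D).
Local Notation Om := (Om D).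
Local Notation iotaK := (iotaK D).
Local Notation absK := (@absK _ _ _ D).
Local Notation zn := 'rV[int]_n.
Let UK : ultrametric_abs absK := absK_ultra D.

Section LaurentPoly.
Variables (U0 g : R).
Hypotheses (U00 : 0 < U0) (g0 : 0 < g).
Local Notation decay := (@term_decay _ _ _ D n U0 g).

(** Functions on the unit torus rather than lists of terms: the representing Laurent polynomial is
    only asked to exist, so closure under sums, products and determinants can be proved for
    functions. *)
Definition laurent_fun d (delta : R) (phi : 'rV[Om]_n -> Om) : Prop :=
  exists s : lpoly D n, (forall x, unit_pt x -> leval s x = phi x) /\
    (forall t, t \in s -> decay d delta t).

Lemma laurent_fun0 d delta : laurent_fun d delta (fun=> 0).
Proof. by exists [::]; split=> // x _; rewrite /leval big_nil. Qed.

Lemma laurent_fun1 : laurent_fun 0 1 (fun=> 1).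
Proof.
exists [:: (1, 0)]; split=> [x _|t]; first by rewrite /leval big_seq1 /= rmorph1 xpow0 mulr1.
rewrite inE => /eqP ->; exists 1 => //=; rewrite powR1 mulr1 (abs1 UK) !mul0r; split=> //.
by rewrite /size1 big1 // => i _; rewrite mxE.
Qed.

Lemma laurent_funD d delta phi psi : laurent_fun d delta phi -> laurent_fun d delta psi ->
  laurent_fun d delta (fun x => phi x + psi x).
Proof.
move=> [s [Hs ds]] [t [Ht dt]]; exists (s ++ t); split=> [x ux|w].
  by rewrite /leval big_cat /= -Hs // -Ht.
by rewrite mem_cat => /orP[/ds|/dt].
Qed.

Lemma laurent_funN d delta phi : laurent_fun d delta phi -> laurent_fun d delta (fun x => - phi x).
Proof.
move=> [s [Hs ds]]; exists [seq (- t.1, t.2) | t <- s]; split=> [x ux|w].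
  by rewrite /leval big_map -Hs // /leval -sumrN; apply: eq_bigr => t _; rewrite rmorphN mulNr.
by move=> /mapP[t /ds[y y1 [H1 H2]] ->]; exists y => //=; rewrite (absN UK).
Qed.

(** If $|u| \le d U_0 y$ and $|u'| \le d' U_0 z$ with $y, z \ge 1$, then $|u + u'| \le (d + d') U_0
    yz$. The weights multiply while the factor [d] adds, and this is why [d] is recorded. *)
Lemma laurent_funM d d' delta delta' phi psi : 0 <= delta ->
  laurent_fun d delta phi -> laurent_fun d' delta' psi ->
  laurent_fun (d + d') (delta * delta') (fun x => phi x * psi x).
Proof.
move=> de0 [s [Hs ds]] [t [Ht dt]].
exists [seq (a.1 * b.1, a.2 + b.2) | a <- s, b <- t]; split=> [x ux|w].
  rewrite -Hs // -Ht // /leval big_allpairs_dep big_distrlr /=.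
  by apply: eq_bigr => a _; apply: eq_bigr => b _; rewrite /= xpowD // rmorphM mulrACA.
move=> /allpairsP[[a b] /= [/ds[y y1 [H1 H2]] /dt[z z1 [H3 H4]] ->]].
have y0 : 0 < y by exact: lt_le_trans y1.
have z0 : 0 < z by exact: lt_le_trans z1.
exists (y * z); first by rewrite -[leLHS]mulr1 ler_pM.
split=> /=.
  apply: (@le_trans _ _ (size1 a.2 + size1 b.2)%N%:R); first by rewrite ler_nat size1D.
  rewrite natrD natrD mulrDl mulrDl; apply: lerD.
    by apply: le_trans H1 _; apply: ler_wpM2l; [exact: mulr_ge0 (ltW U00)|rewrite ler_peMr // ltW].
  by apply: le_trans H3 _; apply: ler_wpM2l; [exact: mulr_ge0 (ltW U00)|rewrite ler_peMl // ltW].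
rewrite (absM UK) (powRM _ (ltW y0) (ltW z0)) mulrACA; apply: ler_pM => //.
  by rewrite mulr_ge0 ?(abs_ge0 UK) ?powR_ge0.
by rewrite mulr_ge0 ?(abs_ge0 UK) ?powR_ge0.
Qed.

Lemma laurent_fun_le d d' delta delta' phi : (d <= d')%N -> delta <= delta' ->
  laurent_fun d delta phi -> laurent_fun d' delta' phi.
Proof.
move=> dd de [s [Hs ds]]; exists s; split=> // t /ds[y y1 [H1 H2]]; exists y => //; split.
  apply: le_trans H1 _; apply: ler_wpM2r; first exact: le_trans y1.
  by apply: ler_wpM2r; rewrite ?ler_nat // ltW.
exact: le_trans H2 de.
Qed.

Lemma laurent_fun_sum d delta (I : Type) (r : seq I) (phi : I -> 'rV[Om]_n -> Om) :
  (forall i, laurent_fun d delta (phi i)) ->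
  laurent_fun d delta (fun x => \sum_(i <- r) phi i x).
Proof.
move=> H; elim: r => [|i r IH].
  have -> : (fun x => \sum_(i <- [::]) phi i x) = fun=> 0 by apply/funext => x; rewrite big_nil.
  exact: laurent_fun0.
have -> : (fun x => \sum_(j <- i :: r) phi j x) = fun x => phi i x + \sum_(j <- r) phi j x.
  by apply/funext => x; rewrite big_cons.
exact: laurent_funD.
Qed.

Lemma laurent_fun_prod (I : Type) (r : seq I) (d : I -> nat) (delta : I -> R)
    (phi : I -> 'rV[Om]_n -> Om) : (forall i, 0 <= delta i) ->
  (forall i, laurent_fun (d i) (delta i) (phi i)) ->
  laurent_fun (\sum_(i <- r) d i) (\prod_(i <- r) delta i) (fun x => \prod_(i <- r) phi i x).
Proof.
move=> de0 H; elim: r => [|i r IH].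
  have -> : (fun x => \prod_(i <- [::]) phi i x) = fun=> 1 by apply/funext => x; rewrite big_nil.
  by rewrite !big_nil; exact: laurent_fun1.
have -> : (fun x => \prod_(j <- i :: r) phi j x) = fun x => phi i x * \prod_(j <- r) phi j x.
  by apply/funext => x; rewrite big_cons.
by rewrite !big_cons; apply: laurent_funM.
Qed.

Lemma laurent_fun_det m (A : 'I_m -> 'I_m -> 'rV[Om]_n -> Om) (delta : 'I_m -> R) :
  (forall j, 0 <= delta j) -> (forall i j, laurent_fun 1 (delta j) (A i j)) ->
  laurent_fun m (\prod_j delta j) (fun x => \det (\matrix_(i, j) A i j x)).
Proof.
move=> de0 H; rewrite /determinant; apply: laurent_fun_sum => s.
have H1 : laurent_fun m (\prod_j delta j) (fun x => \prod_i A i (s i) x).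
  have := @laurent_fun_prod _ (index_enum 'I_m) (fun=> 1%N) (fun i => delta (s i))
    (fun i => A i (s i)) (fun i => de0 _) (fun i => H i (s i)).
  rewrite sum1_card card_ord.
  by rewrite -(reindex_inj (@perm_inj _ s) (P := xpredT) (F := delta)).
have -> : (fun x => (-1) ^+ s * \prod_i (\matrix_(i, j) A i j x) i (s i)) =
  (fun x => (-1) ^+ s * \prod_i A i (s i) x).
  by apply/funext => x; congr (_ * _); apply: eq_bigr => i _; rewrite mxE.
case: (odd_perm s); last by have -> : (fun x => (-1) ^+ false * \prod_i A i (s i) x) =
    (fun x => \prod_i A i (s i) x) by apply/funext => x; rewrite expr0 mul1r.
have -> : (fun x => (-1) ^+ true * \prod_i A i (s i) x) = (fun x => - \prod_i A i (s i) x).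
  by apply/funext => x; rewrite expr1 mulN1r.
exact: laurent_funN.
Qed.
End LaurentPoly.

Variables (J : set nat) (B : J -> J -> laurent D n).

Definition weight (U0 : R) (u : zn) : R := Num.max 1 ((size1 u)%:R / U0).

(** What log-convergence supplies at one radius $r$: decay of the coefficients like $|u|^{-g}$ for
    some $g$ with $q^g > r$, and nuclearity for the norm weighted accordingly. *)
Definition tame (r : R) : Prop := exists U0 g : R,
  [/\ 0 < U0, 0 < g, r < q%:R `^ g,
   forall i j u, absK (B i j u) * weight U0 u `^ g <= 1 &
   forall eta : R, 0 < eta -> exists N1, forall i j : J, (N1 <= val j)%N ->
     forall u, absK (B i j u) * weight U0 u `^ g <= eta].

Definition trunc_list N (i j : nat) : lpoly D n :=
  oapp (fun a : J => oapp (fun b : J => [seq (B a b u, u) | u <- zball n N]) [::] (insub j)) [::] (insub i).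

Definition trunc_mx N x : 'M[Om]_N.+1 := \matrix_(i, j) leval (trunc_list N i j) x.

Definition trunc_prod N x m : 'M[Om]_N.+1 := mx_prod (fun k => trunc_mx N (frob_pt x k)) m.

(** The bound [A] must not depend on [N], since a limit in [N] follows. A tensor index involving
    some basis index at least [N1] has weight [eta], and the others number at most [Z], whatever [N]
    is. *)
Lemma trunc_prod_bound (r : R) lam : 1 <= r -> tame r -> exists A : R, forall N,
  exists tau Dp : nat -> K,
  [/\ forall m (z : Om), (0 < m)%N -> (q ^ m - 1).-primitive_root z ->
        \sum_(e : {ffun 'I_n -> 'I_(q ^ m - 1)})
           char_monomial lam (trunc_prod N (root_pt z e) m) = iotaK (tau m * (q ^ m - 1)%N%:R ^+ n),
      ps_log_deriv (fun m => - tau m) Dp & forall m, absK (Dp m) * r ^+ m <= A].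
Proof.
move=> r1 [U0 [g [U00 g0 rq B1 Beta]]].
pose C := dworkC (q := q) g r.
have C1 : 1 <= C.
  rewrite /C /dworkC; have -> : 1 = 1 `^ g :> R by rewrite powR1.
  apply: (ge0_ler_powR (ltW g0)); rewrite ?nnegrE // /threshold ?le_max ?ler01 ?lexx //.
have Cr0 : 0 < C * r by rewrite mulr_gt0 // (lt_le_trans ltr01).
have Cr1 : 1 <= C * r by rewrite -[leLHS]mulr1 ler_pM.
(* The level up to which [dwork_bound] does not count an index as exceptional. *)
pose eta := (C * r)^-1; have eta0 : 0 < eta by rewrite invr_gt0.
have eta1 : eta <= 1 by rewrite /eta invf_le1.
have [N1 HN1] := Beta eta eta0.
(* An entry of the compound matrix is homogeneous of degree $\sum_a \lambda_a$ in the entries of the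
   truncated matrix; the successor only ensures that [d] is positive. *)
pose d := (\sum_(a < size lam) nth 0%N lam a).+1.
pose Z := #|{: {ffun 'I_(size lam) -> {set 'I_N1}}}|.
exists ((C * r) ^+ (((ball_bound (q := q) U0 g r d).*2.+1 ^ n) * Z)) => N.
pose L := {ffun 'I_(size lam) -> {set 'I_N.+1}}.
pose dl (b : nat) : R := if (b < N1)%N then 1 else eta.
have dl0 b : 0 <= dl b by rewrite /dl; case: ifP => _ //; exact: ltW.
have dl1 b : dl b <= 1 by rewrite /dl; case: ifP.
pose kappa (h : L) : R := if [forall a, [forall b in h a, (b < N1)%N]] then 1 else eta.
have entry (i j : 'I_N.+1) : laurent_fun U0 g 1 (dl j) (leval (trunc_list N i j)).
  exists (trunc_list N i j); split=> // t; rewrite /trunc_list.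
  case: (insub (i : nat) : option J) => [a|] //=; have := insubK J (j : nat).
  case: (insub (j : nat) : option J) => [b|] //= bj /mapP[u _ ->].
  exists (weight U0 u); first by rewrite /weight le_max lexx.
  rewrite /= mul1r; split; first by rewrite mulrC -ler_pdivrMr // /weight le_max lexx orbT.
  rewrite /dl; case: ltnP => // jN1; by apply: HN1; have -> : val b = j by exact: bj.
have centry (f h : L) : laurent_fun U0 g d (kappa h) (fun x => compound (trunc_mx N x) f h).
  case: (boolP [forall a, (#|f a| == nth 0%N lam a) && (#|h a| == nth 0%N lam a)]) => [/forallP fh|].
    apply: (@laurent_fun_le _ _ U00 _ _
      (\prod_(a < size lam) \prod_(b < nth 0%N lam a) dl (set_nth (h a) b)) _ _ (leqnSn _)).
    - rewrite /kappa; case: ifP => [_|/negbT].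
        by apply: prodr_ile1 => a _; rewrite prodr_ge0 //=; apply: prodr_ile1 => b _; rewrite dl0 dl1.
      rewrite negb_forall => /existsP[a]; rewrite negb_forall_in => /existsP[b /andP[bh bN]].
      have /andP[_ /eqP ha] := fh a.
      have [c _ bc] : exists2 c, c \in 'I_(nth 0%N lam a) & b = set_nth (h a) c.
        by apply/imsetP; rewrite set_nth_im.
      have p01 (T : finType) (P : pred T) (G : T -> R) : (forall i, 0 <= G i <= 1) -> 0 <= \prod_(i | P i) G i <= 1.
        by move=> H; rewrite prodr_ge0 => [|i _]; [apply: prodr_ile1|have /andP[] := H i].
      have dl01 b' : 0 <= dl b' <= 1 by rewrite dl0 dl1.
      have -> : eta = dl b by rewrite /dl (negPf bN).
      rewrite (bigD1 a) //= (bigD1 c) //= -bc -mulrA; apply: ler_piMr => //.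
      have /andP[X0 X1] := p01 _ (fun i => i != c) _ (fun i => dl01 (set_nth (h a) i)).
      have /andP[Y0 Y1] := p01 _ (fun i => i != a) _ (fun i =>
        p01 _ xpredT _ (fun b' : 'I_(nth 0%N lam i) => dl01 (set_nth (h i) b'))).
      exact: mulr_ile1.
    apply: (@laurent_fun_prod _ _ U00 _ (index_enum 'I_(size lam)) (fun a => nth 0%N lam a)
      (fun a => \prod_(b < nth 0%N lam a) dl (set_nth (h a) b)) (fun (a : 'I_(size lam)) x =>
      cminor (nth 0%N lam a) (trunc_mx N x) (f a) (h a))) => a; first exact: prodr_ge0.
    rewrite /cminor; have /andP[-> ->] /= := fh a.
    have := @laurent_fun_det _ _ U00 (nth 0%N lam a) (fun b c => leval (trunc_list N (set_nth (f a) b) (set_nth (h a) c)))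
      (fun c => dl (set_nth (h a) c)) (fun c => dl0 _) (fun b c => entry _ _).
    set X := (fun x => \det _) => HX; set Y := (fun x => \det _); have -> // : Y = X.
    by apply/funext => x; congr (\det _); apply/matrixP => b c; rewrite !mxE.
  rewrite negb_forall => /existsP[a Ha].
  have -> : (fun x => compound (trunc_mx N x) f h) = fun=> 0; last exact: laurent_fun0.
  by apply/funext => x; rewrite /compound (bigD1 a) //= /cminor (negPf Ha) mul0r.
have /choice[s' Hs'] : forall fh : L * L, exists s : lpoly D n,
    (forall x, unit_pt x -> leval s x = compound (trunc_mx N x) fh.1 fh.2) /\
    (forall t, t \in s -> term_decay U0 g d (kappa fh.2) t).
  by move=> [f h]; exact: centry.
pose s (f h : L) := s' (f, h).
have sE f h x : unit_pt x -> leval (s f h) x = compound (trunc_mx N x) f h.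
  by move=> ux; exact: (Hs' (f, h)).1.
have sd f h t : t \in s f h -> term_decay U0 g d (kappa h) t := (Hs' (f, h)).2 t.
pose W := \max_(f : L) \max_(h : L) \max_(t <- s f h) size1 t.2.
have sW f h t i : t \in s f h -> (absz (t.2 0%R i) <= W)%N.
  move=> ts; apply: leq_trans (size1_ge _ _) _.
  apply: leq_trans (leq_bigmax (F := fun f : L => \max_(h : L) \max_(t <- s f h) size1 t.2) f).
  apply: leq_trans (leq_bigmax (F := fun h : L => \max_(t <- s f h) size1 t.2) h).
  by rewrite (big_rem t) //= leq_maxl.
exists (fun m => \tr (dwork_mx s W ^+ m)), (fun m => (char_ser (dwork_mx s W))`_m); split.
- move=> m z m0 zP; rewrite -(trace_formula q1 sW m0 zP); apply: eq_bigr => e _.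
  case: m m0 zP e => // m m0 zP e.
  have ux : unit_pt (root_pt z e).
    move=> i; rewrite mxE; have := prim_expr_order zP => /(congr1 (@absOm _ _ _ D)).
    rewrite (absX (absOm_ultra D)) (abs1 (absOm_ultra D)) => /eqP.
    have Q1 : (1 < q ^ m.+1)%N by rewrite -(expn0 q) ltn_exp2l.
    rewrite pexpr_eq1 ?subn_gt0 ?(abs_ge0 (absOm_ultra D)) // => /eqP Ez.
    by rewrite (absX (absOm_ultra D)) Ez expr1n.
  rewrite -compound_trace /mxtrace (reindex (enum_val : 'I_#|{: L}| -> L)) /=; last first.
    by apply: onW_bij; exact: enum_val_bij.
  apply: eq_bigr => i _; apply/esym; apply: compound_prod => k i' j'.
  by rewrite mxE sE //; exact: unit_frob_pt.
- exact: char_ser_log_deriv.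
move=> m; apply: (@dwork_bound _ _ _ _ _ _ _ _ U00 g0 r1 rq L s W d kappa _ _ sd) => //.
  by move=> h; rewrite /kappa; case: ifP => _; rewrite ?ler01 ?lexx ?eta1 ?ltW.
(* Sets of ordinals below [N1] are determined by their trace on the first [N1] ordinals; this
   injection gives the count [Z]. *)
pose pull (h : L) : {ffun 'I_(size lam) -> {set 'I_N1}} :=
  [ffun a => [set b : 'I_N1 | [exists c in h a, val c == val b]]].
have small h : h \in [set h | (eta < kappa h)%R] -> forall a b, b \in h a -> (b < N1)%N.
  rewrite inE /kappa; case: ifP => [/forallP H _ a b bh|_]; last by rewrite ltxx.
  by have /forallP/(_ b) := H a; rewrite bh.
rewrite -(card_in_imset (f := pull)); first exact: max_card.
move=> h h' /small Sh /small Sh' /ffunP E; apply/ffunP => a; apply/setP => b.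
have pullE (k : L) (bN : (b < N1)%N) : (Ordinal bN \in pull k a) = (b \in k a).
  rewrite ffunE inE; apply/existsP/idP => [[c /andP[ck /eqP cb]]|bk].
    by have <- : c = b by apply: val_inj.
  by exists b; rewrite bk /=.
case: (ltnP b N1) => bN; first by rewrite -(pullE h bN) -(pullE h' bN) E.
transitivity false; first by apply/negP => /Sh; rewrite ltnNge bN.
by apply/esym/negP => /Sh'; rewrite ltnNge bN.
Qed.
End UniformBound.

(** * Convergence of the truncations and the decay given by log-convergence *)

Section Truncation.
Context {R : realType} {p q : nat} (D : padic_setting R p q) (n : nat).
Hypothesis pp : prime p.
Hypothesis q1 : (1 < q)%N.
Local Notation K := (K D).
Local Notation Om := (Om D).
Local Notation iotaK := (iotaK D).
Local Notation absK := (@absK _ _ _ D).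
Local Notation absOm := (@absOm _ _ _ D).
Local Notation zn := 'rV[int]_n.
Let UK : ultrametric_abs absK := absK_ultra D.
Let UO : ultrametric_abs absOm := absOm_ultra D.
Let CO : abs_complete absOm := @Om_complete _ _ _ D.
Variables (J : set nat) (B : J -> J -> laurent D n).
Hypothesis HB : nuclear_mx B.

Lemma tame_decay r (e : R) : tame B r -> 0 < e ->
  exists T, forall i j u, (T <= size1 u)%N -> absK (B i j u) <= e.
Proof.
move=> [U0 [g [U00 g0 _ B1 _]]] e0.
pose y := e^-1 `^ g^-1; exists (Num.truncn (U0 * y)).+1 => i j u Hu.
have y0 : 0 <= y by exact: powR_ge0.
have yw : y <= weight U0 u.
  rewrite /weight le_max; apply/orP; right; rewrite ler_pdivlMr // mulrC.
  apply: le_trans (ltW (truncnS_gt _)) _; by rewrite ler_nat.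
have : e^-1 <= weight U0 u `^ g.
  have -> : e^-1 = y `^ g.
    by rewrite /y -powRrM mulVf ?gt_eqF // powRr1 // invr_ge0 ltW.
  by apply: (ge0_ler_powR (ltW g0)); rewrite // nnegrE // (le_trans y0).
move=> H; have := B1 i j u; have ei : 0 < e^-1 by rewrite invr_gt0.
have w0 : 0 < weight U0 u `^ g by exact: lt_le_trans H.
rewrite -ler_pdivlMr // div1r => /le_trans; apply.
by rewrite -[leRHS]invrK lef_pV2 ?posrE.
Qed.

Lemma trunc_mx_le1 N x a b : unit_pt x -> absOm (trunc_mx B N x a b) <= 1.
Proof.
move=> ux; rewrite mxE /trunc_list /leval.
case: (insub (a : nat) : option J) => [i|] /=; last by rewrite big_nil (abs0 UO).
case: (insub (b : nat) : option J) => [j|] /=; last by rewrite big_nil (abs0 UO).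
rewrite big_map; apply: (abs_sum_le UO) => // u _.
rewrite eval_term_abs //; have /A0P[H _] := HB.1 i j; exact: H.
Qed.

Lemma trunc_mx_close r (e : R) : tame B r -> 0 < e -> exists N0, forall N, (N0 <= N)%N ->
  forall x (a b : 'I_N.+1), unit_pt x ->
    absOm (zext (imx_eval B x) a b - trunc_mx B N x a b) <= e.
Proof.
move=> tB e0; have [T HT] := tame_decay tB e0; exists T => N TN x a b ux.
rewrite mxE /trunc_list /zext /leval.
case: (insub (a : nat) : option J) => [i|] /=; last by rewrite big_nil subr0 (abs0 UO) ltW.
case: (insub (b : nat) : option J) => [j|] /=; last by rewrite big_nil subr0 (abs0 UO) ltW.
rewrite big_map; apply: (tsum_trunc UO CO (ltW e0)); first exact: eval_vanish (HB.1 i j).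
move=> u; rewrite in_zball -ltnNge => Nu; rewrite eval_term_abs //.
by apply: HT; exact: ltnW (leq_ltn_trans TN Nu).
Qed.

Lemma trunc_prod_cvg r (e : R) : tame B r -> 0 < e -> exists N0, forall N, (N0 <= N)%N ->
  forall x d m, unit_pt x -> (0 < d)%N ->
    absOm (fredholm_det (frob_product B x d) m - (char_ser (trunc_prod B N x d))`_m) <= e.
Proof.
move=> tB e0; have [N0 HN0] := trunc_mx_close tB e0; have [N1 HN1] := HB.2 _ e0.
exists (maxn N0 N1) => N; rewrite geq_max => /andP[NN0 NN1] x d m ux d0.
rewrite frob_product_prod; apply: fredholm_prod_close => //.
- by move=> i a b; exact: nuclear_eval_le1.
- by move=> i; exact: nuclear_eval_decay.
- exact: ltW.
- move=> i; apply: (nuclear_eval_tail HB ux (ltW e0)) => i' j Nj u.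
  by apply: HN1; exact: leq_trans NN1 (ltnW Nj).
- by move=> i a b; apply: trunc_mx_le1; exact: unit_frob_pt.
by move=> i a b; apply: HN0 => //; exact: unit_frob_pt.
Qed.

(** If $\mathrm{ord}_\pi B_u \ge g_1 \log_q |u|$, then $|B_u| \le |u|^{-G_1}$ with $G_1 = g_1 \ln p
    / \ln q$, and $p^{g_0} = q^{G_0}$. The gap between [g0] and [g1] makes the weighted coefficients
    tend to 0 as $|u|$ grows, uniformly in the entries; for the finitely many remaining exponents,
    nuclearity makes the columns small. *)
Lemma log_convergent_tame (c : \bar R) (g0 g1 r : R) :
  (c <= liminf_oo (fun u => ord_coef B u * ((ln (size1 u)%:R / ln q%:R)^-1)%:E))%E ->
  0 < g0 -> g0 < g1 -> (g1%:E < c)%E -> r < p%:R `^ g0 -> tame B r.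
Proof.
move=> cB g00 g01 g1c rp.
have lp0 : 0 < ln p%:R :> R by rewrite ln_gt0 // p_gt1R.
have q1R : 1 < q%:R :> R by rewrite ltr1n.
have lq0 : 0 < ln q%:R :> R by rewrite ln_gt0.
pose G0 := g0 * ln p%:R / ln q%:R; pose G1 := g1 * ln p%:R / ln q%:R.
have G00 : 0 < G0 by rewrite /G0 divr_gt0 // mulr_gt0.
have G01 : G0 < G1 by rewrite /G0 /G1 ltr_pM2r ?invr_gt0 // ltr_pM2r.
have := lt_le_trans g1c cB; rewrite /liminf_oo => /ereal_sup_gt[_ [V [N _ NV] <-]] HV.
have Bu i j u : (maxn N 2 <= size1 u)%N -> absK (B i j u) * (size1 u)%:R `^ G1 <= 1.
  rewrite geq_max => /andP[Nu u2]; have u1 : 1 < (size1 u)%:R :> R by rewrite ltr1n.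
  have lu0 : 0 < ln (size1 u)%:R :> R by rewrite ln_gt0.
  have [->|Bn0] := eqVneq (B i j u) 0; first by rewrite (abs0 UK) mul0r.
  have B0 : 0 < absK (B i j u) by rewrite (abs_gt0 UK).
  set kap := (ln (size1 u)%:R / ln q%:R)^-1 : R.
  have kap0 : 0 < kap by rewrite invr_gt0 divr_gt0.
  have H : (g1%:E < ord_coef B u * kap%:E)%E.
    apply: lt_le_trans HV _; apply: ereal_inf_lbound; exists u => //; exact: NV.
  have H2 : (ord_coef B u <= (- (ln (absK (B i j u)) / ln p%:R))%:E)%E.
    apply: ereal_inf_lbound; exists (i, j) => //=; by rewrite /ordK (negPf Bn0).
  have := lt_le_trans H (lee_wpmul2r _ H2); rewrite lee_fin => /(_ (ltW kap0)).
  rewrite -EFinM lte_fin /kap ltr_pdivlMr ?divr_gt0 // -mulNr ltr_pdivlMr // => H3.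
  have H4 : ln (absK (B i j u)) + G1 * ln (size1 u)%:R <= 0.
    move: (ltW H3); rewrite /G1 -subr_ge0 -[_ <= 0]oppr_ge0 => H4.
    have -> : - (ln (absK (B i j u)) + g1 * ln p%:R / ln q%:R * ln (size1 u)%:R) =
      - ln (absK (B i j u)) - g1 * (ln (size1 u)%:R / ln q%:R) * ln p%:R by field; rewrite gt_eqF.
    exact: H4.
  rewrite -ler_ln ?posrE ?mulr_gt0 ?powR_gt0 // ?(lt_trans ltr01) //.
  rewrite ln1 lnM ?posrE ?powR_gt0 // ?(lt_trans ltr01) // ln_powR //.
(* The estimate [Bu] is available only from this size on. With $U_0 = T_0$ the weight equals 1 below
   it, and there integrality of the coefficients suffices. *)
pose T0 := maxn N 2; pose U0 : R := T0%:R.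
have T0g : (1 < T0)%N by rewrite leq_max leqnn orbT.
have U01 : 1 <= U0 by rewrite ler1n ltnW.
have U00 : 0 < U0 by exact: lt_le_trans U01.
have w1 (u : zn) : 1 <= weight U0 u by rewrite /weight le_max lexx.
have w0 (u : zn) : 0 <= weight U0 u := le_trans ler01 (w1 u).
have wle (u : zn) (x : R) : 1 <= x -> (size1 u)%:R <= x -> weight U0 u <= x.
  move=> x1 ux; rewrite /weight ge_max x1 /= ler_pdivrMr //; apply: le_trans ux _.
  by rewrite ler_peMr // (le_trans ler01).
have far i j u : (T0 <= size1 u)%N ->
    absK (B i j u) * weight U0 u `^ G0 <= (size1 u)%:R `^ (- (G1 - G0)).
  move=> Hu; have u1 : 1 <= (size1 u)%:R :> R by rewrite ler1n (leq_trans _ Hu) // ltnW.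
  have u0 : 0 < (size1 u)%:R :> R by exact: lt_le_trans u1.
  have wG : weight U0 u `^ G0 <= (size1 u)%:R `^ G0.
    by apply: (ge0_ler_powR (ltW G00)); rewrite ?nnegrE ?w0 ?ler0n //; exact: wle.
  apply: le_trans (ler_wpM2l (abs_ge0 UK _) wG) _.
  have -> : (size1 u)%:R `^ G0 = (size1 u)%:R `^ G1 * (size1 u)%:R `^ (- (G1 - G0)) :> R.
    have EG : G0 = G1 + - (G1 - G0) by ring.
    by rewrite [X in _ `^ X = _]EG powRD // (gt_eqF u0) implybT.
  by rewrite mulrA ler_piMl ?powR_ge0 //; exact: Bu.
exists U0, G0; split=> //.
- have <- // : p%:R `^ g0 = q%:R `^ G0 :> R.
  rewrite /powR !gt_eqF ?ltr0n ?(prime_gt0 pp) ?(ltnW q1) //.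
  by congr expR; rewrite /G0; field; rewrite gt_eqF.
- move=> i j u; have /A0P[B1 _] := HB.1 i j; case: (leqP T0 (size1 u)) => Hu.
    apply: le_trans (far _ _ _ Hu) _; rewrite powRN invf_le1.
      by rewrite -[leLHS](powRr0 (size1 u)%:R) ler_powR // ?ler1n ?(leq_trans _ Hu) ?(ltnW T0g) // subr_ge0 ltW.
    by rewrite powR_gt0 // ltr0n (leq_trans _ Hu) // ltnW.
  have -> : weight U0 u = 1.
    by apply/eqP; rewrite eq_le w1 /weight ge_max lexx /= ler_pdivrMr // mul1r ler_nat ltnW.
  by rewrite powR1 mulr1.
move=> eta eta0; pose h := G1 - G0; have h0 : 0 < h by rewrite subr_gt0.
pose T := maxn T0 (Num.truncn (eta^-1 `^ h^-1)).+1; pose TR : R := T%:R.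
have TR1 : 1 <= TR by rewrite ler1n leq_max ltnW.
have TR0 : 0 < TR by exact: lt_le_trans TR1.
have TG : 0 < TR `^ G0 by exact: powR_gt0.
have [N1 HN1] := HB.2 (eta / TR `^ G0) (divr_gt0 eta0 TG).
exists N1 => i j Nj u; case: (leqP T (size1 u)) => Hu.
  apply: le_trans (far _ _ _ _) _; first by apply: leq_trans Hu; rewrite leq_maxl.
  rewrite powRN -[leRHS]invrK lef_pV2 ?posrE ?invr_gt0 ?powR_gt0 //; last first.
    by apply: lt_le_trans TR0 _; rewrite ler_nat.
  have -> : eta^-1 = (eta^-1 `^ h^-1) `^ h.
    by rewrite -powRrM mulVf ?gt_eqF // powRr1 // invr_ge0 ltW.
  apply: (ge0_ler_powR (ltW h0)); rewrite ?nnegrE ?powR_ge0 ?ler0n //.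
  apply: le_trans (ltW (truncnS_gt _)) _; rewrite ler_nat; apply: leq_trans Hu.
  by rewrite leq_maxr.
rewrite -ler_pdivlMr ?powR_gt0 //; last exact: lt_le_trans (w1 u).
apply: le_trans (HN1 i j Nj u) _; rewrite ler_pM2l // lef_pV2 ?posrE ?powR_gt0 //; last exact: lt_le_trans (w1 u).
apply: (ge0_ler_powR (ltW G00)); rewrite ?nnegrE ?w0 ?(ltW TR0) //.
by apply: wle => //; rewrite ler_nat ltnW.
Qed.
End Truncation.

(** * Meromorphy of the sums over all points *)

Section Tends.
Context {R : realType} {F : fieldType} {abs : F -> R} (U : ultrametric_abs abs).

Definition tends (u : nat -> F) (l : F) : Prop :=
  forall e : R, 0 < e -> exists N0, forall N, (N0 <= N)%N -> abs (u N - l) <= e.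

Lemma tends_ext u v l : (forall N, u N = v N) -> tends u l -> tends v l.
Proof. by move=> E H e /H[N0 HN]; exists N0 => N /HN; rewrite E. Qed.

Lemma tends_cst l : tends (fun=> l) l.
Proof. by move=> e e0; exists 0%N => N _; rewrite subrr (abs0 U) ltW. Qed.

Lemma tendsD u v l k : tends u l -> tends v k -> tends (fun N => u N + v N) (l + k).
Proof.
move=> Hu Hv e e0; have [N1 H1] := Hu e e0; have [N2 H2] := Hv e e0.
exists (maxn N1 N2) => N; rewrite geq_max => /andP[/H1 h1 /H2 h2].
have -> : u N + v N - (l + k) = (u N - l) + (v N - k) by ring.
exact: (absD_le U).
Qed.

Lemma tends_bounded u l : tends u l -> exists2 C : R, 0 < C &
  exists N0, forall N, (N0 <= N)%N -> abs (u N) <= C.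
Proof.
move=> /(_ 1 ltr01)[N0 H]; exists (Num.max 1 (abs l)); first by rewrite lt_max ltr01.
exists N0 => N /H h; apply: (abs_close_le U (y := l)); last by rewrite le_max lexx orbT.
by apply: le_trans h _; rewrite le_max lexx.
Qed.

Lemma tendsM u v l k : tends u l -> tends v k -> tends (fun N => u N * v N) (l * k).
Proof.
move=> Hu Hv e e0; have [C C0 [N0 HC]] := tends_bounded Hu.
pose M := Num.max 1 (abs k); have M0 : 0 < M by rewrite lt_max ltr01.
have [N1 H1] := Hu (e / M) (divr_gt0 e0 M0); have [N2 H2] := Hv (e / C) (divr_gt0 e0 C0).
exists (maxn N0 (maxn N1 N2)) => N; rewrite !geq_max => /and3P[/HC hC /H1 h1 /H2 h2].
have -> : u N * v N - l * k = u N * (v N - k) + (u N - l) * k by ring.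
apply: (absD_le U); rewrite (absM U).
  apply: le_trans (ler_pM (abs_ge0 U _) (abs_ge0 U _) hC h2) _.
  by rewrite mulrC divfK // gt_eqF.
apply: (@le_trans _ _ (e / M * M)); last by rewrite divfK // gt_eqF.
by apply: ler_pM; rewrite ?(abs_ge0 U) // le_max lexx orbT.
Qed.

Lemma tendsN u l : tends u l -> tends (fun N => - u N) (- l).
Proof. by move=> Hu e /Hu[N0 H]; exists N0 => N /H; rewrite -opprD (absN U). Qed.

Lemma tends_sum (I : eqType) (r : seq I) (u : I -> nat -> F) l :
  (forall i, i \in r -> tends (u i) (l i)) ->
  tends (fun N => \sum_(i <- r) u i N) (\sum_(i <- r) l i).
Proof.
elim: r => [|i r IH] H.
  by rewrite big_nil; apply: tends_ext (tends_cst 0) => N; rewrite big_nil.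
rewrite big_cons; apply: tends_ext (tendsD (H i (mem_head _ _)) (IH _)) => [N|j jr].
  by rewrite big_cons.
by apply: H; rewrite inE jr orbT.
Qed.

Lemma tends_prod (I : Type) (r : seq I) (u : I -> nat -> F) l : (forall i, tends (u i) (l i)) ->
  tends (fun N => \prod_(i <- r) u i N) (\prod_(i <- r) l i).
Proof.
move=> H; elim: r => [|i r IH].
  by rewrite big_nil; apply: tends_ext (tends_cst 1) => N; rewrite big_nil.
by rewrite big_cons; apply: tends_ext (tendsM (H i) IH) => N; rewrite big_cons.
Qed.

Lemma tends_uniq u l k : tends u l -> tends u k -> l = k.
Proof.
move=> Hl Hk; apply: (abs_eq_lim U) => e e0.
have [N1 H1] := Hl e e0; have [N2 H2] := Hk e e0.
apply: (abs_trans U (y := u (maxn N1 N2))); last by apply: H2; rewrite leq_maxr.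
by rewrite (absBC U); apply: H1; rewrite leq_maxl.
Qed.

Lemma tends_le (C : R) u l : (forall N, abs (u N) <= C) -> tends u l -> abs l <= C.
Proof.
move=> H Hl; case: (eqVneq l 0) => [->|l0].
  by rewrite (abs0 U); exact: le_trans (abs_ge0 U _) (H 0%N).
have al0 : 0 < abs l by rewrite (abs_gt0 U).
have [N0 HN] := Hl (abs l / 2) (divr_gt0 al0 (ltr0Sn _ 1)).
have <- // : abs (u N0) = abs l; apply: (abs_eq_close U).
by apply: le_lt_trans (HN N0 (leqnn _)) _; rewrite ltr_pdivrMr // mulr_natr mulr2n ltrDl.
Qed.

Lemma tendsX u l k : tends u l -> tends (fun N => u N ^+ k) (l ^+ k).
Proof.
move=> H; elim: k => [|k IH]; first exact: tends_cst.
by rewrite exprS; apply: tends_ext (tendsM H IH) => N; rewrite exprS.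
Qed.

Lemma tends_geometric (r : R) u l : 0 <= r -> r < 1 -> (forall t, abs (u t - l) <= r ^+ t) -> tends u l.
Proof.
move=> r0 r1 H e e0; have [A HA] := vanish_nat r0 r1 H e0.
exists (\max_(i <- A) i).+1 => N AN; apply: HA; apply/negP => NA.
by move: AN; rewrite ltnNge (big_rem N) //= leq_maxl.
Qed.

(** If $|x - 1| \le r$, then in $x^p - 1 = (x - 1)(1 + x + \cdots + x^{p-1})$ the second factor
    differs from $p$ by at most $r$ and so is itself at most $r$. Each $p$-th power gains a factor
    $r$. *)
Lemma tends_expr_p (p : nat) (y : F) : abs p%:R < 1 -> abs (y - 1) < 1 ->
  tends (fun t => y ^+ (p ^ t)) 1.
Proof.
move=> p1 y1; set r := Num.max (abs (y - 1)) (abs p%:R).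
have r0 : 0 <= r by rewrite le_max (abs_ge0 U).
have r1 : r < 1 by rewrite gt_max y1.
have ay : abs y <= 1 by apply: (abs_close_le U (ltW y1)); rewrite (abs1 U).
have pow i (x : F) : abs x <= 1 -> abs (x - 1) <= r -> abs (x ^+ i - 1) <= r.
  move=> x1 xr; elim: i => [|i IH]; first by rewrite subrr (abs0 U).
  have -> : x ^+ i.+1 - 1 = x * (x ^+ i - 1) + (x - 1) by rewrite exprS; ring.
  apply: (absD_le U) => //; rewrite (absM U); apply: le_trans IH.
  by rewrite ler_piMl ?(abs_ge0 U).
apply: (tends_geometric r0 r1) => t; have rt1 i : r ^+ i <= 1 by rewrite exprn_ile1 // ltW.
suff H : abs (y ^+ (p ^ t) - 1) <= r ^+ t.+1.
  by apply: le_trans H _; rewrite exprS ler_piMl ?exprn_ge0 // ltW.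
elim: t => [|t IH]; first by rewrite expn0 !expr1 le_max lexx.
set x := y ^+ (p ^ t) in IH; have x1 : abs x <= 1 by exact: (absX_le1 U).
have xr : abs (x - 1) <= r by apply: le_trans IH _; rewrite exprS ler_piMr.
rewrite expnSr exprM -/x subrX1 (absM U) exprSr; apply: ler_pM; rewrite ?(abs_ge0 U) //.
have -> : \sum_(i < p) x ^+ i = \sum_(i < p) (x ^+ i - 1) + p%:R.
  by rewrite sumrB sumr_const card_ord subrK.
apply: (absD_le U); last by rewrite le_max lexx orbT.
by apply: (abs_sum_le U) => // i _; exact: pow.
Qed.

Lemma power_sums_bound (r : R) (H : nat -> F) j : 0 <= r -> H 0%N = 1 -> (forall m, abs (H m) <= r ^+ m) ->
  abs (power_sums H j.+1) <= r ^+ j.+1.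
Proof.
move=> r0 H1 Hle; elim/ltn_ind: j => j IH; rewrite power_sums_rec //; apply: (absB_le U).
  by rewrite (absN U); apply: le_trans (abs_mulrn U _ _) (Hle _).
apply: (abs_sum_le U) => [|i _]; first exact: exprn_ge0.
have -> : r ^+ j.+1 = r ^+ i.+1 * r ^+ (j - i) by rewrite -exprD addSn subnKC // ltnW.
by rewrite (absM U); apply: ler_pM; rewrite ?(abs_ge0 U) // IH.
Qed.

Lemma common_torsion (s : seq F) : (forall a, a \in s -> abs a <= 1) ->
  (forall a, a \in s -> exists2 E, (0 < E)%N & abs (a ^+ E - 1) < 1) ->
  exists2 E, (0 < E)%N & forall a, a \in s -> abs (a ^+ E - 1) < 1.
Proof.
elim: s => [|a s IH] s1 H; first by exists 1%N.
have mul (x : F) i j : abs x <= 1 -> abs (x ^+ i - 1) < 1 -> abs (x ^+ (i * j) - 1) < 1.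
  move=> x1 xi; rewrite exprM subrX1 (absM U); apply: le_lt_trans xi.
  rewrite ler_piMr ?(abs_ge0 U) //; apply: (abs_sum_le U) => // l _.
  by rewrite !(absX_le1 U).
have [|b bs|E E0 HE] := IH; first by move=> b bs; apply: s1; rewrite inE bs orbT.
  by apply: H; rewrite inE bs orbT.
have [E' E0' Ha] := H a (mem_head _ _).
exists (E * E')%N; first by rewrite muln_gt0 E0.
move=> b; rewrite inE => /predU1P[->|bs]; first by rewrite mulnC mul // s1 ?mem_head.
by apply: mul; [apply: s1; rewrite inE bs orbT|exact: HE].
Qed.

Hypothesis F0 : forall m, m.+1%:R != 0 :> F.

Lemma tends_divn u l k : tends (fun N => u N *+ k.+1) (l *+ k.+1) -> tends u l.
Proof.
have ak : 0 < abs (k.+1%:R) by rewrite (abs_gt0 U) F0.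
move=> H e e0; have [N0 HN] := H (e * abs k.+1%:R) (mulr_gt0 e0 ak).
by exists N0 => N /HN H'; rewrite -(ler_pM2r ak) -(absM U) mulrBl !mulr_natr.
Qed.

(** Coefficientwise continuity of the formal exponential. For one fixed coefficient the division by
    an integer is harmless, but it is not uniform, so growth bounds have to be obtained
    separately. *)
Lemma tends_log_deriv (S f : nat -> nat -> F) S' f' :
  (forall N, ps_log_deriv (S N) (f N)) -> ps_log_deriv S' f' ->
  (forall i, tends (fun N => S N i.+1) (S' i.+1)) -> forall m, tends (fun N => f N m) (f' m).
Proof.
move=> HS HS' HT; elim/ltn_ind => [[_|m IH]].
  by rewrite HS'.1; have -> : (fun N => f N 0%N) = fun=> 1;
     [apply/funext => N; exact: (HS N).1|exact: tends_cst].
apply: (@tends_divn _ _ m); rewrite HS'.2.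
have -> : (fun N => f N m.+1 *+ m.+1) = (fun N => \sum_(i < m.+1) S N i.+1 * f N (m - i)%N).
  by apply/funext => N; rewrite (HS N).2.
by apply: tends_sum => i _; apply: tendsM => //; apply: IH; rewrite ltnS leq_subr.
Qed.

Lemma tends_power_sums (G : nat -> nat -> F) G' : (forall N, G N 0%N = 1) -> G' 0%N = 1 ->
  (forall i, tends (fun N => G N i) (G' i)) ->
  forall j, tends (fun N => power_sums (G N) j.+1) (power_sums G' j.+1).
Proof.
move=> G1 G1' H; elim/ltn_ind => j IH; rewrite power_sums_rec //.
have -> : (fun N => power_sums (G N) j.+1) = (fun N =>
   - (G N j.+1 * j.+1%:R) - \sum_(i < j) power_sums (G N) i.+1 * G N (j - i)%N).
  by apply/funext => N; rewrite power_sums_rec // mulr_natr.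
rewrite -[G' _ *+ _]mulr_natr; apply: tendsD; first by apply: tendsN; apply: tendsM => //; exact: tends_cst.
by apply: tendsN; apply: tends_sum => i _; apply: tendsM => //; exact: IH.
Qed.
End Tends.

(** * Logarithmic derivatives of meromorphic functions over $K$ *)

Section Meromorphy.
Context {R : realType} {p q : nat} (D : padic_setting R p q).
Hypothesis pp : prime p.
Local Notation K := (K D).
Local Notation Om := (Om D).
Local Notation iotaK := (iotaK D).
Local Notation absK := (@absK _ _ _ D).
Local Notation absOm := (@absOm _ _ _ D).
Let UK : ultrametric_abs absK := absK_ultra D.
Let UO : ultrametric_abs absOm := absOm_ultra D.
Let CK : abs_complete absK := @K_complete _ _ _ D pp.
Local Notation tendsK := (tends (abs := absK)).
Local Notation tendsO := (tends (abs := absOm)).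

Lemma tends_iota u l : tendsO (iotaK \o u) (iotaK l) -> tendsK u l.
Proof.
move=> H e /H[N0 HN]; exists N0 => N /HN /=; by rewrite -rmorphB absOm_iota.
Qed.

(** Completeness of $K$ makes its image closed. In this way limits computed in the ambient field are
    shown to lie in $K$. *)
Lemma iota_closed (u : nat -> K) L : tendsO (iotaK \o u) L -> exists2 l, L = iotaK l & tendsK u l.
Proof.
move=> H; have [e e0|l Hl] := CK (s := u).
  have e2 : 0 < e / 2 by exact: divr_gt0.
  have [N0 HN] := H _ e2; exists N0 => // N /= N0N i j Ni Nj.
  rewrite -absOm_iota rmorphB; apply: (@le_lt_trans _ _ (e / 2)).
    apply: (abs_trans UO (y := L)); first by apply: HN; exact: leq_trans Ni.
    by rewrite (absBC UO); apply: HN; exact: leq_trans Nj.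
  by rewrite ltr_pdivrMr // mulr_natr mulr2n ltrDl.
have Hu : tendsK u l.
  move/cvg0P: Hl => Hl e e0; have [|N0 HN] := Hl _ e e0; first by move=> i; exact: (abs_ge0 UK).
  by exists N0 => N /HN /ltW.
exists l => //; apply: (tends_uniq UO H) => e /Hu[N0 HN]; exists N0 => N /HN.
by rewrite /= -rmorphB absOm_iota.
Qed.

Variable rho : R.

(** Boundedness at every radius, rather than convergence to 0, passes to limits in the truncation
    with the same constant; convergence is recovered at the end by comparison with a larger
    radius. *)
Definition bounded_ld (s : nat -> K) : Prop := exists2 f : nat -> K, ps_log_deriv s f &
  forall r : R, 1 <= r -> r < rho -> exists A : R, forall m, absK (f m) * r ^+ m <= A.

(* [S] is the logarithmic derivative of a quotient of two power series over K
   that are bounded on every disc |T| < r with r < rho. *)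
Definition mero (S : nat -> Om) : Prop := exists s t,
  [/\ bounded_ld s, bounded_ld t & forall m, (0 < m)%N -> S m = iotaK (s m - t m)].

Lemma bounded_ld0 : bounded_ld (fun=> 0).
Proof.
exists (@ps_one K); first exact: ps_log_deriv1.
move=> r r1 _; exists 1 => -[|m]; first by rewrite /ps_one eqxx (abs1 UK) mul1r.
by rewrite /ps_one /= (abs0 UK) mul0r.
Qed.

Lemma bounded_ldD s t : bounded_ld s -> bounded_ld t -> bounded_ld (fun m => s m + t m).
Proof.
move=> [f Hf bf] [g Hg bg]; exists (ps_mul f g); first exact: ps_log_deriv_mul.
move=> r r1 rr; have [A HA] := bf r r1 rr; have [A' HA'] := bg r r1 rr.
have r0 : 0 < r by exact: lt_le_trans r1.
have A0 : 0 <= A by apply: le_trans (HA 0%N); rewrite mulr_ge0 ?(abs_ge0 UK) // exprn_ge0 // ltW.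
have A0' : 0 <= A' by apply: le_trans (HA' 0%N); rewrite mulr_ge0 ?(abs_ge0 UK) // exprn_ge0 // ltW.
exists (A * A') => m; rewrite -ler_pdivlMr ?exprn_gt0 //.
apply: (abs_sum_le UK) => [|i _]; first by rewrite divr_ge0 ?mulr_ge0 ?exprn_ge0 ?(ltW r0).
have rE : r ^+ m = r ^+ i * r ^+ (m - i) by rewrite -exprD subnKC // -ltnS.
rewrite ler_pdivlMr ?exprn_gt0 // rE (absM UK) mulrACA.
by apply: ler_pM; rewrite ?mulr_ge0 ?(abs_ge0 UK) // exprn_ge0 // ltW.
Qed.

Lemma bounded_ld_scale a s : absK a <= 1 -> bounded_ld s -> bounded_ld (fun m => a ^+ m * s m).
Proof.
move=> a1 [f Hf bf]; exists (fun m => a ^+ m * f m); first exact: ps_log_deriv_scale.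
move=> r r1 rr; have [A HA] := bf r r1 rr; exists A => m; apply: le_trans (HA m).
rewrite (absM UK) -mulrA ler_piMl ?(absX_le1 UK) // mulr_ge0 ?(abs_ge0 UK) // exprn_ge0 //.
exact: le_trans r1.
Qed.

Lemma mero_eq S S' : (forall m, (0 < m)%N -> S m = S' m) -> mero S -> mero S'.
Proof. by move=> E [s [t [Hs Ht H]]]; exists s, t; split=> // m m0; rewrite -E // H. Qed.

Lemma mero0 : mero (fun=> 0).
Proof. by exists (fun=> 0), (fun=> 0); split=> [||m _]; rewrite ?subrr ?rmorph0 //; exact: bounded_ld0. Qed.

Lemma meroD S S' : mero S -> mero S' -> mero (fun m => S m + S' m).
Proof.
move=> [s [t [Hs Ht H]]] [s' [t' [Hs' Ht' H']]].
exists (fun m => s m + s' m), (fun m => t m + t' m); split; try exact: bounded_ldD.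
by move=> m m0; rewrite H // H' // -rmorphD; congr (iotaK _); ring.
Qed.

Lemma meroN S : mero S -> mero (fun m => - S m).
Proof.
move=> [s [t [Hs Ht H]]]; exists t, s; split=> // m m0.
by rewrite H // -rmorphN opprB.
Qed.

Lemma mero_scale a S : absK a <= 1 -> mero S -> mero (fun m => iotaK a ^+ m * S m).
Proof.
move=> a1 [s [t [Hs Ht H]]]; exists (fun m => a ^+ m * s m), (fun m => a ^+ m * t m).
split; try exact: bounded_ld_scale.
by move=> m m0; rewrite H // -rmorphXn -rmorphM mulrBr.
Qed.

Lemma meroMn S k : mero S -> mero (fun m => S m *+ k).
Proof.
move=> HS; elim: k => [|k IH]; first exact: mero0.
by apply: mero_eq (meroD HS IH) => m _; rewrite mulrS.
Qed.

Lemma mero_sign S k : mero S -> mero (fun m => (-1) ^+ k * S m).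
Proof.
move=> HS; elim: k => [|k IH]; first by apply: mero_eq HS => m _; rewrite expr0 mul1r.
by apply: mero_eq (meroN IH) => m _; rewrite exprS -mulrA mulN1r.
Qed.

Lemma mero_sum (I : Type) (r : seq I) (S : I -> nat -> Om) : (forall i, mero (S i)) ->
  mero (fun m => \sum_(i <- r) S i m).
Proof.
move=> H; elim: r => [|i r IH]; first by apply: mero_eq mero0 => m _; rewrite big_nil.
by apply: mero_eq (meroD (H i) IH) => m _; rewrite big_cons.
Qed.
End Meromorphy.

(** * Power sums over all points of the torus *)

Section FullPowerSums.
Context {R : realType} {p q : nat} (D : padic_setting R p q) (n : nat).
Hypothesis pp : prime p.
Hypothesis qP : exists2 a : nat, (0 < a)%N & q = (p ^ a)%N.
Local Notation K := (K D).
Local Notation Om := (Om D).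
Local Notation iotaK := (iotaK D).
Local Notation absK := (@absK _ _ _ D).
Local Notation absOm := (@absOm _ _ _ D).
Let UK : ultrametric_abs absK := absK_ultra D.
Let UO : ultrametric_abs absOm := absOm_ultra D.

Lemma q_gt1 : (1 < q)%N.
Proof.
have [a a0 ->] := qP; rewrite -(expn0 p) ltn_exp2l // prime_gt1 //.
Qed.

Lemma abs_root_unity (y : Om) k : (0 < k)%N -> y ^+ k = 1 -> absOm y = 1.
Proof.
move=> k0 /(congr1 absOm); rewrite (absX UO) (abs1 UO) => /eqP.
by rewrite pexpr_eq1 ?(abs_ge0 UO) // => /eqP.
Qed.

Lemma unit_root_pt m (z : Om) (e : {ffun 'I_n -> 'I_(q ^ m - 1)}) : (0 < m)%N ->
  (q ^ m - 1).-primitive_root z -> unit_pt (root_pt z e).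
Proof.
move=> m0 zP i; rewrite mxE (absX UO) (abs_root_unity _ (prim_expr_order zP)) ?expr1n //.
exact: prim_order_gt0 zP.
Qed.

Variables (J : set nat) (B : J -> J -> laurent D n) (rho : R).
Hypothesis HB : nuclear_mx B.

Lemma fredholm_prod0 x d : unit_pt x -> (0 < d)%N -> tame B 1 ->
  fredholm_det (frob_product B x d) 0 = 1.
Proof.
move=> ux d0 tB; apply: (abs_eq_lim UO) => e e0.
have [N0 /(_ N0 (leqnn _) x d 0%N ux d0)] := trunc_prod_cvg HB tB e0.
by rewrite char_ser0.
Qed.

Lemma tends_char_ser x d l : tame B 1 -> unit_pt x -> (0 < d)%N ->
  tends (abs := absOm) (fun N => (char_ser (trunc_prod B N x d))`_l) (fredholm_det (frob_product B x d) l).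
Proof.
move=> tB ux d0 e e0; have [N0 HN] := trunc_prod_cvg HB tB e0.
by exists N0 => N /HN H; rewrite (absBC UO); exact: H.
Qed.

Hypothesis rho1 : 1 < rho.
Hypothesis tB : forall r, 1 <= r -> r < rho -> tame B r.
Variable z : nat -> Om.
Hypothesis zP : forall m, (0 < m)%N -> (q ^ m - 1).-primitive_root (z m).

Let tB1 : tame B 1. Proof. exact: tB. Qed.

Local Notation G m e := (fredholm_det (frob_product B (root_pt (z m) e) m)).

(** The signs turn coefficients into traces of exterior powers, as in [char_monomial]. *)
Let S lam m : Om := \sum_(e : {ffun 'I_n -> 'I_(q ^ m - 1)})
  \prod_(l <- lam) ((-1) ^+ l * G m e l).

Let c m : K := (q ^ m - 1)%N%:R ^+ n.

Let c_neq0 m : (0 < m)%N -> c m != 0.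
Proof.
move=> m0; rewrite expf_neq0 //.
have : (0 < q ^ m - 1)%N by exact: prim_order_gt0 (zP m0).
by case: (q ^ m - 1)%N => // k _; exact: K_char0.
Qed.

(** Division by $c_m = (q^m - 1)^n$ gives the limit $\tau_m$ of the traces of the truncated Dwork
    matrices. Their characteristic series converge coefficientwise to a series that inherits the
    common bound, and $-\tau$ is its logarithmic derivative. *)
Lemma mero_monomial_sum lam : mero (D := D) rho (S lam).
Proof.
have bd r : 1 <= r -> r < rho -> exists A : R, forall N, exists tau Dp : nat -> K,
  [/\ forall m, (0 < m)%N -> \sum_(e : {ffun 'I_n -> 'I_(q ^ m - 1)})
        char_monomial lam (trunc_prod B N (root_pt (z m) e) m) = iotaK (tau m * c m),
      ps_log_deriv (fun m => - tau m) Dp & forall m, absK (Dp m) * r ^+ m <= A].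
  move=> r1 rr; have [A HA] := trunc_prod_bound q_gt1 lam r1 (tB r1 rr).
  exists A => N; have [tau [Dp [H1 H2 H3]]] := HA N; exists tau, Dp; split=> // m m0.
  exact: H1 (zP m0).
have cvS m : (0 < m)%N -> tends (abs := absOm) (fun N => \sum_(e : {ffun 'I_n -> 'I_(q ^ m - 1)})
    char_monomial lam (trunc_prod B N (root_pt (z m) e) m)) (S lam m).
  move=> m0; apply: (tends_sum UO) => e _; rewrite (big_nth 0%N) big_mkord.
  apply: (tends_prod UO) => a; apply: (tendsM UO); first exact: tends_cst.
  by apply: tends_char_ser tB1 _ _ => //; apply: unit_root_pt; rewrite ?zP.
have [tau Htau] : exists tau, forall m, (0 < m)%N -> S lam m = iotaK (tau m * c m).
  have [A /choice[t Ht]] := bd 1 (lexx _) rho1.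
  suff /choice[tau H] : forall m, exists x, (0 < m)%N -> S lam m = iotaK (x * c m) by exists tau.
  move=> [|m]; first by exists 0.
  have [|l Hl _] := @iota_closed _ _ _ D pp (fun N => t N m.+1 * c m.+1) (S lam m.+1).
    have := cvS m.+1 isT; congr (tends _ _); apply/funext => N /=.
    by have [Dp [H _ _]] := Ht N; exact: H.
  by exists (l / c m.+1) => _; rewrite divfK // c_neq0.
have Ft : bounded_ld (D := D) rho (fun m => - tau m).
  have [f Hf] := ps_log_deriv_exists (@K_char0 _ _ _ D pp) (fun m => - tau m).
  exists f => // r r1 rr; have [A HA] := bd r r1 rr; exists A => m.
  have [t Ht] := choice HA; have [Dp HD] := choice Ht.
  have r0 : 0 < r by exact: lt_le_trans r1.
  rewrite -ler_pdivlMr ?exprn_gt0 //; apply: (tends_le UK (u := fun N => Dp N m)).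
    by move=> N; rewrite ler_pdivlMr ?exprn_gt0 //; have [_ _] := HD N.
  apply: (tends_log_deriv UK (@K_char0 _ _ _ D pp) (S := fun N m => - t N m) _ Hf).
    by move=> N; have [_ H _] := HD N.
  move=> i; apply: (tendsN UK).
  have -> : tau i.+1 = tau i.+1 * c i.+1 * (c i.+1)^-1 by rewrite mulfK // c_neq0.
  have -> : (fun N => t N i.+1) = (fun N => t N i.+1 * c i.+1 * (c i.+1)^-1).
    by apply/funext => N; rewrite mulfK // c_neq0.
  apply: (tendsM UK); last exact: (tends_cst UK).
  apply: tends_iota; rewrite -Htau //.
  have := cvS i.+1 isT; congr (tends _ _); apply/funext => N /=.
  by have [H _ _] := HD N; exact: H.
have Mt : mero (D := D) rho (iotaK \o tau).
  exists (fun=> 0), (fun m => - tau m); split=> //; first exact: bounded_ld0.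
  by move=> m _; rewrite opprK add0r.
(* Multiplication of $\tau_m$ by $q^m - 1$ corresponds to passing from $F(T)$ to $F(qT)/F(T)$, which
   preserves meromorphy on the disc because $|q| \le 1$. *)
suff : forall k, mero (D := D) rho (fun m => iotaK (tau m * (q ^ m - 1)%N%:R ^+ k)).
  move=> /(_ n); apply: mero_eq => m m0; by rewrite Htau.
elim=> [|k IH]; first by apply: mero_eq Mt => m _; rewrite expr0 mulr1.
have qK : absK q%:R <= 1 by exact: abs_natr.
apply: mero_eq (meroD (mero_scale qK IH) (meroN IH)) => m m0.
rewrite -rmorphXn -rmorphM -rmorphN -rmorphD; congr (iotaK _).
rewrite exprS natrB ?expn_gt0 ?(ltnW q_gt1) // natrX; ring.
Qed.

(** Newton's identities express a power sum through lower ones multiplied by coefficients of $G$.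
    The induction therefore carries an arbitrary monomial in the coefficients, to which such a
    factor can be added. *)
Lemma mero_power_sums lam j : mero (D := D) rho (fun m => \sum_(e : {ffun 'I_n -> 'I_(q ^ m - 1)})
  (\prod_(l <- lam) ((-1) ^+ l * G m e l)) * power_sums (G m e) j.+1).
Proof.
elim/ltn_ind: j lam => j IH lam.
pose T1 m := (-1) ^+ j.+1 * S (j.+1 :: lam) m *+ j.+1.
pose T2 (i : 'I_j) m := (-1) ^+ (j - i) * \sum_(e : {ffun 'I_n -> 'I_(q ^ m - 1)})
  (\prod_(l <- (j - i)%N :: lam) ((-1) ^+ l * G m e l)) * power_sums (G m e) i.+1.
have M1 : mero (D := D) rho T1 by apply/meroMn/mero_sign/mero_monomial_sum.
have M2 : mero (D := D) rho (fun m => \sum_i T2 i m).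
  by apply: mero_sum => i; apply: mero_sign; exact: IH.
apply: mero_eq (meroD (meroN M1) (meroN M2)) => m m0.
have -> : \sum_i T2 i m = \sum_(e : {ffun 'I_n -> 'I_(q ^ m - 1)}) \sum_(i < j) (-1) ^+ (j - i) *
    ((\prod_(l <- (j - i)%N :: lam) ((-1) ^+ l * G m e l)) * power_sums (G m e) i.+1).
  by rewrite exchange_big; apply: eq_bigr => i _; rewrite /T2 mulr_sumr.
rewrite /T1 /S -mulr_natr mulr_sumr mulr_suml -!sumrN -big_split; apply: eq_bigr => e _ /=.
have sgn k : (-1) ^+ k * (-1) ^+ k = 1 :> Om by rewrite -exprD addnn -mul2n exprM sqrrN expr1n expr1n.
rewrite power_sums_rec; last by apply: fredholm_prod0 => //; apply: unit_root_pt (zP m0).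
have sg k (x y : Om) : (-1) ^+ k * ((-1) ^+ k * x * y) = x * y by rewrite !mulrA sgn mul1r.
rewrite mulrBr big_cons mulr_sumr sg -[in RHS]mulr_natr; congr (_ - _); first by ring.
by apply: eq_bigr => i _; rewrite big_cons -mulrA sg; ring.
Qed.

Lemma mero_full k : (0 < k)%N -> mero (D := D) rho (fun m => \sum_(e : {ffun 'I_n -> 'I_(q ^ m - 1)})
  power_sums (G m e) k).
Proof.
case: k => // k _; apply: mero_eq (mero_power_sums [::] k) => m _.
by apply: eq_bigr => e _; rewrite big_nil mul1r.
Qed.
End FullPowerSums.

(** * Unit zeros *)

Section LinearFactors.
Variable A : comNzRingType.

Definition ps_lin (a : A) : nat -> A := fun m => if m is m'.+1 then (if m' is 0%N then - a else 0) else 1.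

Lemma ps_mul_lin a (f : nat -> A) m :
  ps_mul (ps_lin a) f m = f m - a * (if m is m'.+1 then f m' else 0).
Proof.
case: m => [|m]; first by rewrite /ps_mul big_ord1 /= mul1r mulr0 subr0.
rewrite /ps_mul big_ord_recl /= mul1r subn0 big_ord_recl /= mulNr subSS subn0 big1 ?addr0 // => i _.
by rewrite /= mul0r.
Qed.

Lemma ps_log_deriv_lin a : ps_log_deriv (fun j => - a ^+ j) (ps_lin a).
Proof.
split=> // -[|m]; first by rewrite big_ord1 /= expr1 mulr1n mulr1.
rewrite /= mul0rn big_ord_recr /= subnn /= mulr1 big_ord_recr /= subSn // subnn /=.
rewrite big1 ?add0r => [|i _]; first by rewrite mulrNN -exprSr subrr.
have -> : (m.+1 - i = (m - i).-1.+2)%N by have := ltn_ord i; lia.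
by rewrite mulr0.
Qed.

Lemma power_sums_lin (s : seq A) j :
  power_sums (\big[@ps_mul A/@ps_one A]_(a <- s) ps_lin a) j.+1 = \sum_(a <- s) a ^+ j.+1.
Proof.
apply/esym; apply: (power_sums_uniq (S := fun j => \sum_(a <- s) a ^+ j)).
apply: ps_log_deriv_eq (ps_log_deriv_big s (fun a => ps_log_deriv_lin a)) => i.
by rewrite sumrN.
Qed.

Lemma ps_lin_prod0 (s : seq A) : (\big[@ps_mul A/@ps_one A]_(a <- s) ps_lin a) 0%N = 1.
Proof.
elim: s => [|a s IH]; first by rewrite big_nil.
by rewrite big_cons ps_mul_lin mulr0 subr0.
Qed.
End LinearFactors.

Section NatSums.
Context {R : realType} {F : fieldType} {abs : F -> R} (U : ultrametric_abs abs).
Hypothesis C : abs_complete abs.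

Lemma vanish_shift (f : nat -> F) k : vanish (abs := abs) (fun m => f (m + k)%N) -> vanish (abs := abs) f.
Proof.
move=> H e /H[S HS]; exists ([fset x in iota 0 k] `|` [fset (x + k)%N | x in S])%fset => i.
rewrite in_fsetU negb_or !inE mem_iota /= add0n -leqNgt => /andP[ki iS].
rewrite -(subnK ki); apply: HS; apply: contra iS => iS; apply/imfsetP; exists (i - k)%N => //.
by rewrite subnK.
Qed.

Lemma tsum_nat_recl (f : nat -> F) : vanish (abs := abs) f ->
  tsum abs f = f 0%N + tsum abs (fun m => f m.+1).
Proof.
move=> vf; pose f0 m := if m is 0%N then f 0%N else 0; pose f1 m := if m is 0%N then 0 else f m.
have vf0 : vanish (abs := abs) f0.
  by apply: vanish_le vf _ => -[|m] //=; rewrite (abs0 U) (abs_ge0 U).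
have vf1 : vanish (abs := abs) f1.
  by apply: vanish_le vf _ => -[|m] //=; rewrite (abs0 U) (abs_ge0 U).
have -> : tsum abs f = tsum abs (fun m => f0 m + f1 m).
  by apply: eq_tsum => -[|m] /=; rewrite ?addr0 ?add0r.
rewrite (tsumD U C vf0 vf1); congr (_ + _).
  rewrite (tsum_finite U C (A := [fset 0%N]%fset)) ?big_seq_fset1 // => -[|m] //.
  by rewrite inE.
rewrite (tsum_reindex U (h := S) C succn_inj) // => -[|m] // H.
by have := H m.
Qed.
End NatSums.

Section UnitZeros.
Context {R : realType} {p q : nat} (D : padic_setting R p q).
Local Notation Om := (Om D).
Local Notation abs := (@absOm _ _ _ D).
Let U : ultrametric_abs abs := absOm_ultra D.
Let CO : abs_complete abs := @Om_complete _ _ _ D.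
Local Notation linprod s := (\big[@ps_mul Om/@ps_one Om]_(a <- s) ps_lin a).

Lemma hasse_vanish (G : nat -> Om) (j : nat -> nat) (b : nat -> nat) z : abs z = 1 -> vanish (abs := abs) G ->
  vanish (abs := abs) (fun m => (G m * z ^+ (j m)) *+ b m).
Proof.
move=> z1 vG; apply: vanish_le vG _ => m; apply: le_trans (abs_mulrn U _ _) _.
by rewrite (absM U) (absX U) z1 expr1n mulr1.
Qed.

(** The Leibniz rule for divided derivatives; the shifted series is handled by Pascal's rule. *)
Lemma hasse_deriv_lin (G : nat -> Om) a j z : abs z = 1 -> vanish (abs := abs) G ->
  hasse_deriv (ps_mul (ps_lin a) G) j z =
  (1 - a * z) * hasse_deriv G j z - a * (if j is j'.+1 then hasse_deriv G j' z else 0).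
Proof.
move=> z1 vG; pose s m := if m is m'.+1 then (G m' * z ^+ (m'.+1 - j)) *+ 'C(m'.+1, j) else 0.
have v1 := hasse_vanish (fun m => (m - j)%N) (fun m => 'C(m, j)) z1 vG.
have v2 := hasse_vanish (fun m => (m.+1 - j)%N) (fun m => 'C(m.+1, j)) z1 vG.
have vs : vanish (abs := abs) s.
  apply: (@vanish_shift _ _ _ s 1); apply: vanish_le v2 _ => m; by rewrite addn1.
rewrite {1}/hasse_deriv; have -> : tsum abs (fun m => (ps_mul (ps_lin a) G m * z ^+ (m - j)) *+ 'C(m, j)) =
    tsum abs (fun m => (G m * z ^+ (m - j)) *+ 'C(m, j) + (- a) * s m).
  apply: eq_tsum => m; rewrite ps_mul_lin; case: m => [|m] /=; first by rewrite !mulr0 subr0 addr0.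
  by rewrite mulrBl mulrnBl mulNr mulrnAr mulrA.
rewrite (tsumD U CO v1 (vanishZ U (- a) vs)) (tsumZ U CO _ vs) (tsum_nat_recl U CO vs) add0r.
pose Y : Om := if j is j'.+1 then hasse_deriv G j' z else 0.
suff -> : tsum abs (fun m => s m.+1) = z * hasse_deriv G j z + Y.
  rewrite -/(hasse_deriv G j z) -[X in _ = _ - a * X]/Y.
  by move: (hasse_deriv G j z) Y => X Y; ring.
rewrite /Y /s; case: j {v1 vs Y} @s v2 => [|j] s v2.
  rewrite addr0 /hasse_deriv -(tsumZ U CO); last exact: (@hasse_vanish _ (fun m => (m - 0)%N) (fun m => 'C(m, 0)) _ z1 vG).
  by apply: eq_tsum => m; rewrite !bin0 !mulr1n !subn0 exprS mulrCA.
have v3 := hasse_vanish (fun m => (m - j.+1)%N) (fun m => 'C(m, j.+1)) z1 vG.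
have v4 := hasse_vanish (fun m => (m - j)%N) (fun m => 'C(m, j)) z1 vG.
rewrite /hasse_deriv -(tsumZ U CO _ v3) -(tsumD U CO (vanishZ U _ v3) v4); apply: eq_tsum => m.
rewrite subSS binS mulrnDr; congr (_ + _).
case: (ltnP j m) => jm; last by rewrite bin_small ?ltnS // !mulr0n mulr0.
by rewrite mulrnAr mulrCA -exprS -subSn // subSS.
Qed.

Lemma vanish_geometric (rho : R) h (G : nat -> Om) : 0 <= rho -> rho < 1 ->
  (forall m, abs (G m) <= rho ^+ (m - h)) -> vanish (abs := abs) G.
Proof.
move=> r0 r1 H; apply: (vanish_shift (k := h)); apply: (vanish_nat r0 r1) => m.
by have := H (m + h)%N; rewrite addnK.
Qed.

(** If $G = (1 - aT) G'$, then $G'_m = \sum_{i \le m} G_i a^{m-i}$, and since $G(a^{-1}) = 0$ this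
    is, up to a unit, the tail of a convergent series. So the coefficient bound improves by one
    index for each zero removed, and after [size s] removals no shift is left. *)
Lemma unit_zero_factor (rho : R) (s : seq Om) (G : nat -> Om) : 0 <= rho -> rho < 1 ->
  (forall a, a \in s -> abs a = 1) ->
  (forall a j, a \in s -> (j < count_mem a s)%N -> hasse_deriv G j a^-1 = 0) ->
  (forall m, abs (G m) <= rho ^+ (m - size s)) ->
  exists H, (forall m, abs (H m) <= rho ^+ m) /\ G = ps_mul (linprod s) H.
Proof.
move=> r0 r1; elim: s G => [|a s IH] G s1 Gz Gle.
  by exists G; split=> [m|]; [have := Gle m; rewrite subn0|rewrite big_nil ps_mul1].
have a1 : abs a = 1 by apply: s1; rewrite inE eqxx.
have a0 : a != 0 by rewrite -(abs_gt0 U) a1.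
pose G' m := \sum_(i < m.+1) G i * a ^+ (m - i).
have GE : G = ps_mul (ps_lin a) G'.
  apply/funext => m; rewrite ps_mul_lin; case: m => [|m].
    by rewrite mulr0 subr0 /G' big_ord1 mulr1.
  rewrite /G' big_ord_recr /= subnn mulr1 mulr_sumr addrAC -sumrB big1 ?add0r // => i _.
  by rewrite subSn -1?ltnS // exprS mulrCA subrr.
have vG : vanish (abs := abs) G := vanish_geometric r0 r1 Gle.
have ai1 : abs a^-1 = 1 by rewrite (absV U) a1 invr1.
have v0 : vanish (abs := abs) (fun m => G m * a^-1 ^+ m).
  by apply: vanish_le vG _ => m; rewrite (absM U) (absX U) ai1 expr1n mulr1.
have G0 : tsum abs (fun m => G m * a^-1 ^+ m) = 0.
  have := Gz a 0%N; rewrite inE eqxx /= eqxx => /(_ isT isT) <-.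
  by apply: eq_tsum => m; rewrite subn0 bin0 mulr1n.
have G'le m : abs (G' m) <= rho ^+ (m - size s).
  have -> : G' m = a ^+ m * \sum_(i < m.+1) G i * a^-1 ^+ i.
    rewrite mulr_sumr; apply: eq_bigr => i _; rewrite mulrCA; congr (_ * _).
    have -> : a ^+ m = a ^+ (m - i) * a ^+ i by rewrite -exprD subnK // -ltnS.
    by rewrite -mulrA -exprMn mulfV // expr1n mulr1.
  rewrite (absM U) (absX U) a1 expr1n mul1r.
  have := @tsum_nat_trunc _ _ _ U CO (rho ^+ (m - size s)) m.+1 _ (exprn_ge0 _ r0) v0.
  rewrite G0 sub0r (absN U); apply=> k mk; rewrite (absM U) (absX U) ai1 expr1n mulr1.
  apply: le_trans (Gle k) _; apply: ler_wiXn2l => //; first exact: ltW.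
  by rewrite /=; lia.
have vG' : vanish (abs := abs) G' := vanish_geometric r0 r1 G'le.
have [b bs|b j bs jb||H [Hle GH]] := IH G'; first by apply: s1; rewrite inE bs orbT.
- have b1 : abs b = 1 by apply: s1; rewrite inE bs orbT.
  have bi1 : abs b^-1 = 1 by rewrite (absV U) b1 invr1.
  have bn0 : b != 0 by rewrite -(abs_gt0 U) b1.
  (* The Leibniz rule transfers the vanishing of divided derivatives from [G] to [G']: at $b = a$
     the order drops by one, and at $b \ne a$ the factor $1 - a/b$ is invertible. *)
  have rel i : (i < count_mem b (a :: s))%N -> (1 - a * b^-1) * hasse_deriv G' i b^-1 -
      a * (if i is i'.+1 then hasse_deriv G' i' b^-1 else 0) = 0.
    by move=> ib; rewrite -hasse_deriv_lin // -GE Gz // inE bs orbT.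
  case: (eqVneq a b) => [ab|ab].
    have := rel j.+1; rewrite /= ab eqxx add1n ltnS => /(_ jb)/eqP.
    by rewrite mulfV // subrr mul0r sub0r oppr_eq0 mulf_eq0 (negPf bn0) => /eqP.
  elim: j jb => [|j IHj] jb; have /eqP := rel _ (leq_trans jb (leq_addl _ _)).
    rewrite mulr0 subr0 mulf_eq0 => /orP[|/eqP //]; rewrite subr_eq0 => /eqP ab1.
    by move: ab; rewrite -(divfK bn0 a) -ab1 mul1r eqxx.
  rewrite IHj ?(ltnW jb) // mulr0 subr0 mulf_eq0 => /orP[|/eqP //]; rewrite subr_eq0 => /eqP ab1.
  by move: ab; rewrite -(divfK bn0 a) -ab1 mul1r eqxx.
- exact: G'le.
by exists H; split=> //; rewrite big_cons -ps_mulA -GH.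
Qed.

Lemma zero_order_uniq (G : nat -> Om) z mu mu' : is_zero_order G z mu -> is_zero_order G z mu' -> mu = mu'.
Proof.
move=> [H1 H2] [H1' H2']; case: (ltngtP mu mu') => // h; first by case: H2; exact: H1'.
by case: H2'; exact: H1.
Qed.

(** Multiplicities are unique and determine the list up to permutation, so the choice made by
    [unit_recip_zeros] does not affect the size. *)
Lemma unit_recip_zerosP (G : nat -> Om) s : is_unit_recip_zeros G s ->
  is_unit_recip_zeros G (unit_recip_zeros G) /\ size (unit_recip_zeros G) = size s.
Proof.
move=> Hs; have Ht : is_unit_recip_zeros G (unit_recip_zeros G) by apply: (xgetI _ Hs).
split=> //; apply/perm_size/allP => a _ /=; apply/eqP.
case: (pselect (abs a = 1)) => a1; first exact: zero_order_uniq (Ht.2 a a1) (Hs.2 a a1).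
have cnt0 t : is_unit_recip_zeros G t -> count_mem a t = 0%N.
  by move=> [H _]; apply/count_memPn/negP => /H.
by rewrite !cnt0.
Qed.

Lemma unit_zeros_factor (rho : R) (s : seq Om) (G : nat -> Om) : 0 <= rho -> rho < 1 ->
  is_unit_recip_zeros G s -> (forall m, abs (G m) <= rho ^+ (m - size s)) ->
  exists H, (forall m, abs (H m) <= rho ^+ m) /\ G = ps_mul (linprod s) H.
Proof.
move=> r0 r1 [s1 s2]; apply: unit_zero_factor => // a j aS ja.
by have [H _] := s2 a (s1 a aS); exact: H.
Qed.
End UnitZeros.

(** * Coefficient bounds from ordinarity at slope zero *)

Section OrdinaryBound.
Context {R : realType} {p q : nat} (D : padic_setting R p q) (n : nat).
Hypothesis pp : prime p.
Hypothesis q0 : (0 < q)%N.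
Local Notation Om := (Om D).
Local Notation absK := (@absK _ _ _ D).
Local Notation absOm := (@absOm _ _ _ D).
Let UK : ultrametric_abs absK := absK_ultra D.
Let UO : ultrametric_abs absOm := absOm_ultra D.
Local Notation eps := (p%:R^-1 : R).
Let e0 : 0 < eps. Proof. exact: pV_gt0. Qed.
Let e1 : eps < 1. Proof. exact: pV_lt1. Qed.

Lemma zero_mod_pi_col (M : nuclear_sigma_module D n) (J : set nat) (f : J -> fvec D n (mindex M))
    (B : J -> J -> laurent D n) i j u : is_basis f -> is_matrix_of f B ->
  zero_mod_pi (phi (f j)) -> absK (B i j u) <= eps.
Proof.
move=> Bf HB [m' m'F Hm']; have FB : fmodule (fun i => B i j) := (HB j).1.
apply: le_trans (fnorm_ge i u FB) _; rewrite -(mx_col_norm Bf HB); apply: fnorm_le => [|i' u'].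
  exact: ltW.
rewrite Hm' (absM UK) uniformizer_abs ler_piMr ?(ltW e0) //.
by have /A0P[H _] := m'F i'; exact: H.
Qed.

Lemma card_le_interval N h : (#|[set b : 'I_N.+1 | (0 < b <= h)%N]| <= h)%N.
Proof.
rewrite cardE -(size_map val) -[leqRHS](size_iota 1 h); apply: uniq_leq_size.
  by rewrite (map_inj_uniq val_inj) enum_uniq.
move=> x /mapP[b]; rewrite mem_enum inE => /andP[b1 b2] ->.
by rewrite mem_iota b1 add1n ltnS.
Qed.

(** At most [h] of the distinct columns of a minor have index between 1 and [h], and every other
    column contributes a factor [eps]. Index 0 counts as small, because bases are indexed by
    positive integers and its column in a truncation is zero. *)
Lemma abs_cminor_slope N (A : 'M[Om]_N.+1) h m S T : (forall i j, absOm (A i j) <= 1) ->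
  (forall i j : 'I_N.+1, ~~ (0 < j <= h)%N -> absOm (A i j) <= eps) ->
  absOm (cminor m A S T) <= eps ^+ (m - h).
Proof.
move=> A1 Ae; rewrite /cminor; case: ifP => [/andP[_ /eqP Tm]|_]; last first.
  by rewrite (abs0 UO) exprn_ge0 // ltW.
pose good (j : 'I_m) := (0 < set_nth T j <= h)%N.
pose b (j : 'I_m) := if good j then 1 else eps.
apply: (@le_trans _ _ (\prod_j b j)).
  apply: (abs_det_le UO) => [j|i j]; first by rewrite /b; case: ifP => // _; exact: ltW.
  by rewrite /b mxE; case: ifPn => gj; [exact: A1|exact: Ae].
have -> : \prod_j b j = eps ^+ #|[set j | ~~ good j]|.
  rewrite (bigID good) /= big1 ?mul1r => [|j gj]; last by rewrite /b gj.
  under eq_bigr => j /negPf gj do rewrite /b gj.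
  by rewrite -prodr_const; apply: eq_bigl => j; rewrite inE.
apply: ler_wiXn2l; rewrite ?ltW //=.
have : (#|[set j | good j]| <= h)%N.
  apply: leq_trans (card_le_interval N h); rewrite -(card_imset _ (set_nth_inj Tm)).
  by apply/subset_leq_card/fintype.subsetP => x /imsetP[j]; rewrite inE => gj ->; rewrite inE.
have := cardsC [set j | good j]; rewrite card_ord.
have -> : finset.setC [set j | good j] = [set j | ~~ good j] by apply/setP => j; rewrite !inE.
move=> E gh; rewrite leq_subLR; apply: leq_trans (eq_leq (esym E)) _.
by rewrite leq_add2r.
Qed.

(** By [abs_cminor_slope] the $m$-th exterior power of each of the [d] factors has entries at most
    $p^{-(m-h)}$, and exterior powers are multiplicative. For $m \le h$ the truncated subtraction
    gives the trivial bound 1. *)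
Lemma fredholm_slope (J : set nat) (B : J -> J -> laurent D n) h x d m :
  (J `<=` [set j | (0 < j)%N])%classic -> nuclear_mx B ->
  (forall i j : J, (h < val j)%N -> forall u, absK (B i j u) <= eps) ->
  unit_pt x -> (0 < d)%N ->
  absOm (fredholm_det (frob_product B x d) m) <= (eps ^+ d) ^+ (m - h).
Proof.
move=> Jp HB Bh ux d0; set b := (eps ^+ d) ^+ (m - h).
have b0 : 0 < b by rewrite !exprn_gt0.
have [N HN] := HB.2 _ b0.
pose C i := imx_eval B (frob_pt x i).
pose A i : 'M[Om]_N.+1 := \matrix_(a, c) zext (C i) a c.
have C1 i a c : absOm (C i a c) <= 1 by exact: nuclear_eval_le1.
have A1 i a c : absOm (A i a c) <= 1 by rewrite mxE; apply: zext_le1.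
have Ah i (a c : 'I_N.+1) : ~~ (0 < c <= h)%N -> absOm (A i a c) <= eps.
  move=> ch; rewrite mxE /zext.
  case: (insub (a : nat) : option J) => [a'|] /=; last by rewrite (abs0 UO) ltW.
  have := insubK J (c : nat); case: (insub (c : nat) : option J) => [c'|] /=; last by rewrite (abs0 UO) ltW.
  move=> E; apply: eval_le; [exact: unit_frob_pt|exact: ltW|exact: HB.1|].
  apply: Bh; have Ec : val c' = c by exact: E.
  have c0 : (0 < c)%N by rewrite -Ec; exact: Jp (set_valP c').
  by rewrite Ec ltnNge; move: ch; rewrite c0.
rewrite frob_product_prod; apply: (abs_close_le UO (y := (char_ser (mx_prod A d))`_m)).
  apply: fredholm_prod_close => //; first by move=> i; exact: nuclear_eval_decay.
  - exact: ltW.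
  - move=> i; apply: (nuclear_eval_tail HB ux (ltW b0)) => i' j Nj u.
    by apply: HN; exact: ltnW Nj.
  by move=> i a c; rewrite mxE subrr (abs0 UO) ltW.
have -> : (char_ser (mx_prod A d))`_m = (-1) ^+ m * \sum_S cminor m (mx_prod A d) S S.
  by rewrite cminor_trace mulrA -exprD addnn -mul2n exprM sqrrN expr1n expr1n mul1r.
rewrite (absM UO) (absX UO) (absN1 UO) expr1n mul1r; apply: (abs_sum_le UO) => [|S _]; first exact: ltW.
rewrite /b -exprM mulnC exprM; suff H k T W : absOm (cminor m (mx_prod A k) T W) <= (eps ^+ (m - h)) ^+ k by exact: H.
elim: k T W => [|k IH] T W.
  by rewrite cminor1 expr0; apply: (abs_natr UO).
rewrite [mx_prod _ _]/= cminorM; apply: (abs_sum_le UO) => [|V _]; first by rewrite !exprn_ge0 // ltW.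
rewrite (absM UO) exprSr; apply: ler_pM; rewrite ?(abs_ge0 UO) //.
by apply: abs_cminor_slope => //; exact: Ah.
Qed.
End OrdinaryBound.

Section PowerSumsCongr.
Variable A : comNzRingType.

Lemma power_sums_eq (G G' : nat -> A) j : G 0%N = 1 -> G' 0%N = 1 ->
  (forall i, (i <= j.+1)%N -> G i = G' i) -> power_sums G j.+1 = power_sums G' j.+1.
Proof.
move=> G1 G1'; elim/ltn_ind: j => j IH E; rewrite !power_sums_rec // E //; congr (_ - _).
apply: eq_bigr => i _; rewrite IH // => [|k ki]; last first.
  by apply: E; apply: leq_trans ki _; exact: ltnW (ltn_ord i).
by rewrite E // (leq_trans (leq_subr _ _)).
Qed.

Lemma coef_prod_ps (I : Type) (r : seq I) (P : I -> {poly A}) :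
  (fun m => (\prod_(i <- r) P i)`_m) =
  \big[@ps_mul A/@ps_one A]_(i <- r) (fun m => (P i)`_m).
Proof.
elim: r => [|i r IH]; first by rewrite !big_nil; apply/funext => m; rewrite coef1.
by rewrite !big_cons -IH; apply/funext => m; rewrite coefM.
Qed.
End PowerSumsCongr.

Section BoundedSeries.
Context {R : realType} {F : fieldType} {abs : F -> R} (U : ultrametric_abs abs).

Lemma ps_mul_bounded (e : R) (f g : nat -> F) : 0 <= e -> (forall m, abs (f m) <= e ^+ m) ->
  (forall m, abs (g m) <= e ^+ m) -> forall m, abs (ps_mul f g m) <= e ^+ m.
Proof.
move=> e0 Hf Hg m; apply: (abs_sum_le U) => [|i _]; first exact: exprn_ge0.
have -> : e ^+ m = e ^+ i * e ^+ (m - i) by rewrite -exprD subnKC // -ltnS.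
by rewrite (absM U); apply: ler_pM; rewrite ?(abs_ge0 U).
Qed.

Lemma ps_prod_bounded (e : R) (I : eqType) (r : seq I) (f : I -> nat -> F) : 0 <= e ->
  (forall i m, i \in r -> abs (f i m) <= e ^+ m) ->
  forall m, abs ((\big[@ps_mul F/@ps_one F]_(i <- r) f i) m) <= e ^+ m.
Proof.
move=> e0 H m; rewrite big_seq; elim/big_rec: _ m => [[|m]|i g ir IH m].
- by rewrite /ps_one eqxx (abs1 U).
- by rewrite (abs0 U) exprn_ge0.
by apply: ps_mul_bounded => // k; exact: H.
Qed.
End BoundedSeries.

(** * Euler factors formed with the non-unit zeros *)

Section SmallFactor.
Context {R : realType} {p q : nat} (D : padic_setting R p q).
Hypothesis pp : prime p.
Local Notation Om := (Om D).
Local Notation abs := (@absOm _ _ _ D).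
Let U : ultrametric_abs abs := absOm_ultra D.

(** A root $r$ with $|r| < 1/\rho$ is impossible: in $P(r) = 0$ all terms except the constant term 1
    would have absolute value below 1. *)
Lemma split_unit_poly (P : {poly Om}) (rho : R) : P`_0 = 1 -> 0 < rho ->
  (forall m, abs P`_m <= rho ^+ m) ->
  exists2 s : seq Om, (forall b, b \in s -> abs b <= rho) &
    (fun m => P`_m) = \big[@ps_mul Om/@ps_one Om]_(b <- s) ps_lin b.
Proof.
move=> P0 r0 Ple; have [rs Prs] := closed_field_poly_normal P.
have rootP r : r \in rs -> P.[r] = 0.
  move=> rr; rewrite Prs hornerZ; apply/eqP; rewrite mulf_eq0; apply/orP; right.
  by rewrite -/(root _ _) root_prod_XsubC.
have r_neq0 r : r \in rs -> r != 0.
  by move=> /rootP Pr; apply/eqP => E; move: Pr; rewrite E horner_coef0 P0 => /eqP; rewrite oner_eq0.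
have r_large r : r \in rs -> rho^-1 <= abs r.
  move=> rr; rewrite leNgt; apply/negP => ar.
  have x1 : rho * abs r < 1 by rewrite mulrC -ltr_pdivlMr // div1r.
  have := rootP r rr; rewrite (horner_coef_wide (n := (size P).+1)) // big_ord_recl P0 expr0 mulr1 => /eqP.
  rewrite addrC addr_eq0 => /eqP E.
  have : abs (\sum_(i < size P) P`_(bump 0 i) * r ^+ bump 0 i) <= rho * abs r.
    apply: (abs_sum_le U) => [|i _]; first by rewrite mulr_ge0 ?(abs_ge0 U) // ltW.
    rewrite (absM U) (absX U) /bump /= add1n; apply: (@le_trans _ _ ((rho * abs r) ^+ i.+1)).
      by rewrite exprMn ler_wpM2r ?exprn_ge0 ?(abs_ge0 U).
    rewrite exprS ler_piMr ?exprn_ile1 ?mulr_ge0 ?(abs_ge0 U) // ltW //.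
  by rewrite E (absN1 U) leNgt x1.
pose s := [seq r^-1 | r <- rs]; exists s.
  move=> b /mapP[r rr ->]; have ra : 0 < abs r by rewrite (abs_gt0 U) r_neq0.
  rewrite (absV U) -[leRHS]invrK lef_pV2 ?posrE ?invr_gt0 //; exact: r_large.
have lin (r : Om) : r != 0 -> 'X - r%:P = (- r) *: (1 - r^-1 *: 'X).
  move=> r0'; rewrite scalerBr scalerA mulNr mulfV // scaleN1r opprK addrC scaleNr alg_polyC //.
have [c Pc] : exists c : Om, P = c *: \prod_(b <- s) (1 - b *: 'X).
  exists (lead_coef P * \prod_(r <- rs) - r); rewrite [LHS]Prs -scalerA; congr (_ *: _).
  rewrite /s big_map; elim: (rs) r_neq0 => [|r t IH] Ht; first by rewrite !big_nil scale1r.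
  rewrite !big_cons IH => [|x xt]; last by apply: Ht; rewrite inE xt orbT.
  by rewrite lin ?Ht ?mem_head // -scalerAl -scalerAr scalerA.
have linE b : (fun m => (1 - b *: 'X : {poly Om})`_m) = ps_lin b.
  apply/funext => -[|[|m]]; rewrite coefB coefZ coef1 coefX /= ?mulr0 ?subr0 //.
  by rewrite mulr1 sub0r.
have prodE : (fun m => (\prod_(b <- s) (1 - b *: 'X) : {poly Om})`_m) =
    \big[@ps_mul Om/@ps_one Om]_(b <- s) ps_lin b.
  by rewrite coef_prod_ps; apply: eq_bigr => b _; exact: linE.
have c1 : c = 1.
  have := P0; rewrite Pc coefZ.
  have := ps_lin_prod0 s; rewrite -prodE => ->; by rewrite mulr1.
by rewrite -prodE; apply/funext => m; rewrite [in LHS]Pc c1 scale1r.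
Qed.

(** The series is formally $\prod_b (1 - b^k T^d)^{-1}$ over the reciprocal zeros $b$ of [H]. The
    bound is read off from such a product, because a bound on the logarithmic derivative would be
    spoilt by the integer denominators of the exponential. *)
Lemma small_factor_euler (eps : R) (H : nat -> Om) k d : 0 < eps -> (0 < k)%N -> (0 < d)%N ->
  H 0%N = 1 -> (forall m, abs (H m) <= (eps ^+ d) ^+ m) ->
  exists phi, ps_log_deriv (fun m => if (d %| m)%N then power_sums H (k * (m %/ d))%N *+ d else 0) phi /\
    forall m, abs (phi m) <= (eps ^+ k) ^+ m.
Proof.
move=> e0 k0 d0 H1 Hle.
pose S m : Om := if (d %| m)%N then power_sums H (k * (m %/ d))%N *+ d else 0.
have [phi Hphi] := ps_log_deriv_exists (@Om_char0 _ _ _ D pp) S.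
exists phi; split=> // m.
(* The coefficient of $T^m$ involves only power sums of index at most $km$, so [H] may be replaced
   by a truncation, which splits into linear factors. *)
pose P : {poly Om} := \poly_(i < (k * m).+1) H i.
have PE i : (i <= k * m)%N -> P`_i = H i by move=> im; rewrite coef_poly ltnS im.
have [||i|s sle sE] := @split_unit_poly P (eps ^+ d).
- by rewrite PE.
- exact: exprn_gt0.
- by rewrite coef_poly; case: ifP => _ //; rewrite (abs0 U) !exprn_ge0 // ltW.
pose phi' := \big[@ps_mul Om/@ps_one Om]_(b <- s) ps_euler (b ^+ k) d.
have Hphi' : ps_log_deriv (fun m => \sum_(b <- s) (if (d %| m)%N then (b ^+ k) ^+ (m %/ d) *+ d else 0)) phi'.
  by apply: ps_log_deriv_big => b; exact: ps_log_deriv_euler.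
have -> : phi m = phi' m.
  apply: (ps_log_deriv_uniq (@Om_char0 _ _ _ D pp) _ Hphi Hphi') => i /andP[i0 im].
  rewrite /S; case: ifP => di; last by rewrite big1.
  rewrite sumrMnl; congr (_ *+ _).
  have kd0 : (0 < k * (i %/ d))%N by rewrite muln_gt0 k0 divn_gt0 // dvdn_leq.
  under eq_bigr => b _ do rewrite -exprM.
  rewrite -(prednK kd0) -power_sums_lin -sE; apply: power_sums_eq => // [|j]; first by rewrite PE.
  rewrite prednK // => jk; rewrite PE //; apply: leq_trans jk _; rewrite leq_mul2l.
  by apply/orP; right; apply: leq_trans im; exact: leq_div.
apply: (ps_prod_bounded U); first by rewrite exprn_ge0 // ltW.
move=> b l bs; rewrite /ps_euler; case: ifP => dl; last by rewrite (abs0 U) !exprn_ge0 // ltW.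
rewrite !(absX U); have -> : (eps ^+ k) ^+ l = ((eps ^+ d) ^+ k) ^+ (l %/ d).
  rewrite -!exprM; congr (_ ^+ _).
  by rewrite -{1}(divnK dl) [RHS]mulnCA [(d * _)%N]mulnC.
rewrite -!(exprM _ k) lerXn2r ?nnegrE ?(abs_ge0 U) ?exprn_ge0 ?(ltW e0) //.
exact: sle.
Qed.
End SmallFactor.

(** * Teichmueller points and closed points *)

Lemma prim_root_exists (F : closedFieldType) N : N%:R != 0 :> F ->
  exists z : F, N.-primitive_root z.
Proof.
move=> N0; have n_gt0 : (0 < N)%N by case: N N0 => //; rewrite eqxx.
pose P : {poly F} := 'X^N - 1; have [r Dp] := closed_field_poly_normal P.
rewrite (monicP _) ?monicXnsubC // scale1r in Dp.
have rn1 : all N.-unity_root r by apply/allP => z; rewrite -root_prod_XsubC -Dp.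
have sz_r : (N < (size r).+1)%N by rewrite -(size_prod_XsubC r id) -Dp size_XnsubC.
have [|z _ Hz] := hasP (cyclic.has_prim_root n_gt0 rn1 _ sz_r); last by exists z.
by rewrite -separable_prod_XsubC -Dp separable_Xn_sub_1.
Qed.

Section Teichmueller.
Context {R : realType} {p q : nat} (D : padic_setting R p q) (n : nat).
Hypothesis pp : prime p.
Hypothesis qP : exists2 a : nat, (0 < a)%N & q = (p ^ a)%N.
Local Notation Om := (Om D).
Local Notation kOm := (kOm D).
Local Notation absOm := (@absOm _ _ _ D).
Local Notation red := (@redOm _ _ _ D).
Local Notation tc := (@teich _ _ _ D n).
Let UO : ultrametric_abs absOm := absOm_ultra D.
Let rP : is_residue_map absOm red := redOmP D.

Lemma red_0 : red 0 = 0.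
Proof. by apply/(red_eq0 rP); rewrite ?(abs0 UO). Qed.

Lemma red_nat k : red k%:R = k%:R.
Proof.
elim: k => [|k IH]; first exact: red_0.
by rewrite !mulrS (redD rP) ?(red1 rP) ?IH // ?(abs1 UO) // (abs_natr UO).
Qed.

Lemma red_exp x k : absOm x <= 1 -> red (x ^+ k) = red x ^+ k.
Proof.
move=> x1; elim: k => [|k IH]; first exact: (red1 rP).
by rewrite !exprS (redM rP) ?IH // (absX_le1 UO).
Qed.

Lemma red_sum (I : Type) (r : seq I) (f : I -> Om) : (forall i, absOm (f i) <= 1) ->
  red (\sum_(i <- r) f i) = \sum_(i <- r) red (f i).
Proof.
move=> H; elim: r => [|i r IH]; first by rewrite !big_nil red_0.
by rewrite !big_cons (redD rP) ?IH //; apply: (abs_sum_le UO).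
Qed.

Lemma kOm_pchar : p \in [pchar kOm].
Proof.
apply/andP; split=> //; rewrite -red_nat; apply/eqP/(red_eq0 rP); first exact: (abs_natr UO).
exact: absOm_p_lt1.
Qed.

Lemma kOm_pnat d : [pchar kOm].-nat (q ^ d)%N.
Proof.
have [a _ qE] := qP; have -> : (q ^ d = p ^ (a * d))%N by rewrite {1}qE expnM.
by rewrite (eq_pnat _ (pcharf_eq kOm_pchar)) pnatX pnat_id.
Qed.

Lemma kOm_q d : (0 < d)%N -> (q ^ d)%N%:R = 0 :> kOm.
Proof.
have [a a0 qE] := qP => d0; have -> : (q ^ d = p ^ (a * d))%N by rewrite {1}qE expnM.
rewrite natrX; have -> : (p%:R : kOm) = 0.
  by have /andP[_ /eqP] := kOm_pchar.
by rewrite expr0n muln_eq0 -!leqn0 leqNgt a0 leqNgt d0.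
Qed.

Lemma expr_fix (F : comNzRingType) (x : F) Q k : x ^+ Q = x -> x ^+ (Q ^ k) = x.
Proof. by move=> E; elim: k => [|k IH]; rewrite ?expn0 ?expr1 // expnS exprM E. Qed.

(* If x <> y are two lifts fixed by some power of Frobenius, then
   (x^Q - y^Q) / (x - y) = 1 while its reduction is Q t^(Q-1) = 0. *)
Lemma teich_uniq (x y : Om) d d' : absOm x <= 1 -> absOm y <= 1 -> red x = red y ->
  (0 < d)%N -> (0 < d')%N -> x ^+ (q ^ d) = x -> y ^+ (q ^ d') = y -> x = y.
Proof.
move=> x1 y1 xy d0 d0' xd yd; set Q := (q ^ (d * d'))%N.
have xQ : x ^+ Q = x by rewrite /Q expnM; exact: expr_fix.
have yQ : y ^+ Q = y by rewrite /Q mulnC expnM; exact: expr_fix.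
apply/eqP; rewrite -subr_eq0; apply/negP => /negP w0.
have H : \sum_(i < Q) x ^+ (Q.-1 - i) * y ^+ i = 1.
  by apply: (mulfI w0); rewrite -subrXX xQ yQ mulr1.
have := red1 rP; rewrite -H red_sum => [|i]; last by rewrite (absM_le1 UO) ?(absX_le1 UO).
have -> : \sum_(i < Q) red (x ^+ (Q.-1 - i) * y ^+ i) = \sum_(i < Q) red x ^+ Q.-1.
  apply: eq_bigr => i _; rewrite (redM rP) ?(absX_le1 UO) // !red_exp // -xy -exprD subnK //.
  by rewrite -ltnS prednK // expn_gt0 (ltnW (q_gt1 pp qP)).
rewrite sumr_const card_ord -mulr_natr kOm_q ?muln_gt0 ?d0 // mulr0 => /esym/eqP.
by rewrite oner_eq0.
Qed.

Lemma teich1E (x : Om) d : absOm x <= 1 -> (0 < d)%N -> x ^+ (q ^ d) = x -> teich1 (red x) = x.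
Proof.
move=> x1 d0 xd; rewrite /teich1.
have [y1 yx [d' d0' yd]] : [set y | [/\ absOm y <= 1, red y = red x &
    exists2 d, (0 < d)%N & y ^+ (q ^ d) = y]]%classic (teich1 (red x)).
  by apply: (xgetI _ (x := x)); split=> //; exists d.
exact: teich_uniq yx d0' d0 yd xd.
Qed.

Local Notation fr := (@frob _ _ _ D n).

Lemma iter_frob m (x : 'rV[kOm]_n) : iter m fr x = map_mx (fun t => t ^+ (q ^ m)) x.
Proof.
elim: m => [|m IH]; first by apply/rowP => i; rewrite mxE expn0 expr1.
by rewrite iterS IH; apply/rowP => i; rewrite !mxE expnSr exprM.
Qed.

Lemma kOm_expr_inj d : injective (fun t : kOm => t ^+ (q ^ d)).
Proof.
move=> s t /= st; have : (s - t) ^+ (q ^ d) == 0.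
  by rewrite exprDn_pchar ?kOm_pnat // exprNn_pchar ?kOm_pnat // st subrr.
by rewrite expf_eq0 subr_eq0 => /andP[_ /eqP].
Qed.

Lemma iter_frob_inj m : injective (iter m fr).
Proof.
move=> x y; rewrite !iter_frob => /rowP E; apply/rowP => i.
by have := E i; rewrite !mxE; exact: kOm_expr_inj.
Qed.

Definition frob_orbit (x : 'rV[kOm]_n) : set 'rV[kOm]_n := [set iter m fr x | m in setT]%classic.

Lemma frob_orbitP x : geom_point x -> [/\ (0 < degree (frob_orbit x))%N, finite_set (frob_orbit x) &
  forall m, iter m fr x = x <-> (degree (frob_orbit x) %| m)%N].
Proof.
move=> [_ [d0 d00 xd0]].
have /ex_minnP[d /andP[dp /eqP xd] dmin] : exists d, (0 < d)%N && (iter d fr x == x).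
  by exists d0; rewrite d00 xd0 eqxx.
have iterMn k : iter (k * d) fr x = x.
  by elim: k => [|k IH] //; rewrite mulSn iterD IH.
have iter_mod m : iter m fr x = iter (m %% d) fr x.
  by rewrite {1}(divn_eq m d) addnC iterD iterMn.
have orbE : frob_orbit x = [set` [fset y in traject fr x d]%fset]%classic.
  apply/seteqP; split=> y /=.
    move=> [m _ <-]; rewrite !inE; apply/trajectP; exists (m %% d)%N; rewrite ?ltn_mod //.
  by rewrite !inE => /trajectP[i _ ->]; exists i.
have U : uniq (traject fr x d).
  case: d dp xd dmin {iterMn iter_mod orbE} => // d _ xd dmin; rewrite looping_uniq.
  apply/negP => /trajectP[i id E].
  have : iter (d - i) fr x = x.
    by apply: (@iter_frob_inj i); rewrite -iterD subnKC ?(ltnW id).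
  move=> /eqP E2; have := dmin (d - i)%N; rewrite subn_gt0 id E2 => /(_ isT).
  by rewrite ltnNge leq_subr.
have degE : degree (frob_orbit x) = d.
  by rewrite /degree orbE set_fsetK card_fseq undup_id // size_traject.
rewrite degE; split=> //; first by rewrite orbE; exact: finite_fset.
move=> m; split=> [xm|/dvdnP[k ->]]; last exact: iterMn.
apply: contraT; rewrite /dvdn -lt0n => m0.
have := dmin (m %% d)%N; rewrite m0 -iter_mod xm eqxx => /(_ isT).
by rewrite leqNgt ltn_mod dp.
Qed.

Lemma frob_orbit_mem x y : geom_point x -> frob_orbit x y -> geom_point y /\ frob_orbit y = frob_orbit x.
Proof.
move=> gx [i _ <-]; have [[x0 [d d0 xd]] _] := (gx, tt); split.
  split; last by exists d => //; rewrite -iterD addnC iterD xd.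
  by move=> j; rewrite iter_frob mxE expf_neq0.
apply/seteqP; split=> z [m _ <-]; first by exists (m + i)%N; rewrite // iterD.
exists (m + (d * i - i))%N => //; rewrite -iterD -addnA subnK ?leq_pmull // iterD; congr iter.
by elim: i => [|i IH]; rewrite ?muln0 // mulnS iterD IH.
Qed.

Lemma closed_pointP P : closed_point P -> [/\ P (xget 0 P), geom_point (xget 0 P) & P = frob_orbit (xget 0 P)].
Proof.
move=> [x gx <-]; have H : frob_orbit x (xget 0 (frob_orbit x)).
  by apply: (xgetI _ (x := x)); exists 0%N.
by have [g1 g2] := frob_orbit_mem gx H.
Qed.

Variable z : nat -> Om.
Hypothesis zP : forall m, (0 < m)%N -> (q ^ m - 1).-primitive_root (z m).

Let qm1 m : (q ^ m - 1).+1 = (q ^ m)%N.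
Proof. by rewrite subn1 prednK // expn_gt0 (ltnW (q_gt1 pp qP)). Qed.

Let z_abs m : (0 < m)%N -> absOm (z m) <= 1.
Proof.
move=> m0; rewrite (abs_root_unity _ (prim_expr_order (zP m0))) //.
exact: prim_order_gt0 (zP m0).
Qed.

Let z_fix m : (0 < m)%N -> z m ^+ (q ^ m) = z m.
Proof. by move=> m0; rewrite -qm1 exprS (prim_expr_order (zP m0)) mulr1. Qed.

Let zk_fix m k : (0 < m)%N -> (z m ^+ k) ^+ (q ^ m) = z m ^+ k.
Proof. by move=> m0; rewrite exprAC z_fix. Qed.

(** By uniqueness of Teichmueller lifts a power of [z m] with residue 1 equals 1, so the order is
    preserved by reduction. *)
Lemma red_prim_root m : (0 < m)%N -> (q ^ m - 1).-primitive_root (red (z m)).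
Proof.
move=> m0; have N0 := prim_order_gt0 (zP m0).
have E i : (red (z m) ^+ i == 1) = (z m ^+ i == 1).
  rewrite -red_exp ?z_abs //; apply/eqP/eqP => [|->]; last exact: (red1 rP).
  rewrite -(red1 rP) => H; apply: (teich_uniq (d := m) (d' := m)) H _ _ _ _ => //.
  - by rewrite (absX_le1 UO) // z_abs.
  - by rewrite (abs1 UO).
  - exact: zk_fix.
  - exact: expr1n.
rewrite /primitive_root_of_unity N0 /=; apply/forallP => i.
have /andP[_ /forallP/(_ i)/eqP <-] := zP m0.
by apply/eqP; rewrite !unity_rootE E.
Qed.

Definition root_red m (e : {ffun 'I_n -> 'I_(q ^ m - 1)}) : 'rV[kOm]_n := map_mx red (root_pt (z m) e).

Lemma root_redE m e i : (0 < m)%N -> @root_red m e 0 i = red (z m) ^+ e i.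
Proof. by move=> m0; rewrite !mxE red_exp // z_abs. Qed.

Lemma root_red_inj m : (0 < m)%N -> injective (@root_red m).
Proof.
move=> m0 e e' /rowP E; apply/ffunP => i; have := E i; rewrite !root_redE // => /eqP.
rewrite (eq_prim_root_expr (red_prim_root m0)) !modn_small // => /eqP; exact: val_inj.
Qed.

Lemma root_red_fix m e : (0 < m)%N -> (forall i, @root_red m e 0 i != 0) /\ iter m fr (@root_red m e) = root_red e.
Proof.
move=> m0; split=> [i|].
  rewrite root_redE // expf_neq0 // (prim_root_eq0 (red_prim_root m0)) -lt0n.
  exact: prim_order_gt0 (zP m0).
rewrite iter_frob; apply/rowP => i; rewrite mxE root_redE // -exprM mulnC exprM.
by rewrite -red_exp ?z_abs // z_fix.
Qed.

Lemma root_red_geom m e : (0 < m)%N -> geom_point (@root_red m e).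
Proof. by move=> m0; have [H1 H2] := root_red_fix e m0; split=> //; exists m. Qed.

Lemma root_red_surj m (x : 'rV[kOm]_n) : (0 < m)%N -> (forall i, x 0 i != 0) -> iter m fr x = x ->
  exists e, x = @root_red m e.
Proof.
move=> m0 x0; rewrite iter_frob => /rowP xm.
have x1 i : x 0 i ^+ (q ^ m - 1) = 1.
  by apply: (mulfI (x0 i)); rewrite -exprS qm1 mulr1; have := xm i; rewrite mxE.
exists [ffun i => sval (prim_rootP (red_prim_root m0) (x1 i))]; apply/rowP => i.
by rewrite root_redE // ffunE; exact: (svalP (prim_rootP _ _)).
Qed.

Lemma teich_root_red m e : (0 < m)%N -> map_mx (@teich1 _ _ _ D) (@root_red m e) = root_pt (z m) e.
Proof.
move=> m0; apply/rowP => i; rewrite !mxE; apply: (teich1E (d := m)) => //; last exact: zk_fix.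
by rewrite (absX_le1 UO) // z_abs.
Qed.

Lemma frob_root_pt m e : (0 < m)%N -> frob_pt (@root_pt _ _ _ D n (q ^ m - 1) (z m) e) m = root_pt (z m) e.
Proof. by move=> m0; apply/rowP => i; rewrite !mxE zk_fix. Qed.

Lemma teichP P : closed_point P -> [/\ (0 < degree P)%N, unit_pt (tc P) &
  frob_pt (tc P) (degree P) = tc P].
Proof.
move=> cP; have [_ gx PE] := closed_pointP cP; have [d0 _ H] := frob_orbitP gx.
rewrite -PE in d0 H; have [e xe] := root_red_surj d0 gx.1 ((H _).2 (dvdnn _)).
rewrite /teich xe teich_root_red //; split=> //; last exact: frob_root_pt.
by apply: unit_root_pt => //; exact: zP.
Qed.

(** [teich] lifts an arbitrarily chosen point of the orbit, so the two lifts agree only up to a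
    power of Frobenius. *)
Lemma teich_orbit m e : (0 < m)%N -> exists i,
  tc (frob_orbit (@root_red m e)) = frob_pt (root_pt (z m) e) i.
Proof.
move=> m0; have cP : closed_point (frob_orbit (@root_red m e)).
  by exists (root_red e) => //; exact: root_red_geom.
have [[i _ Ei] _ _] := closed_pointP cP; exists i.
rewrite /teich -Ei iter_frob; apply/rowP => j; rewrite !mxE -red_exp ?(absX_le1 UO) ?z_abs //.
apply: (teich1E (d := m)) => //; first by rewrite !(absX_le1 UO) // z_abs.
by rewrite exprAC zk_fix.
Qed.

Definition closed_points m : set (set 'rV[kOm]_n) := [set P | closed_point P /\ (degree P <= m)%N]%classic.

Lemma finite_closed_points m : finite_set (closed_points m).
Proof.
apply: (@sub_finite_set _ _ (\bigcup_(d in [set d | (d < m.+1)%N])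
   (range (fun e : {ffun 'I_n -> 'I_(q ^ d - 1)} => frob_orbit (root_red e))))%classic).
  move=> P [cP dP]; exists (degree P) => //; have [_ gx PE] := closed_pointP cP.
  have [d0 _ H] := frob_orbitP gx; rewrite -PE in d0 H.
  have [e xe] := root_red_surj d0 gx.1 ((H _).2 (dvdnn _)).
  by exists e => //; rewrite -xe.
apply: bigcup_finite => [|d _]; first exact: finite_II.
by apply: finite_image; exact: finite_finset.
Qed.

Lemma card_root_red m P : (0 < m)%N -> closed_point P -> (degree P %| m)%N ->
  #|[set e | frob_orbit (@root_red m e) == P]| = degree P.
Proof.
move=> m0 cP dm; have [_ gx PE] := closed_pointP cP; have [d0 fP H] := frob_orbitP gx.
rewrite -PE in fP H; rewrite cardE -(size_map (@root_red m)); apply/perm_size/uniq_perm.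
- by rewrite map_inj_uniq ?enum_uniq //; exact: root_red_inj.
- exact: fset_uniq.
move=> y; rewrite in_fset_set //; apply/mapP/idP => [[e]|].
  rewrite mem_enum finset.in_set => /eqP <- ->; apply/mem_set; by exists 0%N.
move=> /set_mem Py; have [] := frob_orbit_mem gx (y := y); first by rewrite -PE.
rewrite -PE => gy yP; have [_ _ Hy] := frob_orbitP gy; rewrite yP in Hy.
have [e ye] := root_red_surj m0 gy.1 ((Hy m).2 dm).
by exists e => //; rewrite mem_enum finset.in_set -ye yP.
Qed.

(** The [root_red e] are the points of the torus over the field with $q^m$ elements, each occurring
    once; they are grouped by Frobenius orbits. *)
Lemma sum_root_pt (V : nmodType) m (f : {ffun 'I_n -> 'I_(q ^ m - 1)} -> V) (v : set 'rV[kOm]_n -> V) :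
  (0 < m)%N -> (forall e, f e = v (frob_orbit (root_red e))) ->
  \sum_e f e = \sum_(P <- fset_set (closed_points m)) (if (degree P %| m)%N then v P *+ degree P else 0).
Proof.
move=> m0 fv; have fin := finite_closed_points m.
have deg e : (degree (frob_orbit (@root_red m e)) %| m)%N.
  have [_ _ H] := frob_orbitP (root_red_geom e m0); apply/H; exact: (root_red_fix e m0).2.
have memP e : frob_orbit (@root_red m e) \in fset_set (closed_points m).
  rewrite in_fset_set //; apply/mem_set; split; last exact: dvdn_leq (deg e).
  by exists (root_red e) => //; exact: root_red_geom.
transitivity (\sum_e \sum_(P <- fset_set (closed_points m))
    (if frob_orbit (@root_red m e) == P then v P else 0)).
  apply: eq_bigr => e _; rewrite (bigD1_seq _ (memP e)) ?fset_uniq //= eqxx big1 ?addr0 ?fv // => P nP.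
  by rewrite eq_sym (negPf nP).
rewrite exchange_big /= big_seq [RHS]big_seq; apply: eq_bigr => P.
rewrite in_fset_set // => /set_mem[cP _]; rewrite -big_mkcond /=.
case: ifP => dm; last first.
  by rewrite big_pred0 // => e; apply/negP => /eqP E; have := deg e; rewrite E dm.
rewrite -(card_root_red m0 cP dm) -sumr_const; by apply: eq_bigl => e; rewrite finset.in_set.
Qed.
End Teichmueller.

(** * Euler products and residues of unit zeros *)

Section EulerProduct.
Variables (F : fieldType) (T : choiceType) (C : set T) (deg : T -> nat).
Hypothesis F0 : forall m, m.+1%:R != 0 :> F.
Let pts m := fset_set [set P | C P /\ (deg P <= m)%N]%classic.
Hypothesis fin : forall m, finite_set [set P | C P /\ (deg P <= m)%N]%classic.
Variables s phi : T -> nat -> F.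
Hypothesis sphi : forall P, C P -> ps_log_deriv (s P) (phi P).
Hypothesis s0 : forall P m, C P -> (0 < m < deg P)%N -> s P m = 0.

Lemma ps_log_deriv_big_seq (I : eqType) (r : seq I) (S f : I -> nat -> F) :
  (forall i, i \in r -> ps_log_deriv (S i) (f i)) ->
  ps_log_deriv (fun m => \sum_(i <- r) S i m) (\big[@ps_mul F/@ps_one F]_(i <- r) f i).
Proof.
elim: r => [|i r IH] H.
  by rewrite big_nil; apply: ps_log_deriv_eq (ps_log_deriv1 F) => m; rewrite big_nil.
rewrite big_cons; apply: ps_log_deriv_eq (ps_log_deriv_mul (H i (mem_head _ _)) (IH _)).
  by move=> m; rewrite big_cons.
by move=> j jr; apply: H; rewrite inE jr orbT.
Qed.

(** The finite product that defines the coefficient of $T^m$ changes with $m$. Enlarging it is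
    harmless: a factor at a point of degree above $m$ has vanishing logarithmic derivative up to
    $m$, hence is 1 modulo $T^{m+1}$. *)
Lemma ps_log_deriv_euler_product :
  ps_log_deriv (fun m => \sum_(P <- pts m) s P m)
    (fun m => (\big[@ps_mul F/@ps_one F]_(P <- pts m) phi P) m).
Proof.
have ptsP m P : P \in pts m -> C P /\ (deg P <= m)%N.
  by rewrite in_fset_set // => /set_mem.
have pld M : ps_log_deriv (fun m => \sum_(P <- pts M) s P m) (\big[@ps_mul F/@ps_one F]_(P <- pts M) phi P).
  by apply: ps_log_deriv_big_seq => P /ptsP[cP _]; exact: sphi.
have sE M i : (0 < i <= M)%N -> \sum_(P <- pts M) s P i = \sum_(P <- pts i) s P i.
  move=> /andP[i0 iM]; apply/esym/big_fset_incl => [|P PM Pi].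
    by apply/fsubsetP => P /ptsP[cP dP]; rewrite in_fset_set //; apply/mem_set; split=> //; exact: leq_trans iM.
  have [cP _] := ptsP _ _ PM; apply: s0 => //; rewrite i0 ltnNge; apply: contra Pi => dP.
  by rewrite in_fset_set //; apply/mem_set.
have LE M i : (i <= M)%N -> (\big[@ps_mul F/@ps_one F]_(P <- pts M) phi P) i =
    (\big[@ps_mul F/@ps_one F]_(P <- pts i) phi P) i.
  move=> iM; apply: (ps_log_deriv_uniq F0 _ (pld M) (pld i)) => j /andP[j0 ji].
  by rewrite !sE ?j0 ?ji // (leq_trans ji).
split; first exact: (pld 0%N).1.
move=> m; rewrite (pld m.+1).2; apply: eq_bigr => i _.
have E := LE m.+1 (m - i)%N (leq_trans (leq_subr _ _) (leqnSn m)).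
rewrite sE ?ltnS ?ltn_ord //=.
  exact: (congr1 (fun t => (\sum_(P <- pts i.+1) s P i.+1) * t) E).
by rewrite -ltnS ltn_ord.
Qed.
End EulerProduct.

(** * Dependence of the determinants on the level and on the point of the orbit *)

Section Periodicity.
Lemma mx_prod_add (F : pzRingType) N (A : nat -> 'M[F]_N) i j :
  mx_prod A (i + j) = mx_prod A i *m mx_prod (fun k => A (i + k)%N) j.
Proof.
elim: j => [|j IH]; first by rewrite addn0 mulmx1.
by rewrite addnS /= IH mulmxA.
Qed.

Lemma mx_prod_period (F : pzRingType) N (A : nat -> 'M[F]_N.+1) d a : (forall k, A (d + k)%N = A k) ->
  mx_prod A (a * d) = mx_prod A d ^+ a.
Proof.
move=> H; elim: a => [|a IH] //; rewrite mulSn mx_prod_add exprS -IH; congr (_ *m _).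
by congr (mx_prod _ _); apply/funext => k.
Qed.

Lemma char_ser_rotate (F : comNzRingType) N (A : nat -> 'M[F]_N) m : (0 < m)%N -> A m = A 0%N ->
  char_ser (mx_prod (fun i => A i.+1) m) = char_ser (mx_prod A m).
Proof.
move=> m0 Am; have := char_ser_shift (fun=> 1%:M) m0 Am.
have -> : (fun i => A i *m 1%:M) = A by apply/funext => i; rewrite mulmx1.
by have -> : (fun i => 1%:M *m A i.+1) = fun i => A i.+1 by apply/funext => i; rewrite mul1mx.
Qed.

Context {R : realType} {p q : nat} (D : padic_setting R p q) (n : nat).
Hypothesis pp : prime p.
Hypothesis qP : exists2 a : nat, (0 < a)%N & q = (p ^ a)%N.
Local Notation Om := (Om D).
Local Notation absOm := (@absOm _ _ _ D).
Let UO : ultrametric_abs absOm := absOm_ultra D.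
Variables (J : set nat) (B : J -> J -> laurent D n).
Hypothesis HB : nuclear_mx B.
Hypothesis tB : tame B 1.
Local Notation G x d := (fredholm_det (frob_product B x d)).

Lemma frob_ptD (x : 'rV[Om]_n) i j : frob_pt (frob_pt x i) j = frob_pt x (i + j)%N.
Proof. by apply/rowP => l; rewrite !mxE expnD exprM. Qed.

Lemma frob_pt0 (x : 'rV[Om]_n) : frob_pt x 0 = x.
Proof. by apply/rowP => l; rewrite !mxE expn0 expr1. Qed.

Lemma tends_trace x d k : unit_pt x -> (0 < d)%N ->
  tends (abs := absOm) (fun N => \tr (trunc_prod B N x d ^+ k.+1)) (power_sums (G x d) k.+1).
Proof.
move=> ux d0.
apply: (tends_ext (u := fun N => power_sums (fun l => (char_ser (trunc_prod B N x d))`_l) k.+1)).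
  by move=> N; exact: power_sums_char_ser.
apply: (tends_power_sums UO (G := fun N l => (char_ser (trunc_prod B N x d))`_l)).
- by move=> N; exact: char_ser0.
- exact: fredholm_prod0.
by move=> l; exact: tends_char_ser.
Qed.

(** Over [a] periods the product of truncated matrices is the [a]-th power of the product over one
    period, and power sums are limits of traces of powers. *)
Lemma power_sums_period x d a k : unit_pt x -> (0 < d)%N -> frob_pt x d = x -> (0 < a)%N ->
  power_sums (G x (a * d)) k.+1 = power_sums (G x d) (k.+1 * a)%N.
Proof.
move=> ux d0 xd a0.
have ad0 : (0 < a * d)%N by rewrite muln_gt0 a0.
have ka0 : (0 < k.+1 * a)%N by rewrite muln_gt0 a0.
apply: (tends_uniq UO (tends_trace k ux ad0)); rewrite -(prednK ka0).
apply: tends_ext (tends_trace _ ux d0) => N; rewrite prednK // mulnC exprM.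
congr (\tr (_ ^+ _)); apply/esym/mx_prod_period => i; congr (trunc_mx _ _ _).
by rewrite -frob_ptD xd.
Qed.

(** Replacing $x$ by $x^q$ rotates the cyclic product of matrices, which keeps the characteristic
    series of each truncation. *)
Lemma fredholm_frob x m i l : unit_pt x -> (0 < m)%N -> frob_pt x m = x ->
  G (frob_pt x i) m l = G x m l.
Proof.
move=> + m0; elim: i x => [|i IH] x ux xm; first by rewrite frob_pt0.
have ux1 : unit_pt (frob_pt x 1) by exact: unit_frob_pt.
have xm1 : frob_pt (frob_pt x 1) m = frob_pt x 1 by rewrite frob_ptD addnC -frob_ptD xm.
have <- : frob_pt (frob_pt x 1) i = frob_pt x i.+1 by rewrite frob_ptD add1n.
rewrite IH //; apply: (tends_uniq UO (tends_char_ser HB l tB ux1 m0)).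
apply: tends_ext (tends_char_ser HB l tB ux m0) => N.
have E1 := @char_ser_rotate _ _ (fun k => trunc_mx B N (frob_pt x k)) m m0 (congr1 _ (etrans xm (esym (frob_pt0 x)))).
have E2 : trunc_prod B N (frob_pt x 1) m = mx_prod (fun k => trunc_mx B N (frob_pt x k.+1)) m.
  by congr mx_prod; apply/funext => k; rewrite frob_ptD add1n.
by rewrite E2 -[RHS]/((fun P : {poly Om} => P`_l) _) E1.
Qed.
End Periodicity.

(** * Residues of the coefficients and of the unit zeros *)

Section Residues.
Context {R : realType} {p q : nat} (D : padic_setting R p q) (n : nat).
Hypothesis pp : prime p.
Hypothesis qP : exists2 a : nat, (0 < a)%N & q = (p ^ a)%N.
Local Notation K := (K D).
Local Notation Om := (Om D).
Local Notation kOm := (kOm D).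
Local Notation iotaK := (iotaK D).
Local Notation absK := (@absK _ _ _ D).
Local Notation absOm := (@absOm _ _ _ D).
Local Notation red := (@redOm _ _ _ D).
Let UK : ultrametric_abs absK := absK_ultra D.
Let UO : ultrametric_abs absOm := absOm_ultra D.
Let rP : is_residue_map absOm red := redOmP D.
Local Notation linprod s := (\big[@ps_mul Om/@ps_one Om]_(a <- s) ps_lin a).

Lemma red_close x y : absOm y <= 1 -> absOm (x - y) < 1 -> red x = red y.
Proof.
move=> y1 xy; have x1 : absOm (x - y) <= 1 by exact: ltW.
by rewrite -[x](subrK y) (redD rP) // (red_eq0 rP x1).2 // add0r.
Qed.

Lemma red_closeP x y : absOm x <= 1 -> absOm y <= 1 -> red x = red y -> absOm (x - y) < 1.
Proof.
move=> x1 y1 E; apply/(red_eq0 rP); first exact: (absB_le UO).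
have N1 : absOm (- y) <= 1 by rewrite (absN UO).
rewrite (redD rP) // E -(redD rP) // subrr; exact: red_0.
Qed.

(** Integral elements whose residue lies in the field with $q^d$ elements. *)
Definition residue_fixed d (y : Om) : Prop := absOm y <= 1 /\ red y ^+ (q ^ d) = red y.

Lemma residue_fixedD d x y : residue_fixed d x -> residue_fixed d y -> residue_fixed d (x + y).
Proof.
move=> [x1 Ex] [y1 Ey]; split; first exact: (absD_le UO).
by rewrite (redD rP) // exprDn_pchar ?(kOm_pnat D pp qP) // Ex Ey.
Qed.

Lemma residue_fixedM d x y : residue_fixed d x -> residue_fixed d y -> residue_fixed d (x * y).
Proof.
move=> [x1 Ex] [y1 Ey]; split; first exact: (absM_le1 UO).
by rewrite (redM rP) // exprMn Ex Ey.
Qed.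

Lemma residue_fixed_nat d k : residue_fixed d k%:R.
Proof.
split; first exact: (abs_natr UO).
rewrite red_nat; elim: k => [|k IH]; first by rewrite expr0n expn_eq0 gtn_eqF // ltnW // (q_gt1 pp qP).
by rewrite mulrS exprDn_pchar ?(kOm_pnat D pp qP) // expr1n IH.
Qed.

Lemma residue_fixedN d x : residue_fixed d x -> residue_fixed d (- x).
Proof.
move=> [x1 Ex]; have N1 : absOm (- x) <= 1 by rewrite (absN UO).
split=> //; have -> : red (- x) = - red x.
  by apply/eqP; rewrite -addr_eq0 -(redD rP) // addNr red_0.
by rewrite exprNn_pchar ?(kOm_pnat D pp qP) // Ex.
Qed.

Lemma residue_fixed_sum d (I : Type) (r : seq I) (P : pred I) (f : I -> Om) :
  (forall i, P i -> residue_fixed d (f i)) -> residue_fixed d (\sum_(i <- r | P i) f i).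
Proof.
move=> H; elim/big_rec: _ => [|i x Pi]; first exact: (residue_fixed_nat d 0).
by apply: residue_fixedD; exact: H.
Qed.

Lemma residue_fixed_prod d (I : Type) (r : seq I) (P : pred I) (f : I -> Om) :
  (forall i, P i -> residue_fixed d (f i)) -> residue_fixed d (\prod_(i <- r | P i) f i).
Proof.
move=> H; elim/big_rec: _ => [|i x Pi]; first exact: (residue_fixed_nat d 1).
by apply: residue_fixedM; exact: H.
Qed.

Lemma residue_fixed_sign d k : residue_fixed d ((-1) ^+ k).
Proof.
elim: k => [|k IH]; first exact: (residue_fixed_nat d 1).
by rewrite exprS; apply: residue_fixedM => //; apply: residue_fixedN; exact: (residue_fixed_nat d 1).
Qed.

Lemma residue_fixed_det d N (A : 'M[Om]_N) : (forall i j, residue_fixed d (A i j)) -> residue_fixed d (\det A).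
Proof.
move=> H; apply: residue_fixed_sum => s _; apply: residue_fixedM; first exact: residue_fixed_sign.
exact: residue_fixed_prod.
Qed.

Lemma residue_fixed_char_ser d N (A : 'M[Om]_N) m : (forall i j, residue_fixed d (A i j)) ->
  residue_fixed d (char_ser A)`_m.
Proof.
move=> H; rewrite char_ser_coef; apply: residue_fixedM; first exact: residue_fixed_sign.
apply: residue_fixed_sum => S _; apply: residue_fixed_det => i j; rewrite mxE.
by case: ifP => _ //; exact: (residue_fixed_nat d (i == j)).
Qed.

Lemma residue_fixed_iota d (a : K) : absK a <= 1 -> residue_fixed d (iotaK a).
Proof.
move=> a1; have rKP := redKP D; split; first by rewrite absOm_iota.
apply: expr_fix; rewrite -red_exp ?absOm_iota //; apply: red_close; first by rewrite absOm_iota.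
rewrite -rmorphXn -rmorphB absOm_iota.
have aq1 : absK (a ^+ q) <= 1 by exact: (absX_le1 UK).
apply/(red_eq0 rKP); first exact: (absB_le UK).
have N1 : absK (- a) <= 1 by rewrite (absN UK).
have redX k : redK (a ^+ k) = redK a ^+ k.
  elim: k => [|k IH]; first exact: (red1 rKP).
  by rewrite !exprS (redM rKP) ?IH // (absX_le1 UK).
have r0 : redK (0 : K) = 0 by apply/(red_eq0 rKP); rewrite (abs0 UK).
have redN : redK (- a) = - redK a.
  by apply/eqP; rewrite -addr_eq0 -(redD rKP) // addNr r0.
by rewrite (redD rKP) // redX redN -{2}(expf_card (redK a)) card_Fq subrr.
Qed.

Variables (J : set nat) (B : J -> J -> laurent D n).
Hypothesis HB : nuclear_mx B.
Hypothesis tB : tame B 1.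

(** An approximation within $1/2$ has the same residue. A truncated determinant is built from
    elements of $R$, with residues in $\mathbf F_q$, and from Laurent monomials in the coordinates
    of $x$, which are fixed by the $q^d$-th power. *)
Lemma fredholm_residue_fixed x d l : unit_pt x -> (0 < d)%N -> frob_pt x d = x ->
  residue_fixed d (fredholm_det (frob_product B x d) l).
Proof.
move=> ux d0 xd; have h0 : 0 < 2^-1 :> R by rewrite invr_gt0.
have h1 : 2^-1 < 1 :> R by rewrite invf_lt1 // ltr1n.
have [N /(_ N (leqnn _))] := tends_char_ser HB l tB ux d0 h0.
set c := (char_ser _)`_l => Hc.
have [c1 cE] : residue_fixed d c.
  apply: residue_fixed_char_ser; rewrite /trunc_prod.
  have entry k i j : residue_fixed d (trunc_mx B N (frob_pt x k) i j).
    rewrite mxE /trunc_list /leval; case: (insub (i : nat) : option J) => [i'|] /=; last first.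
      by rewrite big_nil; exact: (residue_fixed_nat d 0).
    case: (insub (j : nat) : option J) => [j'|] /=; last by rewrite big_nil; exact: (residue_fixed_nat d 0).
    rewrite big_map; apply: residue_fixed_sum => u _; apply: residue_fixedM.
      by apply: residue_fixed_iota; have /A0P[H _] := HB.1 i' j'; exact: H.
    have uk : unit_pt (frob_pt x k) by exact: unit_frob_pt.
    split; first by rewrite xpow_abs.
    rewrite -red_exp ?xpow_abs //; congr red; rewrite /xpow -prodrXl; apply: eq_bigr => t _.
    rewrite -exprn_exprz; congr (_ ^ _); rewrite !mxE exprAC.
    by have /rowP/(_ t) := xd; rewrite mxE => ->.
  elim: {2}d => [|m IH] i j.
    by rewrite /= mxE; exact: (residue_fixed_nat d (i == j)).
  by rewrite /= mxE; apply: residue_fixed_sum => k _; exact: residue_fixedM.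
have Hc1 : absOm (fredholm_det (frob_product B x d) l - c) < 1.
  by rewrite (absBC UO); exact: le_lt_trans Hc h1.
split; first by apply: (abs_close_le UO (ltW Hc1) c1).
by rewrite (red_close c1 Hc1).
Qed.

Lemma linprod_le1 (s : seq Om) m : (forall a, a \in s -> absOm a = 1) -> absOm (linprod s m) <= 1.
Proof.
move=> s1; rewrite -(expr1n _ m); apply: (ps_prod_bounded UO) => // a i /s1 a1.
by rewrite expr1n; case: i => [|[|i]] /=; rewrite ?(abs1 UO) ?(absN UO) ?a1 ?(abs0 UO).
Qed.

Lemma red_linprod (s : seq Om) m : (forall a, a \in s -> absOm a = 1) ->
  red (linprod s m) = (\prod_(a <- s) (1 - red a *: 'X))`_m.
Proof.
elim: s m => [|a s IH] m s1.
  rewrite !big_nil coef1 /ps_one; case: eqP => _; [exact: (red1 rP)|exact: red_0].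
have a1 : absOm a <= 1 by rewrite s1 ?mem_head.
have s1' b : b \in s -> absOm b = 1 by move=> bs; apply: s1; rewrite inE bs orbT.
rewrite !big_cons ps_mul_lin mulrBl mul1r coefB -scalerAl coefZ coefXM.
have f1 i : absOm (linprod s i) <= 1 by exact: linprod_le1.
pose prev : Om := if m is m'.+1 then linprod s m' else 0.
have p1 : absOm prev <= 1 by rewrite /prev; case: (m) => [|m'] //; rewrite (abs0 UO).
have N1 : absOm (- (a * prev)) <= 1 by rewrite (absN UO) (absM_le1 UO).
rewrite -[X in a * X]/prev (redD rP) // IH //; congr (_ + _).
have -> : red (- (a * prev)) = - red (a * prev).
  by apply/eqP; rewrite -addr_eq0 -(redD rP) // ?addNr ?red_0 // (absM_le1 UO).
rewrite (redM rP) //; congr (- (_ * _)); rewrite /prev; case: (m) => [|m']; first exact: red_0.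
exact: IH.
Qed.

(** Modulo the maximal ideal [G] becomes $g = \prod_b (1 - \bar b X)$. Its coefficients lie in the
    field with $Q = q^d$ elements, so $y \mapsto y^Q$ preserves its finite set of roots; hence the
    orbit of $1/\bar a$ is periodic and $\bar a$ is a root of unity. *)
Lemma unit_zero_torsion d (rho : R) (s : seq Om) (G H : nat -> Om) a : 0 <= rho -> rho < 1 -> (0 < d)%N ->
  (forall b, b \in s -> absOm b = 1) -> (forall l, residue_fixed d (G l)) ->
  H 0%N = 1 -> (forall m, absOm (H m) <= rho ^+ m) -> G = ps_mul (linprod s) H ->
  a \in s -> exists2 E, (0 < E)%N & absOm (a ^+ E - 1) < 1.
Proof.
move=> r0 r1 d0 s1 GF H1 Hle GH aS; set Q := (q ^ d)%N.
pose g : {poly kOm} := \prod_(b <- s) (1 - red b *: 'X).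
have gl l : g`_l = red (G l).
  have ll1 : absOm (linprod s l) <= 1 by exact: linprod_le1.
  rewrite -red_linprod //; apply/esym/red_close => //.
  rewrite GH /ps_mul big_ord_recr /= subnn H1 mulr1 addrK.
  apply: (@le_lt_trans _ _ rho) => //; apply: (abs_sum_le UO) => // i _.
  rewrite (absM UO) -[leRHS]mul1r; apply: ler_pM; rewrite ?(abs_ge0 UO) ?linprod_le1 //.
  apply: le_trans (Hle _) _; have := ltn_ord i; rewrite -subn_gt0; case: (l - i)%N => // k _.
  by rewrite exprS ler_piMr // exprn_ile1 // ltW.
have gQ y : root g y -> root g (y ^+ Q).
  rewrite /root !horner_coef => /eqP gy.
  have -> : \sum_(i < size g) g`_i * (y ^+ Q) ^+ i = (\sum_(i < size g) g`_i * y ^+ i) ^+ Q.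
    have Qn : [pchar kOm].-nat Q by exact: kOm_pnat.
    rewrite (big_morph (fun t : kOm => t ^+ Q) (id1 := 0) (op1 := +%R)).
    - by apply: eq_bigr => i _; rewrite exprMn exprAC gl (GF i).2.
    - by move=> u v; rewrite exprDn_pchar.
    - by rewrite expr0n gtn_eqF // expn_gt0 ltnW // (q_gt1 pp qP).
  by rewrite gy expr0n gtn_eqF // expn_gt0 ltnW // (q_gt1 pp qP).
have a1 : absOm a = 1 by exact: s1.
have rb0 b : b \in s -> red b != 0.
  by move=> /s1 b1; apply/eqP => /(red_eq0 rP); rewrite b1 lexx ltxx => /(_ isT).
have rootE y : root g y -> y \in [seq (red b)^-1 | b <- s].
  rewrite /root /g horner_prod prodf_seq_eq0 => /hasP[b bs].
  rewrite /= !hornerE subr_eq0 => /eqP by1; apply/mapP; exists b => //.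
  by rewrite -[y]mul1r -(mulVf (rb0 b bs)) -mulrA -by1 mulr1.
pose y := (red a)^-1; have y0 : y != 0 by rewrite invr_eq0 rb0.
have gy : root g y.
  rewrite /root /g horner_prod prodf_seq_eq0; apply/hasP; exists a => //=.
  by rewrite !hornerE mulfV ?rb0 // subrr.
have giter j : root g (y ^+ (Q ^ j)).
  by elim: j => [|j IH]; rewrite ?expn0 ?expr1 // expnSr exprM gQ.
(* Pigeonhole: the first [size s + 1] iterates lie among at most [size s] roots. *)
have /(uniqPn 0)[i [j [ij]]] : ~~ uniq (mkseq (fun j => y ^+ (Q ^ j)) (size s).+1).
  apply/negP => Us; have : {subset mkseq (fun j => y ^+ (Q ^ j)) (size s).+1 <= [seq (red b)^-1 | b <- s]}.
    by move=> t /mapP[j _ ->]; exact: rootE.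
  by move=> /(uniq_leq_size Us); rewrite size_mkseq size_map ltnn.
rewrite size_mkseq => jS; rewrite !nth_mkseq ?(ltn_trans ij jS) // => Eij.
(* Powers of Frobenius are injective in characteristic $p$, so the common exponent $Q^i$ can be
   cancelled. *)
have yE : y = y ^+ (Q ^ (j - i)).
  apply: (@kOm_expr_inj _ _ _ D pp qP (d * i)) => /=.
  by rewrite -exprM expnM -/Q Eij -expnD subnK // ltnW.
have Q1 : (1 < Q ^ (j - i))%N.
  by rewrite -expnM -(expn0 q) ltn_exp2l ?(q_gt1 pp qP) // muln_gt0 d0 subn_gt0.
exists (Q ^ (j - i) - 1)%N; first by rewrite subn_gt0.
apply: red_closeP; rewrite ?(absX UO) ?a1 ?expr1n ?(abs1 UO) //.
rewrite red_exp ?a1 // (red1 rP); apply: invr_inj; rewrite -exprVn -/y invr1.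
by apply: (mulfI y0); rewrite -exprS subn1 prednK ?(ltnW Q1) // mulr1 -yE.
Qed.
End Residues.

(** * The unit root zeta function *)

Section UnitRootMeromorphy.
Context {R : realType} {p q : nat} (D : padic_setting R p q) (n : nat).
Hypothesis pp : prime p.
Hypothesis qP : exists2 a : nat, (0 < a)%N & q = (p ^ a)%N.
Local Notation K := (K D).
Local Notation Om := (Om D).
Local Notation kOm := (kOm D).
Local Notation iotaK := (iotaK D).
Local Notation absK := (@absK _ _ _ D).
Local Notation absOm := (@absOm _ _ _ D).
Let UK : ultrametric_abs absK := absK_ultra D.
Let UO : ultrametric_abs absOm := absOm_ultra D.
Local Notation tc := (@teich _ _ _ D n).
Local Notation eps := (p%:R^-1 : R).
Let e0 : 0 < eps. Proof. exact: pV_gt0. Qed.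
Let e1 : eps < 1. Proof. exact: pV_lt1. Qed.
Variables (J : set nat) (B : J -> J -> laurent D n) (rho : R).
Hypothesis HB : nuclear_mx B.
Hypothesis rho1 : 1 < rho.
Hypothesis tB : forall r, 1 <= r -> r < rho -> tame B r.
Let tB1 : tame B 1. Proof. exact: tB. Qed.
Variable z : nat -> Om.
Hypothesis zP : forall m, (0 < m)%N -> (q ^ m - 1).-primitive_root (z m).
Local Notation Gx x d := (fredholm_det (frob_product B x d)).
Local Notation cps m := (fset_set (@closed_points _ _ _ D n m)).
Local Notation linprod s := (\big[@ps_mul Om/@ps_one Om]_(a <- s) ps_lin a).
Variables (s : set 'rV[kOm]_n -> seq Om) (H : set 'rV[kOm]_n -> nat -> Om).
Let G P := fredholm_at B P.
Hypothesis s1 : forall P a, closed_point P -> a \in s P -> absOm a = 1.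
Hypothesis Hle : forall P m, closed_point P -> absOm (H P m) <= (eps ^+ degree P) ^+ m.
Hypothesis GH : forall P, closed_point P -> G P = ps_mul (linprod (s P)) (H P).

(** The contribution of [P] to the logarithmic derivative of $L(\phi_0^k, T)$; [rest_part] is its
    analogue for the reciprocal zeros of [H P]. *)
Definition unit_part k P m : Om :=
  \sum_(a <- s P) (if (degree P %| m)%N then (a ^+ k) ^+ (m %/ degree P) *+ degree P else 0).

Definition rest_part k P m : Om :=
  if (degree P %| m)%N then power_sums (H P) (k * (m %/ degree P))%N *+ degree P else 0.

Definition full_sum k m : Om :=
  \sum_(e : {ffun 'I_n -> 'I_(q ^ m - 1)}) power_sums (Gx (root_pt (z m) e) m) k.

Let cpsP m P : P \in cps m -> closed_point P.
Proof. by rewrite (in_fset_set (finite_closed_points n pp qP zP m)) => /set_mem[]. Qed.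

Let deg_gt0 (P : set 'rV[kOm]_n) : closed_point P -> (0 < degree P)%N.
Proof. by case/(teichP pp qP zP). Qed.

Let H0 P : closed_point P -> H P 0%N = 1.
Proof.
move=> cP; have [d0 ux _] := teichP pp qP zP cP.
have : G P 0%N = 1 by exact: (fredholm_prod0 HB ux d0 tB1).
by rewrite GH // /ps_mul big_ord1 ps_lin_prod0 mul1r.
Qed.

Lemma power_sums_split P k : closed_point P ->
  power_sums (G P) k.+1 = \sum_(a <- s P) a ^+ k.+1 + power_sums (H P) k.+1.
Proof. by move=> cP; rewrite GH // power_sums_mul ?ps_lin_prod0 ?H0 // power_sums_lin. Qed.

(** A point of level $m$ over [P] gives the determinant of the $(m/\deg P)$-th power of the
    Frobenius matrix at [P], so its power sum of index $k$ is that of [G P] of index $km/\deg P$.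
    There are $\deg P$ such points. *)
Lemma full_sumE k m : (0 < k)%N -> (0 < m)%N ->
  full_sum k m = \sum_(P <- cps m) (unit_part k P m + rest_part k P m).
Proof.
case: k => [|k] k0 m0; first by rewrite ltnn in k0.
rewrite /full_sum (sum_root_pt pp qP zP (v := fun P => power_sums (G P) (k.+1 * (m %/ degree P))%N) m0).
  apply: eq_big_seq => P /cpsP cP; have d0 := deg_gt0 cP; rewrite /unit_part /rest_part.
  case: ifP => dm; last by rewrite big1 ?addr0.
  have j0 : (0 < k.+1 * (m %/ degree P))%N by rewrite muln_gt0 /= divn_gt0 // (dvdn_leq m0 dm).
  rewrite -(prednK j0) power_sums_split // (prednK j0) mulrnDl -sumrMnl; congr (_ + _).
  by apply: eq_bigr => a _; rewrite exprM.
move=> e; set P := frob_orbit _.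
have cP : closed_point P by exists (root_red z e) => //; exact: (root_red_geom pp qP zP).
have [d0 uy yd] := teichP pp qP zP cP; have [i yE] := teich_orbit pp qP zP e m0; rewrite -/P in yE.
have [_ _ Hd] := frob_orbitP pp qP (root_red_geom pp qP zP e m0).
have dm : (degree P %| m)%N by apply/Hd; exact: (root_red_fix pp qP zP e m0).2.
have ux := unit_root_pt e m0 (zP m0); have xm := frob_root_pt pp qP zP e m0.
have a0 : (0 < m %/ degree P)%N by rewrite divn_gt0 // dvdn_leq.
have E1 : Gx (root_pt (z m) e) m = Gx (tc P) m.
  by rewrite yE; apply/funext => l; apply/esym; exact: (fredholm_frob HB tB1).
rewrite E1 -{1}(divnK dm); exact: (power_sums_period HB tB1).
Qed.

Lemma full_sum_mero k : (0 < k)%N -> mero (D := D) rho (full_sum k).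
Proof. by move=> k0; apply: (mero_full pp qP HB rho1 tB zP). Qed.

(* The contribution of the unit zeros is the limit of the full sums for the
   exponents k + E p^t, since a^E is congruent to 1 for every unit zero a. *)
Lemma unit_sum_rational k m : (0 < k)%N -> (0 < m)%N ->
  exists l, \sum_(P <- cps m) unit_part k P m = iotaK l.
Proof.
move=> k0 m0.
(* Only the finitely many closed points of degree at most [m] occur, so one exponent serves all
   their unit zeros. *)
have [E E0 HE] : exists2 E, (0 < E)%N & forall P a, P \in cps m -> a \in s P -> absOm (a ^+ E - 1) < 1.
  have [a|a|E E0 HE] := @common_torsion _ _ _ UO (flatten [seq s P | P <- cps m]).
  - by move=> /flatten_mapP[P /cpsP cP aP]; rewrite (s1 cP aP).
  - move=> /flatten_mapP[P /cpsP cP aP]; have [d0 ux xd] := teichP pp qP zP cP.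
    apply: (unit_zero_torsion pp qP (rho := eps ^+ degree P) _ _ d0 _ _ _ _ (GH cP) aP).
    + by rewrite exprn_ge0 // ltW.
    + by rewrite exprn_ilt1 ?(ltW e0) // -lt0n.
    + by move=> b bP; exact: s1 cP bP.
    + by move=> l; exact: (fredholm_residue_fixed pp qP HB tB1).
    + exact: H0.
    + by move=> l; exact: Hle.
  by exists E => // P a Pm aP; apply: HE; apply/flatten_mapP; exists P.
pose kt t := (k + E * p ^ t)%N; have kt0 t : (0 < kt t)%N by rewrite addn_gt0 k0.
have /choice[w Hw] : forall t, exists w, full_sum (kt t) m = iotaK w.
  by move=> t; have [f [g [_ _ Hf]]] := full_sum_mero (kt0 t); exists (f m - g m); exact: Hf.
have T : tends (abs := absOm) (fun t => full_sum (kt t) m) (\sum_(P <- cps m) unit_part k P m).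
  apply: (tends_ext (u := fun t => \sum_(P <- cps m) (unit_part (kt t) P m + rest_part (kt t) P m))).
    by move=> t; rewrite full_sumE.
  apply: (tends_sum UO) => P Pm; have cP := cpsP Pm; have d0 := deg_gt0 cP.
  rewrite -[X in tends _ X]addr0; apply: (tendsD UO); rewrite /unit_part /rest_part.
    apply: (tends_sum UO) => a aP; case: ifP => _; last exact: (tends_cst UO).
    rewrite -mulr_natr; apply: (tends_ext (u := fun t => (a ^+ kt t) ^+ (m %/ degree P) * (degree P)%:R)).
      by move=> t; rewrite mulr_natr.
    apply: (tendsM UO); last exact: (tends_cst UO).
    apply: (tendsX UO); rewrite -[X in tends _ X]mulr1.
    apply: (tends_ext (u := fun t => a ^+ k * (a ^+ E) ^+ (p ^ t))).
      by move=> t; rewrite exprD exprM.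
    apply: (tendsM UO); first exact: (tends_cst UO).
    apply: (tends_expr_p UO); [exact: absOm_p_lt1|exact: HE aP].
  case: (boolP (degree P %| m)%N) => dm; last exact: (tends_cst UO).
  have r0 : 0 <= eps ^+ degree P by rewrite exprn_ge0 // ltW.
  have r1 : eps ^+ degree P < 1 by rewrite exprn_ilt1 ?(ltW e0) // -lt0n.
  (* The power sum of index $j$ of [H P] is at most $(p^{-\deg P})^j$, and here $j \ge k + E p^t \ge
     t$. *)
  apply: (tends_geometric r0 r1) => t; rewrite subr0; apply: le_trans (abs_mulrn UO _ _) _.
  have a0 : (0 < m %/ degree P)%N by rewrite divn_gt0 // dvdn_leq.
  have j0 : (0 < kt t * (m %/ degree P))%N by rewrite muln_gt0 kt0.
  have := power_sums_bound UO (kt t * (m %/ degree P)).-1 r0 (H0 cP) (fun l => Hle l cP).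
  rewrite prednK // => /le_trans; apply; apply: ler_wiXn2l => //; first exact: ltW.
  apply: leq_trans (ltnW (ltn_expl t (prime_gt1 pp))) _.
  apply: (@leq_trans (kt t)); last by rewrite leq_pmulr.
  by apply: leq_trans (leq_addl _ _); rewrite leq_pmull.
have [|l -> _] := @iota_closed _ _ _ D pp w (\sum_(P <- cps m) unit_part k P m); last by exists l.
by apply: tends_ext T => t; rewrite Hw.
Qed.

(** The bound of [small_factor_euler] does not involve the degree of the point, so it holds for the
    whole product. *)
Lemma rest_sum_series k : (0 < k)%N -> exists phi,
  ps_log_deriv (fun m => \sum_(P <- cps m) rest_part k P m) phi /\
  forall m, absOm (phi m) <= (eps ^+ k) ^+ m.
Proof.
move=> k0.
have /choice[phi Hphi] : forall P, exists phi, closed_point P ->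
    ps_log_deriv (rest_part k P) phi /\ forall m, absOm (phi m) <= (eps ^+ k) ^+ m.
  move=> P; case: (pselect (closed_point P)) => [cP|nP]; last by exists (fun=> 0).
  have [phi [H1 H2]] := small_factor_euler pp e0 k0 (deg_gt0 cP) (H0 cP) (fun m => Hle m cP).
  by exists phi => _.
exists (fun m => (\big[@ps_mul Om/@ps_one Om]_(P <- cps m) phi P) m); split.
  apply: (ps_log_deriv_euler_product (@Om_char0 _ _ _ D pp) (C := @closed_point _ _ _ D n) (deg := @degree _ _ _ D n)).
  - exact: (finite_closed_points n pp qP zP).
  - by move=> P cP; have [] := Hphi P cP.
  by move=> P m cP /andP[m0 md]; rewrite /rest_part gtnNdvd.
move=> m; apply: (ps_prod_bounded UO); first by rewrite exprn_ge0 // ltW.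
by move=> P l /cpsP cP; have [_] := Hphi P cP.
Qed.

(** Full and unit sums have values in $K$, hence so has their difference, and its exponential
    descends to $K$ with coefficients at most $p^{-km}$. It is bounded at every radius below $\rho
    \le p^k$, which is where the restriction by $k$ originates. *)
Lemma unit_sum_mero k : (0 < k)%N -> rho <= p%:R ^+ k ->
  mero (D := D) rho (fun m => \sum_(P <- cps m) unit_part k P m).
Proof.
move=> k0 rk; have [phi [Hphi phile]] := rest_sum_series k0.
have splitE m : (0 < m)%N -> \sum_(P <- cps m) rest_part k P m =
    full_sum k m - \sum_(P <- cps m) unit_part k P m.
  by move=> m0; rewrite full_sumE // big_split /= addrAC subrr add0r.
have [f [g [_ _ Hf]]] := full_sum_mero k0.
have /choice[w Hw] : forall m, exists w, (0 < m)%N -> \sum_(P <- cps m) rest_part k P m = iotaK w.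
  move=> [|m]; first by exists 0.
  have [l Hl] := unit_sum_rational k0 (ltn0Sn m).
  by exists (f m.+1 - g m.+1 - l) => _; rewrite splitE // Hl Hf // !rmorphB.
have Mw : mero (D := D) rho (fun m => \sum_(P <- cps m) rest_part k P m).
  have [h Hh] := ps_log_deriv_exists (@K_char0 _ _ _ D pp) w.
  have hE m : iotaK (h m) = phi m.
    apply: (ps_log_deriv_uniq (@Om_char0 _ _ _ D pp) _ (ps_log_deriv_map iotaK Hh) Hphi).
    by move=> i /andP[i0 _]; rewrite /= Hw.
  exists w, (fun=> 0); split; first exists h => //; last first.
  - by move=> m m0; rewrite Hw // subr0.
  - exact: bounded_ld0.
  move=> r r1 rr; exists 1 => m; have r0 : 0 <= r by exact: le_trans r1.
  rewrite -absOm_iota hE; apply: (@le_trans _ _ ((eps ^+ k * r) ^+ m)).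
    by rewrite exprMn ler_wpM2r ?exprn_ge0.
  apply: exprn_ile1; first by rewrite mulr_ge0 ?exprn_ge0 ?(ltW e0).
  have p0 : 0 < p%:R ^+ k :> R by rewrite exprn_gt0 // ltr0n prime_gt0.
  rewrite exprVn mulrC ler_pdivrMr // mul1r.
  exact: le_trans (ltW rr) rk.
apply: mero_eq (meroD (full_sum_mero k0) (meroN Mw)) => m m0.
by rewrite splitE // subKr.
Qed.
End UnitRootMeromorphy.

(** * Return to quotients of power series *)

Section Conclusion.
Context {R : realType} {p q : nat} (D : padic_setting R p q).
Hypothesis pp : prime p.
Local Notation K := (K D).
Local Notation Om := (Om D).
Local Notation iotaK := (iotaK D).
Local Notation absK := (@absK _ _ _ D).
Let UK : ultrametric_abs absK := absK_ultra D.

Lemma bounded_ps_converges (rho : R) (f : nat -> K) : 1 < rho ->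
  (forall r, 1 <= r -> r < rho -> exists A : R, forall m, absK (f m) * r ^+ m <= A) ->
  ps_converges rho f.
Proof.
(* A bound at a larger radius gives geometric decay at [r]. The midpoint is raised to 1 because
   bounds are given only from radius 1 on. *)
move=> rho1 Hf r r0 rr; pose r' := Num.max 1 ((r + rho) / 2).
have rr' : r < r' by rewrite /r' lt_max midf_lt // orbT.
have r'1 : 1 <= r' by rewrite /r' le_max lexx.
have r'rho : r' < rho by rewrite /r' gt_max rho1 midf_lt.
have r'0 : 0 < r' by exact: lt_le_trans r'1.
have [A HA] := Hf r' r'1 r'rho.
have x1 : `|r / r'| < 1 by rewrite ger0_norm ?divr_ge0 ?(ltW r'0) // ltr_pdivrMr // mul1r.
apply: (@squeeze_cvgr _ _ _ _ (fun=> 0) (fun m => A * (r / r') ^+ m)).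
- near=> m; rewrite mulr_ge0 ?(abs_ge0 UK) ?exprn_ge0 //=.
  have -> : absK (f m) * r ^+ m = absK (f m) * r' ^+ m * (r / r') ^+ m.
    by rewrite -mulrA -exprMn mulrCA mulfV ?mulr1 // gt_eqF.
  by rewrite ler_wpM2r ?exprn_ge0 ?divr_ge0 ?(ltW r'0).
- exact: cvg_cst.
rewrite -(mulr0 A); exact: cvgM (cvg_cst A) (cvg_expr x1).
Unshelve. all: by end_near. Qed.

(** A series with constant term 1 is determined by its logarithmic derivative, so $S = s - t$
    becomes $gL = f$. *)
Lemma mero_log_deriv (rho : R) (S L : nat -> Om) : 1 < rho -> mero (D := D) rho S -> ps_log_deriv S L ->
  meromorphic_in_disc rho L.
Proof.
move=> rho1 [s [t [[f Hf bf] [g Hg bg] SE]]] HL; exists f, g; split.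
- exact: bounded_ps_converges.
- exact: bounded_ps_converges.
- by exists 0%N; rewrite Hg.1 oner_neq0.
apply/funext => m; apply: (ps_log_deriv_uniq (@Om_char0 _ _ _ D pp) _
  (ps_log_deriv_mul (ps_log_deriv_map iotaK Hg) HL) (ps_log_deriv_map iotaK Hf)).
by move=> i /andP[i0 _]; rewrite /= SE // -rmorphD addrC subrK.
Qed.
End Conclusion.

Theorem theorem4p10 (R : realType) (p q : nat) (D : padic_setting R p q)
    (n : nat) (c : \bar R) (M : nuclear_sigma_module D n) (k : nat) :
  prime p ->
  (exists2 a : nat, (0 < a)%N & q = (p ^ a)%N) ->
  (0 < n)%N ->
  (0 < c)%E ->
  log_convergent M c ->
  ordinary_slope0 M ->
  (0 < k)%N ->
  meromorphic_in_disc (p%:R `^ fine (Order.min (k%:R%:E) c)) (unit_root_L M k).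
Proof.
move=> pp qP n0 c0 [J1 [f1 [B1 [Bf1 HB1 cB1]]]] [J2 [f2 [B2 [h0 [Bf2 HB2 Hh0 ord]]]]] k0.
have UO := absOm_ultra D.
have q1 := q_gt1 pp qP; have q0 := ltnW q1.
have p1 : 1 < p%:R :> R by exact: p_gt1R.
have p0 : 0 < p%:R :> R by exact: lt_trans p1.
have lp0 : 0 < ln p%:R :> R by rewrite ln_gt0.
have e0 : 0 < p%:R^-1 :> R by exact: pV_gt0.
have e1 : p%:R^-1 < 1 :> R by exact: pV_lt1.
(* The minimum is a real number even for $c = \infty$, so [fine] takes its actual value. *)
have [m0 m0E [m0_gt0 m0k m0c]] : exists2 m0 : R, Order.min (k%:R%:E) c = m0%:E &
    [/\ 0 < m0, m0 <= k%:R & (m0%:E <= c)%E].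
  have kR0 : 0 < k%:R :> R by rewrite ltr0n.
  case: c c0 {cB1} => [c| |] //= c0; last first.
    by exists k%:R; [rewrite min_l ?leey|split; rewrite ?leey].
  exists (Num.min k%:R c); first by rewrite EFin_min.
  by rewrite lt_min kR0 -lte_fin c0 ge_min lexx lee_fin ge_min lexx orbT.
rewrite m0E /=; set rho := p%:R `^ m0.
have rho1 : 1 < rho by rewrite -ltr_ln ?posrE ?powR_gt0 // ln1 ln_powR mulr_gt0.
have NB1 : nuclear_mx B1 by exact: mx_nuclear Bf1 HB1.
have NB2 : nuclear_mx B2 by exact: mx_nuclear Bf2 HB2.
(* Write $r = p^l$. Since $l < m_0 \le c$, there is room for the two exponents $l < g_0 < g_1 < m_0$
   that [log_convergent_tame] requires. *)
have tB r : 1 <= r -> r < rho -> tame B1 r.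
  move=> r1 rr; have r0 : 0 < r by exact: lt_le_trans r1.
  pose l := ln r / ln p%:R; have l0 : 0 <= l by rewrite divr_ge0 ?ln_ge0 // ltW.
  have lm : l < m0.
    by rewrite /l ltr_pdivrMr // -ln_powR ltr_ln ?posrE // powR_gt0.
  apply: (log_convergent_tame pp q1 NB1 cB1 (g0 := (l + m0) / 2) (g1 := ((l + m0) / 2 + m0) / 2)).
  - lra.
  - lra.
  - by apply: lt_le_trans m0c; rewrite lte_fin; lra.
  rewrite -ltr_ln ?posrE ?powR_gt0 // ln_powR -ltr_pdivrMr // -/l; lra.
have /choice[z zP] : forall m, exists z : Om D, (0 < m)%N -> (q ^ m - 1).-primitive_root z.
  move=> [|m]; first by exists 0.
  have N0 : (q ^ m.+1 - 1)%N%:R != 0 :> Om D.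
    have : (0 < q ^ m.+1 - 1)%N by rewrite subn_gt0 -(expn0 q) ltn_exp2l.
    by case: (q ^ m.+1 - 1)%N => // N _; exact: Om_char0.
  by have [z Hz] := prim_root_exists N0; exists z.
(* Log-convergence and ordinarity each come with a basis of their own, and the zeta function is
   defined by the standard one; the three are compared only through their Fredholm determinants at
   closed points. *)
pose std := @std_matrix _ _ _ D n M.
have std1 P : closed_point P -> fredholm_at std P = fredholm_at B1 P.
  move=> cP; have [d0 ux xd] := teichP pp qP zP cP.
  by apply/funext => l; exact: (fredholm_basis pp q0 l Bf1 HB1 ux d0 xd).
have std2 P : closed_point P -> fredholm_at std P = fredholm_at B2 P.
  move=> cP; have [d0 ux xd] := teichP pp qP zP cP.
  by apply/funext => l; exact: (fredholm_basis pp q0 l Bf2 HB2 ux d0 xd).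
pose s P := unit_recip_zeros (fredholm_at std P).
have Hs P : closed_point P -> is_unit_recip_zeros (fredholm_at std P) (s P) /\ size (s P) = h0.
  move=> cP; have [t] := ord P cP; rewrite -std2 // => Ht <-; exact: unit_recip_zerosP.
have /choice[H HH] : forall P, exists H, closed_point P ->
    (forall m, absOm (H m) <= (p%:R^-1 ^+ degree P) ^+ m) /\
    fredholm_at B1 P = ps_mul (\big[@ps_mul (Om D)/@ps_one (Om D)]_(a <- s P) ps_lin a) H.
  move=> P; case: (pselect (closed_point P)) => [cP|nP]; last by exists (fun=> 0).
  have [d0 ux xd] := teichP pp qP zP cP; have [Hz sz] := Hs P cP.
  (* The shift [h0] in [fredholm_slope] equals the number of unit zeros; this equality is what
     ordinarity provides, and removing the zeros uses up the shift exactly. *)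
  have [||m|H [H1 H2]] := unit_zeros_factor (rho := p%:R^-1 ^+ degree P) _ _ Hz.
  - by rewrite exprn_ge0 // ltW.
  - by rewrite exprn_ilt1 ?(ltW e0) // -lt0n.
  - rewrite sz std2 //; apply: fredholm_slope => //; first exact: basis_pos Bf2.
    by move=> i j hj u; apply: (zero_mod_pi_col pp i u Bf2 HB2); exact: Hh0.1.
  by exists H => _; split=> //; rewrite -std1.
have rk : rho <= p%:R ^+ k.
  by rewrite /rho -powR_mulrn ?(ltW p0) // ler_powR // ltW.
have := unit_sum_mero pp qP NB1 rho1 tB zP (s := s) (H := H) _ _ _ k0 rk.
move=> /(_ (fun P a cP aP => (Hs P cP).1.1 a aP) (fun P m cP => (HH P cP).1 m) (fun P cP => (HH P cP).2)).
move=> Hm; apply: (mero_log_deriv pp rho1 Hm).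
have -> : unit_root_L M k = fun m => (\big[@ps_mul (Om D)/@ps_one (Om D)]_(P <-
    fset_set (@closed_points _ _ _ D n m)) euler_factor M k P) m.
  by apply/funext => m; rewrite /unit_root_L fsbig_finite //; exact: finite_closed_points zP m.
apply: (ps_log_deriv_euler_product (@Om_char0 _ _ _ D pp) (C := @closed_point _ _ _ D n) (deg := @degree _ _ _ D n)).
- exact: (finite_closed_points n pp qP zP).
- move=> P cP; have [d0 _ _] := teichP pp qP zP cP.
  by apply: ps_log_deriv_big => a; exact: ps_log_deriv_euler.
by move=> P m cP /andP[m1 md]; rewrite /unit_part big1 // => a _; rewrite gtnNdvd.
Qed.
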